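(* Let $W^{(1)},W^{(2)},\ldots$ be an infinite sequence of finite Coxeter groups such that $W^{(n)}$ has rank $n$ and maximal degree $d_n$. Let $X^{(n)}$ be the number of $W^{(n)}$-inversions of a uniformly random element of $W^{(n)}$, with variance $s_n^2$. Then $X^{(n)}$ satisfies the CLT if and only if $d_n/s_n\to0$ as $n\to\infty$.
   Context: For a finite Coxeter group with root system $\Phi=\Phi^+\sqcup\Phi^-$, the number of inversions of $w$ is $\#\{\beta\in\Phi^+ : w(\beta)\in\Phi^-\}$. Degrees are those of the basic invariants (multiset union over irreducible components). A sequence of random variables $X^{(n)}$ satisfies the CLT if $(X^{(n)}-\mathbb{E}X^{(n)})/\sqrt{\mathbb{V}X^{(n)}}$ converges in distribution to the standard normal $N(0,1)$. *)

(* Defs.v *)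
From HB Require Import structures.
From mathcomp Require Import all_boot all_order all_algebra.
From mathcomp Require Import mpoly.
From mathcomp Require Import all_classical all_reals all_analysis.

Set Implicit Arguments.
Unset Strict Implicit.
Unset Printing Implicit Defensive.

Import Order.TTheory GRing.Theory Num.Theory.
Import numFieldNormedType.Exports.
Local Open Scope classical_set_scope.
Local Open Scope ring_scope.

Section Coxeter.
Variable R : realType.
Variable n : nat.

Definition refl (a : 'cV[R]_n) : 'M[R]_n :=
  1%:M - (2 / (a^T *m a) 0 0) *: (a *m a^T).

Definition is_reflection (t : 'M[R]_n) : Prop :=
  exists a : 'cV[R]_n, a != 0 /\ t = refl a.

(** A finite Coxeter group of rank n, in its (essential) geometric realisation
    as a finite reflection group in R^n, given by the duplicate-free list W of
    its elements: W contains 1, is closed under products (hence, being finite,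
    a group), every element is a product of reflections lying in W, and W
    fixes no nonzero vector (so the roots span R^n, i.e. the rank is n). *)
Definition finite_coxeter_group_rank (W : seq 'M[R]_n) : Prop :=
  [/\ uniq W,
      1%:M \in W,
      (forall g h, g \in W -> h \in W -> g *m h \in W),
      (forall g, g \in W -> exists s : seq 'M[R]_n,
          (forall t, t \in s -> t \in W /\ is_reflection t) /\
          g = foldr (@mulmx R n n n) 1%:M s)
    & (forall x : 'cV[R]_n, (forall g, g \in W -> g *m x = x) -> x = 0)].

(** The roots of W are the nonzero vectors a with refl a \in W.  A positive
    system Phi^+ is determined by a vector v with <v,a> <> 0 for every root:
    Phi^+ = {a root | <v,a> > 0}. *)
Definition generic_for (W : seq 'M[R]_n) (v : 'cV[R]_n) : Prop :=
  forall a : 'cV[R]_n, a != 0 -> refl a \in W -> (v^T *m a) 0 0 != 0.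

(** Number of inversions of w: the number of positive roots (counted up to
    positive scaling, i.e. one per reflection of W) sent by w to negative
    roots. *)
Definition ninv (W : seq 'M[R]_n) (v : 'cV[R]_n) (w : 'M[R]_n) : nat :=
  count (fun t => `[< exists a : 'cV[R]_n,
                       [/\ a != 0, t = refl a, 0 < (v^T *m a) 0 0
                         & (v^T *m (w *m a)) 0 0 < 0] >]) W.

Definition invariant_poly (W : seq 'M[R]_n) (p : mpoly.mpoly n R) : Prop :=
  forall g, g \in W -> forall x : 'cV[R]_n,
    mpoly.meval (fun i => (g *m x) i 0) p = mpoly.meval (fun i => x i 0) p.

Definition homogeneous_of_degree (k : nat) (p : mpoly.mpoly n R) : bool :=
  all (fun m => mpoly.mdeg m == k) (mpoly.msupp p).

Definition max_degree (W : seq 'M[R]_n) (d : nat) : Prop :=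
  exists (f : 'I_n -> mpoly.mpoly n R) (e : 'I_n -> nat),
    [/\ (forall i, f i != 0 /\ homogeneous_of_degree (e i) (f i)),
        (forall i, invariant_poly W (f i)),
        (forall p, invariant_poly W p ->
           exists q : mpoly.mpoly n R,
             p = mpoly.comp_mpoly [tuple f i | i < n] q)
      & d = (\max_(i < n) e i)%N].

Definition inv_mean (W : seq 'M[R]_n) v : R :=
  (\sum_(w <- W) (ninv W v w)%:R) / (size W)%:R.

Definition inv_var (W : seq 'M[R]_n) v : R :=
  (\sum_(w <- W) ((ninv W v w)%:R - inv_mean W v) ^+ 2) / (size W)%:R.

Definition std_inv_cdf (W : seq 'M[R]_n) v (x : R) : R :=
  (count (fun w => ((ninv W v w)%:R - inv_mean W v) / Num.sqrt (inv_var W v) <= x) W)%:R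
  / (size W)%:R.

End Coxeter.

Definition std_normal_cdf {R : realType} (x : R) : R :=
  fine (normal_prob 0 1 `]-oo, x]%classic).

(** CLT for the inversion statistic: convergence in distribution of the
    standardised variables to N(0,1), i.e. pointwise convergence of the
    distribution functions (the limit cdf is continuous everywhere). *)
Definition satisfies_CLT {R : realType}
    (W : forall n, seq 'M[R]_n) (v : forall n, 'cV[R]_n) : Prop :=
  forall x : R, (fun n => std_inv_cdf (W n) (v n) x) @ \oo --> std_normal_cdf x.

(* Main.v *)
(** The inversion polynomial of a finite reflection group W with degrees
    e_1, ..., e_n is sum_w X^(inv w) = prod_i (1 + X + ... + X^(e_i - 1)), so the
    inversion number is a sum of independent uniform variables on {0, ..., e_i - 1}.

    For this identity, let h_H(K) be the dimension of the H-invariant polynomials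
    of degree < K.  Solomon's alternating sum over the parabolic subgroups of H
    expresses the space of skew invariants (the invariants times the product of
    the positive root forms) through the h of the parabolics; induction on |H|
    then shows that the product of the inversion polynomial of H and the generating
    function of h_H is that of the dimensions of all polynomials of degree < K.
    Homogeneous generators f_i of the invariants give h_W(K) <= #{m : sum e_i m_i < K},
    and an algebraic relation among them would make h_W grow slower than K^n; hence
    equality, which is the identity.

    If d_n / s_n -> 0, replace the uniform variables one at a time by Gaussian ones
    of the same variance, testing against x |-> Phi ((A - x) / sqrt t), which solves
    the heat equation.  Conversely, the standardised sum has fourth moment
    3 - sum_i (e_i^4 - 1) / (120 s_n^4) and sixth moment at most 15, so its fourth
    moment converges under the CLT, to the limit 3 of the fourth moments of the
    standardised fair binomial laws; this forces (d_n / s_n)^4 -> 0. *)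

Require Import Defs.
From HB Require Import structures.
From mathcomp Require Import all_boot all_order all_algebra all_fingroup.
From mathcomp Require Import mpoly.
From mathcomp Require Import all_classical all_reals all_analysis.
From mathcomp Require Import zify ring lra.

Set Implicit Arguments.
Unset Strict Implicit.
Unset Printing Implicit Defensive.

Import Order.TTheory GRing.Theory Num.Theory.

(** * Lengths and parabolic subgroups *)

(** [max_degree] supplies homogeneous generators of the invariants, but neither their algebraic
    independence nor the positivity of their degrees. Both must come out of dimension counts, so the
    inversion polynomial is tied to the dimensions of the invariants before any generator enters.
    Counting polynomials of degree < K, instead of exactly K, keeps every space a finite matrix
    space and makes the count vanish at K = 0. On the probabilistic side expectations are iterated
    finite averages. Averaging [Phi ((A - x) / sqrt t)] against a centred Gaussian of variance s
    only replaces t by t + s, so a Gaussian replacement is a change of parameter and no Gaussian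
    integral has to be evaluated. In the converse, the defect of the fourth moment is a sum of
    nonnegative terms, one of which belongs to d_n; the sixth moment gives the uniform integrability
    that convergence of distribution functions alone does not. *)

Section Cocycle.
Import finset.
Local Open Scope group_scope.
Variables (gT : finGroupType) (T : {set gT}) (inv : gT -> gT -> bool).
Implicit Types (H : {group gT}) (I : {set gT}).

(** No base of roots is chosen: a reflection of [H] is simple when the only positive root of [H]
    that it makes negative is its own. This makes sense for every subgroup. *)
Definition simples (H : {set gT}) : {set gT} :=
  [set s in T :&: H | [forall t in T :&: H, (t != s) ==> ~~ inv s t]].

Definition len (H : {set gT}) (w : gT) : nat := #|[set t in T :&: H | inv w t]|.

(** When [I] consists of simple reflections of [H], these are the shortest representatives of the
    left cosets of [<<I>>]; see [minreps_ex] and [minreps_uniq]. *)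
Definition minreps (H I : {set gT}) : {set gT} :=
  [set u in H | [forall s in I, ~~ inv u s]].

(* [T] is a set of reflections and [inv w t] says that [w] makes the positive root of
   [t] negative.  [rc_min] stands for the fact that the positive roots of [H] are
   nonnegative combinations of its simple ones. *)
Record reflection_cocycle : Prop := ReflectionCocycle {
  rc_conj : forall t x, t \in T -> t ^ x \in T;
  rc_sqr : forall t, t \in T -> t * t = 1;
  rc_mul : forall u x t, t \in T -> inv (u * x) t = inv x t (+) inv u (t ^ x^-1);
  rc_self : forall t, t \in T -> inv t t;
  rc_comm : forall t s, t \in T -> s \in T -> t * s = s * t -> t != s -> ~~ inv t s;
  rc_min : forall H b w, (forall s, s \in simples H -> inv w s = b) ->
    forall t, t \in T :&: H -> inv w t = b }.

Hypothesis rc : reflection_cocycle.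

Let TJ t x : t \in T -> t ^ x \in T. Proof. exact: rc_conj. Qed.
Let TT t : t \in T -> t * t = 1. Proof. exact: rc_sqr. Qed.
Let invM u x t : t \in T -> inv (u * x) t = inv x t (+) inv u (t ^ x^-1).
Proof. exact: rc_mul. Qed.
Let invT t : t \in T -> inv t t. Proof. exact: rc_self. Qed.
Let invC t s : t \in T -> s \in T -> t * s = s * t -> t != s -> ~~ inv t s.
Proof. exact: rc_comm. Qed.

Lemma simplesP H s : reflect [/\ s \in T, s \in H &
  forall t, t \in T -> t \in H -> t != s -> inv s t = false] (s \in simples H).
Proof.
rewrite inE inE; apply: (iffP andP) => [[/andP[sT sH] /forall_inP h]|[sT sH h]].
  split=> // t tT tH ts; apply: negbTE.
  by move: (h t); rewrite inE tT tH ts; apply.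
split; first by rewrite sT.
by apply/forall_inP => t /setIP[tT tH]; apply/implyP => ts; rewrite h.
Qed.

Lemma simples_sub H : simples H \subset H.
Proof. by apply/fintype.subsetP => s /simplesP[]. Qed.

Lemma inv1 t : t \in T -> inv 1 t = false.
Proof.
move=> tT; have := invM 1 1 tT; rewrite mulg1 invg1 conjg1.
by case: (inv 1 t).
Qed.

Lemma rc_neq1 t : t \in T -> t != 1.
Proof. by move=> tT; apply/eqP => t1; have := invT tT; rewrite {1}t1 inv1. Qed.

Lemma rc_V t : t \in T -> t^-1 = t.
Proof. by move=> tT; apply/eqP; rewrite eq_invg_mul TT. Qed.

Lemma invJV x t : t \in T -> inv x^-1 (t ^ x^-1) = inv x t.
Proof.
move=> tT; have := invM x^-1 x tT; rewrite mulVg inv1 //.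
by case: (inv x t); case: (inv _ _).
Qed.

Lemma word_in I (l : seq gT) H : I \subset H -> all (mem I) l -> \prod_(x <- l) x \in H.
Proof.
move=> IH /allP h; rewrite big_seq; apply: group_prod => x /h /= xI.
exact: (fintype.subsetP IH).
Qed.

Lemma simples_gen_sub H I : I \subset simples H -> <<I>> \subset H.
Proof. by move=> h; rewrite gen_subG (fintype.subset_trans h) // simples_sub. Qed.

(** Exchange condition. At the letter [x] where the root of [s] turns negative, with [P] the word to
    its right, the root inverted by [x] must be its own, so [s ^ P^-1 = x]. Hence [x * P * s = P],
    and [x] is the letter to delete. *)
Lemma exchange H I l s : I \subset simples H -> all (mem I) l -> s \in I ->
  inv (\prod_(x <- l) x) s ->
  exists l', [/\ all (mem I) l', size l = (size l').+1 &
                 \prod_(x <- l) x * s = \prod_(x <- l') x].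
Proof.
move=> IS + sI; have IH := fintype.subset_trans IS (simples_sub H).
have /simplesP[sT sH _] := fintype.subsetP IS _ sI.
elim: l => [_|x l IHl /= /andP[xI lI]]; first by rewrite big_nil inv1.
rewrite !big_cons invM //; set P := \prod_(_ <- l) _ in IHl *.
case: (boolP (inv P s)) => [Ps _|_ /= xs].
  have [l' [l'I -> e]] := IHl lI Ps; exists (x :: l') => /=.
  by rewrite xI l'I big_cons -mulgA e.
have /simplesP[xT xH xs'] := fintype.subsetP IS _ xI.
have PH : P \in H by apply: word_in lI.
have e : s ^ P^-1 = x.
  apply/eqP; apply: contraTT xs => ne; rewrite xs' ?groupJ ?groupV //.
  exact: TJ.
exists l; split=> //; move: e; rewrite conjgE invgK => e.
by rewrite -{1}e !mulgA mulgKV -!mulgA TT // mulg1.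
Qed.

(** Look at the last letter [s]. If the word before it already inverts [s], exchange yields a
    shorter word for the same element; otherwise [s] is a descent. *)
Lemma word_descent H I l : I \subset simples H -> all (mem I) l ->
  \prod_(x <- l) x = 1 \/ exists2 s, s \in I & inv (\prod_(x <- l) x) s.
Proof.
move=> IS; have [k] := ubnP (size l); elim: k l => // k IHk l lk lI.
case: (lastP l) lk lI => [|l1 s]; first by move=> *; left; rewrite big_nil.
rewrite size_rcons ltnS all_rcons => lk /andP[/= sI l1I].
have /simplesP[sT sH _] := fintype.subsetP IS _ sI.
rewrite -cats1 big_cat big_seq1 /=.
case: (boolP (inv (\prod_(x <- l1) x) s)) => [h|h].
  have [l' [l'I sz e]] := exchange IS l1I sI h.
  by rewrite e; apply: IHk => //; rewrite -sz ltnW.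
right; exists s => //; rewrite invM // invT //.
by rewrite conjgE invgK mulgA mulgK (negbTE h).
Qed.

Lemma gen_wordP I x : x \in <<I>> -> exists2 l, all (mem I) l & x = \prod_(y <- l) y.
Proof.
move=> /gen_prodgP[n [c cI ->]]; exists [seq c i | i <- index_enum 'I_n].
  by apply/allP => y /mapP[i _ ->] /=.
by rewrite big_map.
Qed.

Lemma gen_descent H I x : I \subset simples H -> x \in <<I>> -> x != 1 ->
  exists2 s, s \in I & inv x s.
Proof.
move=> IS /gen_wordP[l lI ->] /eqP x1.
by case: (word_descent IS lI).
Qed.

Lemma simples_gen H I t : I \subset simples H -> t \in simples <<I>> -> t \in I.
Proof.
move=> IS /simplesP[tT tI h].
have [s sI ts] := gen_descent IS tI (rc_neq1 tT).
have /simplesP[sT _ _] := fintype.subsetP IS _ sI.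
case: (eqVneq s t) => [<- //|st].
by rewrite h // ?mem_gen in ts.
Qed.

Lemma gen_min H I b w : I \subset simples H ->
  (forall s, s \in I -> inv w s = b) -> forall t, t \in T -> t \in <<I>> -> inv w t = b.
Proof.
move=> IS h t tT tI; apply: (@rc_min rc <<I>>%G) => [s|]; last by rewrite inE tT.
by move=> /(simples_gen IS); apply: h.
Qed.

(** A letter of [I] inverts only its own root, and conjugation by elements of [<<I>>] never carries
    [t] into [<<I>>], so no letter of a word for [x] changes the sign. *)
Lemma gen_outside H I x t : I \subset simples H -> x \in <<I>> ->
  t \in T -> t \in H -> t \notin <<I>> -> inv x t = false.
Proof.
move=> IS /gen_wordP[l lI ->] tT tH tI.
have IH := fintype.subset_trans IS (simples_sub H).
have lG (k : seq gT) : all (mem I) k -> \prod_(y <- k) y \in <<I>>.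
  by move=> kI; apply: word_in kI; apply: subset_gen.
elim: l lI => [_|x0 l IHl /= /andP[xI lI]]; first by rewrite big_nil inv1.
rewrite big_cons invM // IHl //=.
have /simplesP[xT xH xs'] := fintype.subsetP IS _ xI.
apply: xs'; first exact: TJ.
  by rewrite groupJ // groupV (word_in IH).
apply: contraNneq tI => e; rewrite -(memJ_norm _ (_ : (\prod_(y <- l) y)^-1 \in 'N(<<I>>))).
  by rewrite e mem_gen.
by rewrite (fintype.subsetP (normG _)) // groupV lG.
Qed.

(** Split the inversions of [u * x] by membership in [<<I>>]. Inside, [u] inverts nothing and those
    of [x] remain; outside, [x] permutes the positive roots and those of [u] are counted. *)
Lemma len_factor H I u x : I \subset simples H ->
  (forall s, s \in I -> inv u s = false) -> x \in <<I>> ->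
  len H (u * x) = (len H u + len <<I>> x)%N.
Proof.
move=> IS hu xI; rewrite /len.
have uI := gen_min IS hu; have GH := simples_gen_sub IS.
rewrite -(cardsID <<I>> [set t in T :&: H | inv (u * x) t]) addnC; congr (_ + _)%N.
  have xH := fintype.subsetP GH _ xI.
  have -> : [set t in T :&: H | inv u t] = [set t ^ x^-1 | t in
     [set t in T :&: H | inv (u * x) t] :\: <<I>>].
    apply/setP => t; apply/idP/imsetP => [|[r + ->]].
      rewrite !inE => /andP[/andP[tT tH] ut]; exists (t ^ x); last by rewrite conjgK.
      have tI : t \notin <<I>> by apply: contraL ut => tI; rewrite uI.
      rewrite !inE TJ // invM ?conjgK; last exact: TJ.
      rewrite (groupJ tH xH) ut addbT memJ_norm ?tI; last by rewrite (fintype.subsetP (normG _)).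
      rewrite (gen_outside IS xI) // ?(groupJ tH xH) //; first exact: TJ.
      by rewrite memJ_norm // (fintype.subsetP (normG _)).
    rewrite !inE => /and3P[rI /andP[rT rH]]; rewrite invM // (gen_outside IS xI) //= => ->.
    by rewrite TJ // groupJ // groupV.
  by rewrite card_imset //; apply: conjg_inj.
apply: eq_card => t; rewrite !inE; case: (boolP (t \in T)) => //= tT.
case: (boolP (t \in <<I>>)) => [tI|_]; last by rewrite andbF.
rewrite andbT (fintype.subsetP GH _ tI) /= invM // uI ?addbF //; first exact: TJ.
by rewrite groupJ // groupV.
Qed.

Lemma len1 H : len H 1 = 0%N.
Proof.
apply/eqP; rewrite cards_eq0; apply/eqP/setP => t; rewrite !inE.
by case: (boolP (t \in T)) => //= tT; rewrite inv1 // andbF.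
Qed.

Lemma len_simple H s : s \in simples H -> len H s = 1%N.
Proof.
move=> /simplesP[sT sH h]; rewrite /len (_ : [set _ in _ | _] = [set s]) ?cards1 //.
apply/setP => t; rewrite !inE; case: (eqVneq t s) => [->|ts]; first by rewrite sT sH invT.
by case: (boolP (t \in T)) => // tT; case: (boolP (t \in H)) => //= tH; rewrite h.
Qed.

Lemma len_inv H x : x \in H -> len H x^-1 = len H x.
Proof.
move=> xH; rewrite /len.
have -> : [set t in T :&: H | inv x^-1 t] = [set t ^ x^-1 | t in [set t in T :&: H | inv x t]].
  apply/setP => t; apply/idP/imsetP => [|[r + ->]].
    rewrite !inE => /andP[/andP[tT tH] xt]; exists (t ^ x); last by rewrite conjgK.
    rewrite !inE TJ // groupJ //= -(invJV x) ?conjgK //; exact: TJ.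
  by rewrite !inE => /andP[/andP[rT rH]]; rewrite TJ // groupJ ?groupV //= invJV.
by rewrite card_imset //; apply: conjg_inj.
Qed.

Lemma len_mul_simple H w s : s \in simples H ->
  len H (w * s) = (if inv w s then (len H w).-1 else (len H w).+1) /\
  (inv w s -> 0 < len H w)%N.
Proof.
move=> sS; have /simplesP[sT sH _] := sS.
have IS : [set s] \subset simples H by rewrite finset.sub1set.
have sg : s \in <<[set s]>> by rewrite mem_gen // set11.
have l1 : len <<[set s]>> s = 1%N.
  apply: (@len_simple <<[set s]>>%G); apply/simplesP; split=> // t tT /(fintype.subsetP (simples_gen_sub IS)) tH.
  by have /simplesP[_ _ h] := sS; apply: h.
have up u : inv u s = false -> len H (u * s) = (len H u).+1.
  by move=> us; rewrite (len_factor IS) // ?l1 ?addn1 // => _ /set1P ->.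
case: (boolP (inv w s)) => ws; last by split=> //; rewrite up // (negbTE ws).
have := up (w * s); rewrite -mulgA TT // mulg1 invM // invT //.
by rewrite conjgE invgK mulgA mulgK ws => ->.
Qed.

(** For a simple [s] inverted by [t] and different from it, [rc_comm] forbids [s] and [t] to
    commute. Then [s * t] still inverts [s], so [t ^ s] is a reflection shorter by 2, and induction
    preserves parity. *)
Lemma refl_gen H t : t \in T -> t \in H -> t \in <<simples H>> /\ odd (len H t).
Proof.
have [k] := ubnP (len H t); elim: k t => // k IHk t lk tT tH.
have [s sS ts] : exists2 s, s \in simples H & inv t s.
  case: (pickP [pred s | (s \in simples H) && inv t s]) => [s /andP[]|h]; first by exists s.
  have tS s : s \in simples H -> inv t s = false by move=> sS; move: (h s) => /=; rewrite sS.
  by have := rc_min rc tS (t := t); rewrite inE tT tH invT // => /(_ isT).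
have /simplesP[sT sH hs] := sS.
case: (eqVneq t s) => [->|nts]; first by rewrite mem_gen // len_simple.
have sts : s * t * s = t ^ s by rewrite conjgE (rc_V sT) mulgA.
have tst : t * s * t = s ^ t by rewrite conjgE (rc_V tT) mulgA.
have [+ /(_ ts) l0] := len_mul_simple t sS; rewrite ts => e1.
have ne : s ^ t != s.
  apply: contraTneq ts => e; apply: invC => //.
  by rewrite -{2}e -tst -(mulgA _ t t) TT // mulg1.
have iv : inv (s * t) s.
  rewrite invM // ts rc_V // hs //; [exact: TJ | by rewrite groupJ].
have [+ /(_ iv) l1] := len_mul_simple (s * t) sS; rewrite iv => e2.
have e3 : len H (s * t) = (len H t).-1.
  by rewrite -e1 -[RHS]len_inv ?groupM // invMg !rc_V.
have e4 : len H (t ^ s) = (len H t).-2 by rewrite -sts e2 e3.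
move: l1; rewrite e3 => l1.
have /IHk : len H (t ^ s) < k by rewrite e4; lia.
move=> /(_ (TJ s tT) (groupJ tH sH))[]; rewrite e4.
have sN : s \in 'N(<<simples H>>) by rewrite (fintype.subsetP (normG _)) ?mem_gen.
rewrite memJ_norm // => -> o; split=> //.
by move: o l0 l1; case: (len H t) => [|[|n]] //=; rewrite negbK.
Qed.

End Cocycle.

(** * Solomon's alternating sums *)

Section PowersetSign.
Import finset.
Local Open Scope ring_scope.

Lemma sum_powerset_sign (K : pzRingType) (fT : finType) (A : {set fT}) :
  \sum_(J in powerset A) (-1) ^+ #|J| = (A == finset.set0)%:R :> K.
Proof.
have [->|[a aA]] := set_0Vmem A.
  by rewrite powerset0 big_set1 cards0 eqxx expr0.
have -> : (A == finset.set0) = false by apply/negbTE/set0Pn; exists a.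
rewrite (bigID (fun J : {set fT} => a \in J)) /=.
rewrite [X in _ + X](reindex_onto (fun J : {set fT} => J :\ a) (fun J => a |: J)); last first.
  by move=> J /andP[_ aI]; rewrite setU1K.
rewrite [X in _ + X](eq_bigl (fun J : {set fT} => (J \in powerset A) && (a \in J))); last first.
  move=> J; rewrite !inE eqxx /= andbT; case: (boolP (a \in J)) => aJ.
    by rewrite finset.setD1K // eqxx !andbT subDset (finset.setUidPr _) // finset.sub1set.
  by rewrite andbF; apply/negbTE/negP => /andP[_ /eqP e]; move: aJ; rewrite -e setU11.
rewrite -big_split big1 // => J /andP[_ aI].
by rewrite (cardsD1 a J) aI add1n exprS mulN1r /= addNr.
Qed.

End PowersetSign.

Section Solomon.
Import finset.
Local Open Scope group_scope.
Local Open Scope ring_scope.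
Variables (gT : finGroupType) (T : {set gT}) (inv : gT -> gT -> bool).
Implicit Types (H : {group gT}) (I : {set gT}).
Hypothesis rc : reflection_cocycle T inv.
Variable R : numFieldType.

Local Notation len := (len T inv).
Local Notation simples := (simples T inv).
Local Notation minreps := (minreps inv).

Definition lenpoly (H : {set gT}) : {poly R} := \sum_(w in H) 'X^(len H w).
Definition sgn (H : {set gT}) (w : gT) : R := (-1) ^+ len H w.
Definition ascents (H : {set gT}) (u : gT) : {set gT} :=
  [set s in simples H | ~~ inv u s].

Lemma minrepsP H I u :
  reflect (u \in H /\ forall s, s \in I -> inv u s = false) (u \in minreps H I).
Proof.
rewrite inE; apply: (iffP andP) => -[uH]; last first.
  by move=> h; split=> //; apply/forall_inP => s /h ->.
by move/forall_inP => h; split=> // s /h /negbTE.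
Qed.

Lemma minreps_ascents H I u : I \subset simples H -> u \in H ->
  (u \in minreps H I) = (I \subset ascents H u).
Proof.
move=> IS uH; apply/minrepsP/fintype.subsetP => [[_ h] s sI|h].
  by rewrite inE h // (fintype.subsetP IS).
by split=> // s /h; rewrite inE => /andP[_ /negbTE].
Qed.

Lemma minreps_ex H I w : I \subset simples H -> w \in H ->
  exists2 u, u \in minreps H I & (u^-1 * w)%g \in <<I>>.
Proof.
move=> IS wH; have GH := simples_gen_sub IS.
have ww : (w^-1 * w)%g \in <<I>> by rewrite mulVg group1.
have [u uw umin] := @arg_minnP _ w (fun u => (u^-1 * w)%g \in <<I>>) (len H) ww.
have uH : u \in H.
  by rewrite -groupV -(groupMr _ wH) (fintype.subsetP GH).
exists u => //; apply/minrepsP; split=> // s sI; apply/negP => us.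
have sS := fintype.subsetP IS _ sI.
have [+ /(_ us) l0] := len_mul_simple rc u sS; rewrite us => e.
have /simplesP[sT _ _] := sS.
have /umin : ((u * s)^-1 * w)%g \in <<I>>.
  by rewrite invMg -mulgA groupM // groupV mem_gen.
by rewrite e; move: l0; case: (len H u) => //= k _; rewrite ltnn.
Qed.

(** If [x = u^-1 * u'] were not 1 it would have a descent [s] in [I]; as [u] keeps all roots of
    [<<I>>] positive, [u'] would invert [s] too. *)
Lemma minreps_uniq H I u u' : I \subset simples H -> u \in minreps H I ->
  u' \in minreps H I -> (u^-1 * u')%g \in <<I>> -> u = u'.
Proof.
move=> IS /minrepsP[uH hu] /minrepsP[uH' hu'] xI.
case: (eqVneq (u^-1 * u')%g 1%g) => [/eqP|x1]; first by rewrite -eq_mulVg1 => /eqP.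
have [s sI xs] := gen_descent rc IS xI x1.
have /simplesP[sT sH _] := fintype.subsetP IS _ sI.
have := hu' _ sI; rewrite -{1}(mulKVg u u') (rc_mul rc) // xs (gen_min rc IS hu) //.
  exact: (rc_conj rc).
by rewrite groupJ ?groupV // mem_gen.
Qed.

Lemma coset_sum H I (V : nmodType) (F : gT -> V) : I \subset simples H ->
  \sum_(w in H) F w = \sum_(u in minreps H I) \sum_(x in <<I>>) F (u * x)%g.
Proof.
move=> IS; have GH := simples_gen_sub IS.
pose rep w := odflt 1%g [pick u in minreps H I | (u^-1 * w)%g \in <<I>>].
have repP w : w \in H -> (rep w \in minreps H I) && (((rep w)^-1 * w)%g \in <<I>>).
  move=> wH; rewrite /rep; case: pickP => [u -> //|h].
  by have [u u1 u2] := minreps_ex IS wH; move: (h u); rewrite u1 u2.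
rewrite (partition_big rep (mem (minreps H I))) => [|w /repP /andP[] //].
apply: eq_bigr => u uM; have /minrepsP[uH _] := uM.
rewrite (reindex_onto (fun x => u * x)%g (fun w => u^-1 * w)%g) /=; last first.
  by move=> w _; rewrite mulKVg.
apply: eq_bigl => x; rewrite mulKg eqxx andbT groupMl //.
apply/andP/idP => [[xH /eqP e]|xI].
  by have := repP _ (groupM uH xH); rewrite e mulKg => /andP[].
have xH := fintype.subsetP GH _ xI; split=> //; apply/eqP.
have /andP[r1 r2] := repP (u * x)%g (groupM uH xH).
apply/esym; apply: (minreps_uniq IS uM r1).
set r := rep _ in r2 *.
have -> : (u^-1 * r = x * (r^-1 * (u * x))^-1)%g by rewrite !invMg invgK -!mulgA mulKVg.
by rewrite groupM // groupV.
Qed.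

Lemma lenpoly_factor H I : I \subset simples H ->
  lenpoly H = (\sum_(u in minreps H I) 'X^(len H u)) * lenpoly <<I>>.
Proof.
move=> IS; rewrite /lenpoly (coset_sum _ IS) mulr_suml.
apply: eq_bigr => u /minrepsP[uH hu]; rewrite mulr_sumr; apply: eq_bigr => x xI.
by rewrite (len_factor rc IS) // exprD.
Qed.

Lemma ascents_sub H u : ascents H u \subset simples H.
Proof. by apply/fintype.subsetP => s; rewrite inE => /andP[]. Qed.

(** An element [u] is counted for exactly the subsets [I] of its ascents, so the signs cancel unless
    it has none. Used once for polynomials and once for traces. *)
Lemma sum_ascents (V : pzRingType) H (F : gT -> V) :
  \sum_(I in powerset (simples H)) (-1) ^+ #|I| * (\sum_(u in minreps H I) F u) =
  \sum_(u in H | ascents H u == finset.set0) F u.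
Proof.
transitivity (\sum_(u in H) \sum_(I in powerset (ascents H u)) (-1) ^+ #|I| * F u).
  under eq_bigr do rewrite mulr_sumr.
  rewrite (exchange_big_dep (mem H)) /=; last by move=> I u _ /minrepsP[].
  apply: eq_bigr => u uH; apply: eq_bigl => I; rewrite !powersetE.
  case: (boolP (I \subset simples H)) => [IS|nIS]; first by rewrite minreps_ascents.
  apply/esym/negbTE; apply: contra nIS => h.
  exact: fintype.subset_trans h (ascents_sub H u).
rewrite big_mkcondr /=; apply: eq_bigr => u uH.
by rewrite -mulr_suml sum_powerset_sign; case: eqP; rewrite ?mul1r ?mul0r.
Qed.

Lemma ascents0P H u : u \in H -> ascents H u = finset.set0 ->
  forall t, t \in T -> t \in H -> inv u t = true.
Proof.
move=> uH e t tT tH; apply: (rc_min rc (H := H)) => [s sS|]; last by rewrite inE tT.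
by apply/negPn/negP => us; have := finset.in_set0 s; rewrite -e inE sS us.
Qed.

Definition reflgroup (H : {set gT}) : bool := H \subset <<T :&: H>>.

Lemma reflgroup_simples H : reflgroup H -> <<simples H>> = H.
Proof.
move=> rH; apply/eqP; rewrite finset.eqEsubset gen_subG simples_sub /=.
apply: fintype.subset_trans rH _; rewrite gen_subG.
by apply/fintype.subsetP => t /setIP[tT tH]; have [] := refl_gen rc tT tH.
Qed.

Lemma descent_ex H x : reflgroup H -> x \in H -> x != 1%g ->
  exists2 s, s \in simples H & inv x s.
Proof.
move=> rH xH x1; apply: (gen_descent rc (fintype.subxx _)) => //.
by rewrite reflgroup_simples.
Qed.

(** An element of maximal length has no ascent, hence inverts every positive root. Two such elements
    differ by one without descents, that is, by 1. *)
Lemma longest_ex H : reflgroup H -> exists w0, [/\ w0 \in H, len H w0 = #|T :&: H| &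
  forall u, u \in H -> (ascents H u == finset.set0) = (u == w0)].
Proof.
move=> rH; have [w0 w0H w0max] := @arg_maxnP _ 1%g (mem H) (len H) (group1 H).
have w0A : ascents H w0 = finset.set0.
  apply/eqP; rewrite -finset.subset0; apply/fintype.subsetP => s; rewrite inE => /andP[sS nw].
  have [+ _] := len_mul_simple rc w0 sS; rewrite (negbTE nw) => e.
  have /simplesP[_ sH _] := sS.
  by have /= := w0max (w0 * s)%g (groupM w0H sH); rewrite e ltnn.
have h0 := ascents0P w0H w0A.
exists w0; split=> //.
  by apply: eq_card => t; rewrite !inE; case: (boolP (t \in T)) => //= tT;
    case: (boolP (t \in H)) => //= tH; rewrite h0.
move=> u uH; apply/eqP/eqP => [uA|-> //].
have h1 := ascents0P uH uA.
apply/eqP; rewrite eq_sym eq_mulVg1; apply/negP => /negP x1.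
have [s sS xs] := descent_ex rH (groupM (groupVr w0H) uH) x1.
have /simplesP[sT sH _] := sS.
have := h1 s sT sH; rewrite -(mulKVg w0 u) (rc_mul rc) // xs h0 //.
  exact: (rc_conj rc).
by rewrite groupJ // groupV groupM // groupV.
Qed.

Lemma sgn_mul_simple H w s : s \in simples H -> sgn H (w * s)%g = - sgn H w.
Proof.
move=> sS; rewrite /sgn; have [-> l0] := len_mul_simple rc w sS.
case: ifP => [/l0|_]; last by rewrite exprS mulN1r.
by case: (len H w) => // k _; rewrite exprS mulN1r opprK.
Qed.

Lemma sgn1 H : sgn H 1%g = 1.
Proof. by rewrite /sgn len1. Qed.

Lemma sgn_neq0 H w : sgn H w != 0.
Proof. by rewrite signr_eq0. Qed.

Lemma sgnM H w x : reflgroup H -> x \in H -> sgn H (w * x)%g = sgn H w * sgn H x.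
Proof.
move=> rH; rewrite -{1}(reflgroup_simples rH) => /gen_wordP[l lI ->].
elim/last_ind: l lI => [_|l s IHl]; first by rewrite big_nil mulg1 sgn1 mulr1.
rewrite all_rcons => /andP[/= sS /IHl e].
by rewrite -cats1 big_cat big_seq1 /= mulgA !(sgn_mul_simple _ sS) e mulrN.
Qed.

Lemma sgnV H x : x \in H -> sgn H x^-1 = sgn H x.
Proof. by move=> xH; rewrite /sgn len_inv. Qed.

Lemma sgn_refl H t : t \in T -> t \in H -> sgn H t = -1.
Proof. by move=> tT tH; have [_ o] := refl_gen rc tT tH; rewrite /sgn -signr_odd o expr1. Qed.

(** By [lenpoly_factor] the inner sum is the quotient of the length polynomials of [H] and [<<I>>].
    Only the longest element survives the alternating sum. *)
Lemma altsum_minreps H : reflgroup H ->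
  \sum_(I in powerset (simples H)) (-1) ^+ #|I| *
    (\sum_(u in minreps H I) 'X^(len H u)) = 'X^#|T :&: H| :> {poly R}.
Proof.
move=> rH; rewrite sum_ascents; have [w0 [w0H <- h]] := longest_ex rH.
rewrite (bigD1 w0) /=; last by rewrite w0H h // eqxx.
by rewrite big1 ?addr0 // => u /andP[/andP[uH]]; rewrite h // => ->.
Qed.

End Solomon.

(** * Solomon's formula for class functions *)

Section SolomonCharacter.
Import finset.
Local Open Scope group_scope.
Local Open Scope ring_scope.
Variables (gT : finGroupType) (T : {set gT}) (inv : gT -> gT -> bool).
Hypothesis rc : reflection_cocycle T inv.
Variables (R : numFieldType) (H : {group gT}).
Hypothesis rH : reflgroup T H.
Implicit Types (I : {set gT}) (f : gT -> R).

Local Notation len := (len T inv).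
Local Notation simples := (simples T inv).
Local Notation minreps := (minreps inv).
Local Notation ascents := (ascents T inv).
Local Notation sgn := (sgn T inv R).

(* The functions [b u] are triangular with respect to the length, and those with
   [I \subset ascents H u] span the right [<<I>>]-invariant functions on [H].  In the
   alternating sum over [I] of the traces of left translation by [w] on these spaces,
   only the [b]-coordinate of the longest element survives; it is the sign of [w]. *)
Let b u g : R := ((u^-1 * g)%g \in <<ascents H u>>)%:R.

Let rinv I f := forall g x, g \in H -> x \in <<I>> -> f (g * x)%g = f g.

Let b_self u : b u u = 1.
Proof. by rewrite /b mulVg group1. Qed.

Let b_tri u g : u \in H -> b u g != 0 -> g != u -> (len H u < len H g)%N.
Proof.
move=> uH; rewrite /b; case: (boolP (_ \in _)) => [xI _|]; last by rewrite eqxx.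
rewrite eq_sym eq_mulVg1 => x1.
have AS := ascents_sub T inv H u.
have [s sI xs] := gen_descent rc AS xI x1.
have hu s' : s' \in ascents H u -> inv u s' = false by rewrite inE => /andP[_ /negbTE].
rewrite -(mulKVg u g) (len_factor rc AS hu xI) -addn1 leq_add2l card_gt0.
have /simplesP[sT _ _] := fintype.subsetP AS _ sI.
by apply/set0Pn; exists s; rewrite !inE sT xs mem_gen.
Qed.

Let b_rinv I u : I \subset ascents H u -> rinv I (b u).
Proof.
move=> IA g x gH xI; rewrite /b mulgA groupMr //.
by apply: fintype.subsetP xI; rewrite genS.
Qed.

(** Elimination by increasing length: [b u] is 1 at [u] and otherwise supported on longer elements,
    so subtracting multiples of it clears the values of [f] at one length without disturbing the
    smaller ones. *)
Let b_span I f : I \subset simples H -> rinv I f ->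
  exists c, (forall u, c u != 0 -> u \in minreps H I) /\
            forall g, g \in H -> f g = \sum_(u in H) c u * b u g.
Proof.
move=> IS; pose M := #|T|.+1.
have lM u : (len H u < M)%N.
  by rewrite ltnS subset_leq_card //; apply/fintype.subsetP => t; rewrite !inE => /andP[/andP[]].
suff step k : forall f, rinv I f ->
    (forall u, u \in minreps H I -> (len H u + k < M)%N -> f u = 0) ->
  exists c, (forall u, c u != 0 -> u \in minreps H I) /\
            forall g, g \in H -> f g = \sum_(u in H) c u * b u g.
  by move=> fI; apply: (step M) => // u _; lia.
elim: k => [|k IHk] {}f fI f0.
  exists (fun _ => 0); split=> [u|g gH]; first by rewrite eqxx.
  rewrite big1 => [|u _]; last by rewrite mul0r.
  have [u uM xI] := minreps_ex rc IS gH; have /minrepsP[uH _] := uM.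
  by rewrite -(mulKVg u g) fI // f0 // addn0.
pose c1 u : R := if (u \in minreps H I) && (len H u + k.+1 == M)%N then f u else 0.
have [||c [c2 cE]] := IHk (fun g => f g - \sum_(u in H) c1 u * b u g).
- move=> g x gH xI; rewrite fI //; congr (_ - _); apply: eq_bigr => u uH.
  rewrite /c1; case: ifP => [/andP[uM _]|_]; last by rewrite !mul0r.
  by rewrite (b_rinv (I := I)) // -minreps_ascents.
- move=> u uM luk; have /minrepsP[uH _] := uM.
  rewrite (bigD1 u) //= b_self mulr1 big1 ?addr0 => [|u' /andP[uH' nu]].
    rewrite /c1 uM /=; case: eqP => [_|ne]; first by rewrite subrr.
    by rewrite subr0 f0 //; lia.
  rewrite /c1; case: ifP => [/andP[_ /eqP e]|_]; last by rewrite mul0r.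
  case: (eqVneq (b u' u) 0) => [->|nb]; first by rewrite mulr0.
  by have := b_tri uH' nb; rewrite eq_sym nu => /(_ isT); lia.
exists (fun u => c u + c1 u); split=> [u|g gH].
  apply: contraNT => nu; rewrite /c1 (negbTE nu) addr0.
  by apply: contraNT nu => /c2.
rewrite -[LHS](subrK (\sum_(u in H) c1 u * b u g)) cE // -big_split /=.
by apply: eq_bigr => u _; rewrite mulrDl.
Qed.

Let idx (i : 'I_#|H|) : gT := enum_val i.
Let idxH i : idx i \in H. Proof. exact: enum_valP. Qed.
Let rv f : 'rV[R]_#|H| := \row_j f (idx j).
Let B : 'M[R]_#|H| := \matrix_(i, j) b (idx i) (idx j).
Let rk u : 'I_#|H| := enum_rank_in (group1 H) u.
Let coord f u : R := (rv f *m invmx B) 0 (rk u).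

Let sumH (F : gT -> R) : \sum_(g in H) F g = \sum_i F (idx i).
Proof. by rewrite big_enum_val. Qed.

Let rv_span I f : I \subset simples H -> rinv I f ->
  exists2 c, (forall u, c u != 0 -> u \in minreps H I) & rv f = rv c *m B.
Proof.
move=> IS /(b_span IS)[c [c0 cE]]; exists c => //.
by apply/rowP => j; rewrite !mxE cE // sumH; apply: eq_bigr => i _; rewrite !mxE.
Qed.

Let B_unit : B \in unitmx.
Proof.
rewrite -row_full_unit -sub1mx; apply/row_subP => i.
have [||c _ e] := @rv_span finset.set0 (fun g => (idx i == g)%:R).
- by rewrite finset.sub0set.
- by move=> g x _; rewrite gen0 => /set1gP ->; rewrite mulg1.
apply/submxP; exists (rv c); rewrite -e; apply/rowP => j; rewrite !mxE.
by rewrite (inj_eq enum_val_inj).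
Qed.

Let coordE f g : g \in H -> f g = \sum_(u in H) coord f u * b u g.
Proof.
move=> gH; have := mulmxKV B_unit (rv f) => /rowP /(_ (rk g)).
rewrite !mxE {1}/idx enum_rankK_in // => <-; rewrite sumH; apply: eq_bigr => i _.
by rewrite [X in _ * X]mxE /coord /rk /idx enum_valK_in enum_rankK_in.
Qed.

Let coord0 I f u : I \subset simples H -> rinv I f -> u \in H ->
  ~~ (I \subset ascents H u) -> coord f u = 0.
Proof.
move=> IS fI uH; rewrite -(minreps_ascents IS uH) => nu.
have [c c0 e] := rv_span IS fI; rewrite /coord e mulmxK ?B_unit // mxE /idx enum_rankK_in //.
by apply: contraNeq nu => /c0.
Qed.

(** If [u] has an ascent [s], right translation by [s] fixes [b u] and changes the sign character,
    so their pairing vanishes. For [w0] the function [b w0] is the indicator of [w0]. *)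
Let coord_longest f w0 : w0 \in H ->
  (forall u, u \in H -> (ascents H u == finset.set0) = (u == w0)) ->
  \sum_(g in H) f g * sgn H g = coord f w0 * sgn H w0.
Proof.
move=> w0H hw0; under eq_bigr => g gH do rewrite (coordE f gH) mulr_suml.
rewrite exchange_big (bigD1 w0) //= addrC big1 ?add0r => [|u /andP[uH nu]].
  rewrite (bigD1 w0) //= b_self mulr1 big1 ?addr0 // => g /andP[gH ng].
  rewrite /b (eqP (_ : ascents H w0 == finset.set0)) ?hw0 // gen0.
  by rewrite (sameP set1gP eqP) -eq_mulVg1 eq_sym (negbTE ng) mulr0 mul0r.
have /set0Pn[s sA] : ascents H u != finset.set0 by rewrite hw0.
have sS := fintype.subsetP (ascents_sub T inv H u) _ sA.
have /simplesP[sT sH _] := sS.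
set X := \sum_(_ in _) _.
suff : X = - X by move/eqP; rewrite -addr_eq0 -mulr2n mulrn_eq0 => /eqP.
rewrite {1}/X (reindex_inj (mulIg s)) /= -sumrN; apply: eq_big => [g|g gH].
  by rewrite groupMr.
rewrite (sgn_mul_simple rc R g sS) mulrN (@b_rinv (ascents H u) u) ?mem_gen //.
by rewrite -(groupMr _ sH).
Qed.

Let avg I w u g : R := (\sum_(x in <<I>>) b u (w * g * x)%g) / #|<<I>>|%:R.

Let card_unit (G : {group gT}) : #|G|%:R != 0 :> R.
Proof. by rewrite pnatr_eq0 -lt0n cardG_gt0. Qed.

(** The left side counts the cosets of [<<I>>] fixed by [w]. It is the trace of [Q], translation by
    [w] composed with averaging over [<<I>>]; the right side is the same trace in the basis [b]. *)
Let trace_coset I w : I \subset simples H -> w \in H ->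
  (\sum_(g in H | (w ^ g)%g \in <<I>>) 1) / #|<<I>>|%:R =
  \sum_(u in minreps H I) coord (fun g => b u (w * g)%g) u.
Proof.
move=> IS wH; have GH := simples_gen_sub IS.
pose Q : 'M[R]_#|H| := \matrix_(i, j)
  ((((idx j)^-1 * w^-1 * idx i)%g \in <<I>>)%:R / #|<<I>>|%:R : R).
have -> : (\sum_(g in H | (w ^ g)%g \in <<I>>) 1) / #|<<I>>|%:R = \tr Q.
  rewrite big_mkcondr sumH mulr_suml; apply: eq_bigr => i _; rewrite mxE.
  rewrite -(groupV _ (w ^ _)) conjgE !invMg invgK ?mulgA.
  by case: ifP.
have BQ i j : (B *m Q) i j = avg I w (idx i) (idx j).
  rewrite mxE /avg mulr_suml.
  transitivity (\sum_(h in H) b (idx i) h * (((idx j)^-1 * w^-1 * h)%g \in <<I>>)%:R / #|<<I>>|%:R).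
    by rewrite sumH; apply: eq_bigr => k _; rewrite !mxE mulrA.
  rewrite (bigID (fun h => ((idx j)^-1 * w^-1 * h)%g \in <<I>>)) /= addrC big1 ?add0r; last first.
    by move=> h /andP[_ /negbTE ->]; rewrite mulr0 mul0r.
  rewrite (reindex_inj (mulgI (w * idx j)%g)) /=; apply: eq_big => [x|x].
    rewrite -!mulgA mulKg mulKg; apply/andP/idP => [[]//|xI].
    by rewrite !groupM // (fintype.subsetP GH).
  by case/andP => _ ->; rewrite mulr1.
have avg_inv u : rinv I (avg I w u).
  move=> g y gH yI; rewrite /avg; congr (_ / _).
  rewrite (reindex_inj (mulgI (y^-1)%g)) /=; apply: eq_big => [x|x _].
    by rewrite groupMl // groupV.
  by rewrite !mulgA mulgK.
rewrite -(mulKmx B_unit Q) mxtrace_mulC.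
have -> : \tr (B *m Q *m invmx B) = \sum_(u in H) coord (avg I w u) u.
  rewrite sumH; apply: eq_bigr => i _; rewrite /coord /rk /idx enum_valK_in !mxE.
  by apply: eq_bigr => j _; rewrite BQ mxE.
rewrite (bigID (mem (minreps H I))) /= [X in _ + X]big1 ?addr0; last first.
  by move=> u /andP[uH nu]; apply: (coord0 IS (avg_inv u)); rewrite -?minreps_ascents.
apply: eq_big => [u|u /andP[uH uM]].
  by case: (boolP (u \in minreps H I)) => [/minrepsP[-> _]|]; rewrite ?andbF.
rewrite /coord (_ : rv (avg I w u) = rv (fun g => b u (w * g)%g)) //.
apply/rowP => j; rewrite !mxE /avg (eq_bigr (fun=> b u (w * idx j)%g)).
  by rewrite sumr_const -[X in X / _]mulr_natr mulfK.
by move=> x xI; apply: (@b_rinv I) => //; rewrite -?minreps_ascents // groupM.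
Qed.

Lemma solomon_character (chi : gT -> R) :
  (forall w g, w \in H -> g \in H -> chi (w ^ g)%g = chi w) ->
  \sum_(I in powerset (simples H)) (-1) ^+ #|I| * ((\sum_(x in <<I>>) chi x) / #|<<I>>|%:R) =
  (\sum_(w in H) sgn H w * chi w) / #|H|%:R.
Proof.
move=> chiJ; have [w0 [w0H _ hw0]] := longest_ex rc rH.
(* Frobenius reciprocity: the mean of [chi] over [<<I>>] is its pairing on [H] with the permutation
   character of the cosets of [<<I>>]. *)
have trI I : I \subset simples H -> (\sum_(x in <<I>>) chi x) / #|<<I>>|%:R =
    (\sum_(w in H) chi w * (\sum_(u in minreps H I) coord (fun g => b u (w * g)%g) u)) / #|H|%:R.
  move=> IS; have GH := simples_gen_sub IS.
  under [in RHS]eq_bigr => w wH do rewrite -(trace_coset IS wH) mulrA mulr_sumr.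
  rewrite -mulr_suml [in RHS]mulrAC; congr (_ / _).
  transitivity ((\sum_(g in H) \sum_(x in <<I>>) chi x) / #|H|%:R).
    by rewrite sumr_const -[X in X / _]mulr_natr mulfK.
  congr (_ / _).
  rewrite [RHS](exchange_big_dep (mem H)) /=; last by move=> w g _ /andP[].
  apply: eq_bigr => g gH; rewrite (reindex_inj (conjg_inj g)) /=.
  have yH y : (y ^ g)%g \in <<I>> -> y \in H.
    by move=> yI; rewrite -(groupJr y gH) (fintype.subsetP GH).
  apply: eq_big => [y|y yI]; last by rewrite mulr1 chiJ // yH.
  by rewrite gH; case: (boolP (_ \in <<I>>)) => [/yH ->|_]; rewrite ?andbF.
under eq_bigr => I IP do rewrite trI -?powersetE // mulrA mulr_sumr.
rewrite -mulr_suml; congr (_ / _); rewrite exchange_big /=.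
apply: eq_bigr => w wH; rewrite mulrC.
under eq_bigr => I _ do rewrite mulrCA.
rewrite -mulr_sumr (sum_ascents T inv H (fun u => coord (fun g => b u (w * g)%g) u)).
rewrite (eq_bigl (pred1 w0)) => [|u]; last first.
  by case: (boolP (u \in H)) => [uH|nu] /=; [rewrite hw0|apply/esym; apply: contraNF nu => /eqP ->].
rewrite big_pred1_eq; congr (_ * _).
apply: (mulIf (sgn_neq0 T inv R H w0)); rewrite -coord_longest //.
have asc0 : ascents H w0 = finset.set0 by apply/eqP; rewrite hw0.
rewrite (bigD1 (w^-1 * w0)%g) ?groupM ?groupV //= mulKVg b_self mul1r big1 ?addr0.
  by rewrite (sgnM rc) // (sgnV rc).
move=> g /andP[gH ng]; rewrite /b asc0 gen0 (sameP set1gP eqP) -eq_mulVg1.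
case: (w0 =P _) => [e|_]; last by rewrite mul0r.
by rewrite e mulKg eqxx in ng.
Qed.

End SolomonCharacter.

(** * Products of a polynomial with a formal power series *)

Section Convolution.
Local Open Scope ring_scope.
Variable R : comNzRingType.
Implicit Types (p q : {poly R}) (h : nat -> R).

(** The coefficient of degree [K] in the product of [p] with the power series of coefficients [h].
    The series stays a function; [convol_coef] truncates it to compute with polynomials. *)
Definition convol p h (K : nat) : R := \sum_(i < K.+1) p`_i * h (K - i)%N.

Lemma convol_coef p h K M : (K <= M)%N ->
  convol p h K = (p * \poly_(j < M.+1) h j)`_K.
Proof.
move=> KM; rewrite coefM; apply: eq_bigr => i _; rewrite coef_poly.
by rewrite (leq_ltn_trans (leq_subr _ _)).
Qed.

Lemma eq_convol p h h' : h =1 h' -> convol p h =1 convol p h'.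
Proof. by move=> e K; apply: eq_bigr => i _; rewrite e. Qed.

Lemma convolM p q h K : convol (p * q) h K = convol p (convol q h) K.
Proof.
rewrite (@convol_coef _ _ _ K) // -mulrA coefM; apply: eq_bigr => i _.
by rewrite (@convol_coef _ _ _ K) // leq_subr.
Qed.

Lemma convolC p q h K : convol p (convol q h) K = convol q (convol p h) K.
Proof. by rewrite -!convolM mulrC. Qed.

Lemma convol_suml (I : finType) (P : pred I) (F : I -> {poly R}) h K :
  convol (\sum_(i | P i) F i) h K = \sum_(i | P i) convol (F i) h K.
Proof.
rewrite exchange_big /=; apply: eq_bigr => i _; rewrite -mulr_suml.
by rewrite coef_sum.
Qed.

Lemma convol_sumr (I : finType) (P : pred I) p (h : I -> nat -> R) K :
  convol p (fun k => \sum_(i | P i) h i k) K = \sum_(i | P i) convol p (h i) K.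
Proof. by rewrite exchange_big /=; apply: eq_bigr => i _; rewrite -mulr_sumr. Qed.

Lemma convolZl a p h K : convol (a *: p) h K = a * convol p h K.
Proof. by rewrite /convol mulr_sumr; apply: eq_bigr => i _; rewrite coefZ mulrA. Qed.

Lemma convolZr a p h K : convol p (fun k => a * h k) K = a * convol p h K.
Proof. by rewrite /convol mulr_sumr; apply: eq_bigr => i _; rewrite mulrCA. Qed.

Lemma convolBr p h h' K : convol p (fun k => h k - h' k) K = convol p h K - convol p h' K.
Proof. by rewrite /convol -sumrB; apply: eq_bigr => i _; rewrite mulrBr. Qed.

Lemma convolXn n h K : convol 'X^n h K = if (n <= K)%N then h (K - n)%N else 0.
Proof.
rewrite (@convol_coef _ _ _ K) // coefXnM ltnNge; case: leqP => //= nK.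
by rewrite coef_poly ltnS leq_subr.
Qed.

Lemma convol1 h K : convol 1 h K = h K.
Proof. by rewrite -(expr0 'X) convolXn subn0. Qed.

End Convolution.

(** * Length polynomial times invariant series *)

Section PoincareSeries.
Import finset.
Local Open Scope group_scope.
Local Open Scope ring_scope.
Variables (gT : finGroupType) (T : {set gT}) (inv : gT -> gT -> bool).
Hypothesis rc : reflection_cocycle T inv.
Variables (R : numFieldType) (chi : nat -> gT -> R).
Implicit Types (H : {group gT}) (I : {set gT}).

(* [chi K] plays the character of a group on the polynomials of degree less than [K]. *)
Definition inv_series (H : {set gT}) (K : nat) : R := (\sum_(w in H) chi K w) / #|H|%:R.

Hypothesis chi0 : forall w, chi 0 w = 0.
Hypothesis chiJ : forall K w g, chi K (w ^ g)%g = chi K w.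
Hypothesis chi_skew : forall H K, reflgroup T H ->
  (\sum_(w in H) sgn T inv R H w * chi K w) / #|H|%:R = inv_series H (K - #|T :&: H|)%N.

Local Notation simples := (simples T inv).

Lemma reflgroup_sub_simples H I : I \subset simples H -> reflgroup T <<I>>.
Proof.
move=> IS; rewrite /reflgroup genS // finset.subsetI sub_gen // andbT.
by apply/fintype.subsetP => s /(fintype.subsetP IS) /simplesP[].
Qed.

Lemma gen_proper H I : I \proper simples H -> (#|<<I>>| < #|H|)%N.
Proof.
case/properP => IS [s sS sI]; apply: proper_card; apply/properP; split.
  exact: simples_gen_sub IS.
have /simplesP[sT sH hs] := sS; exists s => //; apply/negP => sG.
have [i iI si] := gen_descent rc IS sG (rc_neq1 rc sT).
have /simplesP[iT iH _] := fintype.subsetP IS _ iI.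
case: (eqVneq i s) => [e|ne]; first by rewrite -e iI in sI.
by rewrite hs in si.
Qed.

Lemma minreps_simples H : reflgroup T H -> minreps inv H (simples H) = [set 1%g].
Proof.
move=> rH; apply/setP => u; rewrite finset.in_set1; apply/minrepsP/eqP => [[uH hu]|->].
  apply/eqP/negPn/negP => u1; have [s sS us] := descent_ex rc rH uH u1.
  by rewrite hu in us.
by split=> // s /simplesP[sT _ _]; rewrite (inv1 rc).
Qed.

(* The induction hypothesis covers all the proper parabolics; for [H] itself, Solomon's
   formula says that the defect [D] of the claim satisfies [(-1) ^ r * D = X ^ N * D]
   with [N > 0], so that [D = 0]. *)
Lemma convol_lenpoly H K : reflgroup T H ->
  convol (lenpoly T inv R H) (inv_series H) K = chi K 1%g.
Proof.
have [k] := ubnP #|H|; elim: k H K => // k IHk H K Hk rH.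
set W := lenpoly T inv R H.
pose M I : {poly R} := \sum_(u in minreps inv H I) 'X^(len T inv H u).
pose s j := chi j 1%g.
case: (posnP #|T :&: H|) => [N0|Npos].
  have S0 : simples H = finset.set0.
    apply/eqP; rewrite -finset.subset0 -(cards0_eq N0).
    by apply/fintype.subsetP => t /simplesP[tT tH _]; rewrite inE tT.
  have H1 : H :=: 1%g by rewrite -(reflgroup_simples rc rH) S0 gen0.
  rewrite /W /lenpoly (eq_convol _ (h' := s)) => [|j].
    by rewrite H1 big_set1 (len1 rc [1 gT]%G) expr0 convol1.
  by rewrite /inv_series H1 big_set1 cards1 divr1.
pose D j := convol W (inv_series H) j - s j.
suff D0 : forall j, D j = 0 by apply/eqP; rewrite -subr_eq0; apply/eqP/D0.
(* The length polynomial of [H] is [M I] times that of [<<I>>], to which the induction hypothesis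
   applies when [I] is proper. For [I = simples H] the factor [M I] is 1 and the defect [D]
   remains. *)
have MI I j : I \subset simples H ->
    convol W (inv_series <<I>>) j = convol (M I) s j + (I == simples H)%:R * D j.
  move=> IS; rewrite {1}/W (lenpoly_factor rc R IS) convolM -/(M I).
  case: (eqVneq I (simples H)) => [->|nI].
    rewrite mul1r /M minreps_simples // big_set1 (len1 rc) expr0 !convol1.
    by rewrite (reflgroup_simples rc rH) /D addrC subrK.
  rewrite mul0r addr0; apply: eq_convol => i; apply: (IHk <<I>>%G).
    by apply: leq_trans (_ : #|H| <= k)%N => //; apply: gen_proper; rewrite finset.properEneq nI.
  exact: reflgroup_sub_simples IS.
have e1 j : convol W (fun i => inv_series H (i - #|T :&: H|)%N) j =
    convol 'X^#|T :&: H| s j + (-1) ^+ #|simples H| * D j.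
  transitivity (convol W (fun i => \sum_(I in powerset (simples H))
      (-1) ^+ #|I| * inv_series <<I>> i) j).
    by apply: eq_convol => i; rewrite -chi_skew // -(solomon_character rc rH).
  rewrite convol_sumr -(altsum_minreps rc R rH).
  transitivity (\sum_(I in powerset (simples H)) (-1) ^+ #|I| *
    (convol (M I) s j + (I == simples H)%:R * D j)).
    by apply: eq_bigr => I; rewrite powersetE => IS; rewrite convolZr MI.
  rewrite convol_suml; under eq_bigr do rewrite mulrDr.
  rewrite big_split; congr (_ + _).
    apply: eq_bigr => I _; rewrite -convolZl; congr (convol _ _ _).
    by rewrite -mul_polyC rmorphXn /= rmorphN1.
  rewrite (bigD1 (simples H)) ?powersetE //= eqxx mul1r big1 ?addr0 // => I /andP[_ /negbTE ->].
  by rewrite mul0r mulr0.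
have e2 j : convol W (fun i => inv_series H (i - #|T :&: H|)%N) j =
    convol 'X^#|T :&: H| (convol W (inv_series H)) j.
  (* When [i] is below the number of reflections, the truncated difference is 0, where [chi]
     vanishes: shifting the argument is then multiplication by a power of X. *)
  rewrite convolC; apply: eq_convol => i; rewrite convolXn; case: leqP => // Ni.
  rewrite /inv_series big1 ?mul0r // => w _.
  by rewrite (eqP (_ : (i - #|T :&: H|)%N == 0%N)) ?chi0 // subn_eq0 ltnW.
move=> j; have [n] := ubnP j; elim: n j => // n IHn j jn.
have : (-1) ^+ #|simples H| * D j = convol 'X^#|T :&: H| D j.
  by rewrite [in RHS]/D convolBr -e2 e1 [_ + _ * D j]addrC addrK.
rewrite convolXn; case: leqP => [Nj|_].
  rewrite (IHn (j - _)%N); last by rewrite (leq_trans _ (jn : j <= n)%N) // ltn_subrL Npos (leq_trans Npos Nj).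
  by move/eqP; rewrite mulf_eq0 signr_eq0 => /eqP.
by move/eqP; rewrite mulf_eq0 signr_eq0 => /eqP.
Qed.

End PoincareSeries.

(** * Invariant and skew-invariant polynomials *)

Section LinearSubstitution.
Local Open Scope ring_scope.
Variables (R : numFieldType) (n : nat).
Implicit Types (A B : 'M[R]_n) (a : 'cV[R]_n) (p q : {mpoly R[n]}).

Definition linform a : {mpoly R[n]} := \sum_i a i 0 *: 'X_i.

(** As a function this is p(A x), see [meval_linsub]; composition therefore reverses the order of
    the matrices in [linsubM]. *)
Definition linsub A p : {mpoly R[n]} := p \mPo [tuple linform (row i A)^T | i < n].

Lemma linsub_is_linear A : linear (linsub A).
Proof. by move=> c p q; rewrite /linsub comp_mpolyD comp_mpolyZ. Qed.
HB.instance Definition _ A := GRing.isLinear.Build R {mpoly R[n]} {mpoly R[n]} _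
  (linsub A) (linsub_is_linear A).

Lemma linsub_is_monoid_morphism A : monoid_morphism (linsub A).
Proof. by split=> [|p q]; rewrite /linsub ?rmorph1 ?rmorphM. Qed.
HB.instance Definition _ A := GRing.isMonoidMorphism.Build {mpoly R[n]} {mpoly R[n]}
  (linsub A) (linsub_is_monoid_morphism A).

Lemma linformD a b : linform (a + b) = linform a + linform b.
Proof. by rewrite -big_split; apply: eq_bigr => i _; rewrite mxE scalerDl. Qed.

Lemma linformZ c a : linform (c *: a) = c *: linform a.
Proof. by rewrite scaler_sumr; apply: eq_bigr => i _; rewrite mxE scalerA. Qed.

Lemma linform0 : linform 0 = 0.
Proof. by rewrite /linform big1 // => i _; rewrite mxE scale0r. Qed.

Lemma linform_coef a i : (linform a)@_(U_(i)) = a i 0.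
Proof.
rewrite raddf_sum (bigD1 i) //= mcoeffZ mcoeffXU eqxx mulr1 big1 ?addr0 // => j ji.
by rewrite mcoeffZ mcoeffXU (negbTE ji) mulr0.
Qed.

Lemma linform_eq0 a : (linform a == 0) = (a == 0).
Proof.
apply/eqP/eqP => [e|->]; last exact: linform0.
by apply/colP => i; rewrite -linform_coef e mcoeff0 mxE.
Qed.

Lemma msize_linform_le a : (msize (linform a) <= 2)%N.
Proof.
apply: leq_trans (msize_sum _ _ _) _; apply/bigmax_leqP => i _.
by apply: leq_trans (msizeZ_le _ _) _; rewrite msizeX mdeg1.
Qed.

Lemma msize_linform a : a != 0 -> msize (linform a) = 2%N.
Proof.
move=> a0; apply/eqP; rewrite eqn_leq msize_linform_le /=.
have [i ai] : exists i, a i 0 != 0.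
  apply/existsP; apply: contraNT a0 => /existsPn h; apply/eqP/colP => i.
  by rewrite mxE; apply/eqP/negbNE.
have /msize_mdeg_lt : U_(i)%MM \in msupp (linform a) by rewrite mcoeff_msupp linform_coef.
by rewrite mdeg1.
Qed.

Lemma linsubX A i : linsub A 'X_i = linform (row i A)^T.
Proof. by rewrite /linsub comp_mpolyXU -tnth_nth tnth_mktuple. Qed.

Lemma linsub_linform A a : linsub A (linform a) = linform (A^T *m a).
Proof.
rewrite raddf_sum /=; under eq_bigr => i _ do rewrite linearZ /= linsubX scaler_sumr.
rewrite exchange_big; apply: eq_bigr => j _; rewrite mxE scaler_suml.
by apply: eq_bigr => i _; rewrite !mxE scalerA mulrC.
Qed.

Lemma linsubXm A m : linsub A 'X_[m] = \prod_i linform (row i A)^T ^+ m i.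
Proof. by rewrite /linsub comp_mpolyX; apply: eq_bigr => i _; rewrite tnth_mktuple. Qed.

Lemma linsubE A p : linsub A p = \sum_(m <- msupp p) p@_m *: linsub A 'X_[m].
Proof. exact: comp_mpolyEX. Qed.

Lemma linsubM A B p : linsub A (linsub B p) = linsub (B *m A) p.
Proof.
rewrite (linsubE B) (linsubE (B *m A)) (raddf_sum (linsub A)).
apply: eq_bigr => m _; rewrite /= linearZ /=; congr (_ *: _).
rewrite !linsubXm rmorph_prod; apply: eq_bigr => i _; rewrite rmorphXn /= linsub_linform.
by rewrite row_mul trmx_mul.
Qed.

Lemma linsub1 p : linsub 1%:M p = p.
Proof.
rewrite -[RHS]comp_mpoly_id /linsub; congr (_ \mPo _).
apply/eq_from_tnth => i; rewrite !tnth_mktuple /linform (bigD1 i) //= !mxE eqxx scale1r.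
by rewrite big1 ?addr0 // => j ji; rewrite !mxE eq_sym (negbTE ji) scale0r.
Qed.

Lemma msizeM_leq p q : (msize (p * q) <= (msize p + msize q).-1)%N.
Proof.
have [->|p0] := eqVneq p 0; first by rewrite mul0r msize0.
have [->|q0] := eqVneq q 0; first by rewrite mulr0 msize0.
by rewrite msizeM.
Qed.

Lemma msize_prod_le (I : Type) (r : seq I) (F : I -> {mpoly R[n]}) (d : I -> nat) :
  (forall i, (msize (F i) <= (d i).+1)%N) ->
  (msize (\prod_(i <- r) F i) <= (\sum_(i <- r) d i).+1)%N.
Proof.
move=> h; elim: r => [|i r IHr]; first by rewrite !big_nil msize1.
rewrite !big_cons; apply: leq_trans (msizeM_leq _ _) _.
by have := h i; move: IHr; lia.
Qed.

Lemma msize_linsub A p : (msize (linsub A p) <= msize p)%N.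
Proof.
rewrite linsubE big_seq.
apply: leq_trans (msize_sum _ _ _) _; apply/bigmax_leqP_seq => m mp _.
apply: leq_trans (msizeZ_le _ _) _; rewrite linsubXm.
apply: leq_trans (msize_mdeg_lt mp); rewrite mdegE.
apply: msize_prod_le => i; elim: (m i) => [|k IHk]; first by rewrite expr0 msize1.
rewrite exprS; apply: leq_trans (msizeM_leq _ _) _.
by have := msize_linform_le (row i A)^T; move: IHk; lia.
Qed.

Lemma meval_linform a x : (linform a).@[x] = \sum_i a i 0 * x i.
Proof. by rewrite raddf_sum /=; apply: eq_bigr => i _; rewrite mevalZ mevalXU. Qed.

Lemma meval_linsub A p (x : 'cV[R]_n) :
  (linsub A p).@[fun i => x i 0] = p.@[fun i => (A *m x) i 0].
Proof.
rewrite /linsub comp_mpoly_meval; apply: meval_eq => i; rewrite tnth_mktuple meval_linform.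
by rewrite mxE; apply: eq_bigr => j _; rewrite !mxE.
Qed.

Definition coproj a : 'M[R]_n := 1%:M - a *m a^T.

(** For [a] of norm 1, [coproj a] is the orthogonal projection onto the hyperplane of [a].
    Congruence modulo [linform a] is stable under sums and products, so constants and variables
    suffice. *)
Lemma linform_dvd a p : exists r, p - linsub (coproj a) p = linform a * r.
Proof.
pose P q := exists r, q - linsub (coproj a) q = linform a * r.
have PD q1 q2 : P q1 -> P q2 -> P (q1 + q2).
  by move=> [r1 e1] [r2 e2]; exists (r1 + r2); rewrite raddfD /= opprD addrACA e1 e2 mulrDr.
have PM q1 q2 : P q1 -> P q2 -> P (q1 * q2).
  move=> [r1 e1] [r2 e2]; exists (r1 * q2 + linsub (coproj a) q1 * r2); rewrite rmorphM /=.
  rewrite mulrDr mulrA -e1 mulrCA -e2; ring.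
have P0 : P 0 by exists 0; rewrite raddf0 subr0 mulr0.
have P1 : P 1 by exists 0; rewrite rmorph1 subrr mulr0.
have PX i : P 'X_i.
  exists (a i 0)%:MP; rewrite linsubX /coproj.
  have -> : 'X_i = linform (row i 1%:M)^T :> {mpoly R[n]} by rewrite -linsubX linsub1.
  rewrite -[linform (row i 1%:M)^T]opprK -opprD -[X in X + _]scaleN1r -linformZ -linformD.
  rewrite mulrC mul_mpolyC -linformZ -scaleN1r -linformZ; congr linform.
  by apply/colP => j; rewrite !mxE big_ord1 !mxE; ring.
rewrite [p]mpolyE; elim/big_ind: _ => // m _; rewrite -mul_mpolyC; apply: (PM).
  by exists 0; rewrite /linsub comp_mpolyC subrr mulr0.
rewrite mpolyXE_id; elim/big_ind: _ => // i _; elim: (m i) => [|k IHk]; first by rewrite expr0.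
by rewrite exprS; apply: PM.
Qed.

End LinearSubstitution.

(** * Polynomials of bounded degree as row vectors *)

Section Coordinates.
Local Open Scope ring_scope.
Variables (R : numFieldType) (n : nat).
Implicit Types (A B : 'M[R]_n) (p q : {mpoly R[n]}) (K : nat).

(** In the full-rank factorisation [P = C *m Rb], idempotence forces [Rb *m C = 1], an identity
    matrix of size the rank and of the same trace as [P]. *)
Lemma mxtrace_idempotent m (P : 'M[R]_m) : P *m P = P -> \tr P = (\rank P)%:R.
Proof.
move=> PP; have := mulmx_base P; set C := col_base P; set Rb := row_base P => CR.
have : Rb *m C = 1%:M.
  apply: (row_free_inj (A := Rb)); first exact: row_base_free.
  apply: (row_full_inj (A := C)); first exact: col_base_full.
  by rewrite mul1mx -(mulmxA Rb C Rb) (mulmxA C Rb) !CR PP.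
by move=> RC; rewrite -{1}CR mxtrace_mulC RC mxtrace1.
Qed.

Local Notation dimU K := #|{: 'X_{1..n < K}}|.

Definition bmon K (j : 'I_(dimU K)) : 'X_{1..n} := (enum_val j : 'X_{1..n < K}).

Lemma bmon_inj K : injective (@bmon K).
Proof. by move=> i j /val_inj /enum_val_inj. Qed.

Lemma mdeg_bmon K (j : 'I_(dimU K)) : (mdeg (bmon j) < K)%N.
Proof. exact: bmdeg. Qed.

Definition vecm K p : 'rV[R]_(dimU K) := \row_j p@_(bmon j).
Definition polym K (r : 'rV[R]_(dimU K)) : {mpoly R[n]} := \sum_j r 0 j *: 'X_[bmon j].

Lemma vecm_is_linear K : linear (@vecm K).
Proof. by move=> c p q; apply/rowP => j; rewrite !mxE mcoeffD mcoeffZ. Qed.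
HB.instance Definition _ K := GRing.isLinear.Build R _ _ _ (@vecm K) (@vecm_is_linear K).

Lemma polym_is_linear K : linear (@polym K).
Proof.
move=> c p q; rewrite /polym scaler_sumr -big_split; apply: eq_bigr => i _ /=.
by rewrite !mxE scalerDl scalerA.
Qed.
HB.instance Definition _ K := GRing.isLinear.Build R _ _ _ (@polym K) (@polym_is_linear K).

Lemma vecmK K p : (msize p <= K)%N -> polym (vecm K p) = p.
Proof.
move=> /mpolywE e; rewrite [RHS]e (reindex (fun j : 'I_(dimU K) => (enum_val j : 'X_{1..n < K}))) /=; last first.
  by apply/onW_bij; apply: enum_val_bij.
by apply: eq_bigr => j _; rewrite mxE.
Qed.

Lemma polymK K : cancel (@polym K) (@vecm K).
Proof.
move=> r; apply/rowP => j; rewrite mxE raddf_sum (bigD1 j) //= mcoeffZ mcoeffX eqxx mulr1.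
rewrite big1 ?addr0 // => i ij; rewrite mcoeffZ mcoeffX .
by rewrite (inj_eq (@bmon_inj _)) (negbTE ij) mulr0.
Qed.

Lemma msize_polym K (r : 'rV[R]_(dimU K)) : (msize (polym r) <= K)%N.
Proof.
apply: leq_trans (msize_sum _ _ _) _; apply/bigmax_leqP => j _.
by apply: leq_trans (msizeZ_le _ _) _; rewrite msizeX mdeg_bmon.
Qed.

Definition opm K K' (f : {mpoly R[n]} -> {mpoly R[n]}) : 'M[R]_(dimU K, dimU K') :=
  \matrix_i vecm K' (f 'X_[bmon i]).

Lemma mul_opm K K' (f : {linear {mpoly R[n]} -> {mpoly R[n]}}) (r : 'rV[R]_(dimU K)) :
  r *m opm K K' f = vecm K' (f (polym r)).
Proof.
rewrite mulmx_sum_row /polym (linear_sum f) (linear_sum (@vecm K')).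
by apply: eq_bigr => j _; rewrite rowK /= !linearZ.
Qed.

Definition repm K A : 'M[R]_(dimU K) := opm K K (linsub A).

Lemma mul_repm K A p : (msize p <= K)%N -> vecm K p *m repm K A = vecm K (linsub A p).
Proof. by move=> pK; rewrite mul_opm vecmK. Qed.

(** Matrices act on row vectors from the right, which undoes the reversal in [linsubM]. *)
Lemma repmM K A B : repm K (A *m B) = repm K A *m repm K B.
Proof.
apply/row_matrixP => i; rewrite !row_mul !rowK -linsubM mul_repm //.
by apply: leq_trans (msize_linsub _ _) _; rewrite msizeX mdeg_bmon.
Qed.

Lemma repm1 K : repm K 1%:M = 1%:M.
Proof.
apply/row_matrixP => i; rewrite rowK linsub1; apply/rowP => j.
by rewrite !mxE mcoeffX (inj_eq (@bmon_inj _)).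
Qed.

End Coordinates.

(** * Isotypic projectors of linear characters with values 1 and -1 *)

Section Isotypic.
Import finset.
Local Open Scope group_scope.
Local Open Scope ring_scope.
Variables (R : numFieldType) (n : nat) (gT : finGroupType) (rho : gT -> 'M[R]_n).
Hypothesis rhoM : forall x y, rho (x * y)%g = rho x *m rho y.
Implicit Types (H : {group gT}) (K : nat).

Local Notation rep K w := (repm K (rho w)).

Definition poly_char K (w : gT) : R := \tr (rep K w).

Lemma poly_charJ K w g : poly_char K (w ^ g)%g = poly_char K w.
Proof.
rewrite /poly_char conjgE rhoM repmM mxtrace_mulC -repmM -rhoM.
by rewrite mulgK.
Qed.

Lemma poly_char0 w : poly_char 0 w = 0.
Proof.
by rewrite /poly_char /mxtrace big1 // => i _; have := mdeg_bmon i; rewrite ltn0.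
Qed.

Definition isoproj (H : {set gT}) (eps : gT -> R) K :=
  #|H|%:R^-1 *: \sum_(w in H) eps w *: rep K w.

Variables (H : {group gT}) (eps : gT -> R).
Hypothesis epsM : forall x y, x \in H -> y \in H -> eps (x * y)%g = eps x * eps y.
Hypothesis eps_sq : forall x, x \in H -> eps x * eps x = 1.

Lemma isoproj_mul K w : w \in H -> isoproj H eps K *m rep K w = eps w *: isoproj H eps K.
Proof.
move=> wH; rewrite /isoproj -scalemxAl scalerA mulrC -scalerA; congr (_ *: _).
rewrite mulmx_suml scaler_sumr [RHS](reindex_inj (mulIg w)) /=.
apply: eq_big => [x|x xH]; first by rewrite groupMr.
by rewrite -scalemxAl epsM // scalerA mulrCA eps_sq // mulr1 rhoM repmM.
Qed.

Lemma isoproj_fix K m (M : 'M[R]_(m, _)) :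
  (forall w, w \in H -> M *m rep K w = eps w *: M) -> M *m isoproj H eps K = M.
Proof.
move=> h; rewrite /isoproj -scalemxAr mulmx_sumr.
rewrite (eq_bigr (fun=> M)) => [|w wH]; last by rewrite -scalemxAr h // scalerA eps_sq // scale1r.
rewrite sumr_const -scaler_nat scalerA mulVf ?scale1r //.
by rewrite pnatr_eq0 -lt0n cardG_gt0.
Qed.

Lemma isoproj_idem K : isoproj H eps K *m isoproj H eps K = isoproj H eps K.
Proof. by apply: isoproj_fix => w wH; rewrite isoproj_mul. Qed.

(** The trace of a projector is its rank, so these character averages are dimensions of spaces of
    invariants or skew invariants. *)
Lemma rank_isoproj K :
  (\rank (isoproj H eps K))%:R = (\sum_(w in H) eps w * poly_char K w) / #|H|%:R.
Proof.
rewrite -mxtrace_idempotent ?isoproj_idem // mxtraceZ mulrC raddf_sum; congr (_ * _).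
by apply: eq_bigr => w _; rewrite /= mxtraceZ.
Qed.

Lemma isoprojP K (r : 'rV[R]_(#|{: 'X_{1..n < K}}|)) :
  reflect (forall w, w \in H -> linsub (rho w) (polym r) = eps w *: polym r)
          (r <= isoproj H eps K)%MS.
Proof.
apply: (iffP idP) => [/submxP[D ->] w wH|h].
  rewrite -linearZ -[LHS](@vecmK _ _ K).
    by rewrite -mul_opm -mulmxA isoproj_mul // scalemxAr.
  exact: leq_trans (msize_linsub _ _) (msize_polym _).
apply/submxP; exists r; rewrite isoproj_fix // => w wH.
by rewrite /repm mul_opm /= h // linearZ /= polymK.
Qed.

End Isotypic.

(** * Skew invariants as multiples of the product of the root forms *)

Section SkewInvariants.
Import finset.
Local Open Scope group_scope.
Local Open Scope ring_scope.
Variables (R : numFieldType) (n : nat) (gT : finGroupType) (rho : gT -> 'M[R]_n).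
Variables (T : {set gT}) (inv : gT -> gT -> bool) (rt : gT -> 'cV[R]_n).

(* [rt t] is the positive root of [t], of norm 1. *)
Record root_system : Prop := RootSystem {
  rs_cocycle : reflection_cocycle T inv;
  rs1 : rho 1%g = 1%:M;
  rsM : forall x y, rho (x * y)%g = rho x *m rho y;
  rs_tr : forall x, (rho x)^T = rho x^-1%g;
  rs_unit : forall t, t \in T -> (rt t)^T *m rt t = 1%:M;
  rs_refl : forall t, t \in T -> rho t = 1%:M - 2 *: (rt t *m (rt t)^T);
  rs_act : forall w t, t \in T -> rho w *m rt t = (-1) ^+ inv w t *: rt (t ^ w^-1)%g;
  rs_indep : forall t u, t \in T -> u \in T -> t != u -> coproj (rt t) *m rt u != 0 }.

Hypothesis rs : root_system.
Implicit Types (H : {group gT}) (p q : {mpoly R[n]}).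

Let rc : reflection_cocycle T inv. Proof. exact: rs_cocycle. Qed.
Local Notation sgn := (sgn T inv R).
Local Notation chi := (poly_char rho).

Definition rootprod (H : {set gT}) : {mpoly R[n]} := \prod_(t in T :&: H) linform (rt t).

Lemma rt_neq0 t : t \in T -> rt t != 0.
Proof.
move=> /(rs_unit rs) e; apply/eqP => r0; move: e; rewrite r0 mulmx0 => /matrixP /(_ 0 0).
by rewrite !mxE => /esym/eqP; rewrite oner_eq0.
Qed.

Lemma prod_sign_inv H w : \prod_(t in T :&: H) (-1) ^+ inv w t = sgn H w :> R.
Proof.
rewrite -[RHS]/((-1) ^+ len T inv H w) /len -prodr_const (big_setID [set t in T :&: H | inv w t]) /=.
rewrite [X in _ * X]big1 ?mulr1; last first.
  by move=> t; rewrite !inE => /andP[]; case: (t \in T) => //=; case: (t \in H) => //= /negbTE ->.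
apply: eq_big => [t|t].
  by rewrite !inE; case: (t \in T) => //=; case: (t \in H).
by rewrite !inE => /and3P[_ _ ->].
Qed.

Lemma linsub_rt w t : t \in T ->
  linsub (rho w) (linform (rt t)) = (-1) ^+ inv w^-1%g t *: linform (rt (t ^ w)%g).
Proof. by move=> tT; rewrite linsub_linform (rs_tr rs) (rs_act rs) // invgK linformZ. Qed.

Lemma linsub_rootprod H w : w \in H ->
  linsub (rho w) (rootprod H) = sgn H w *: rootprod H.
Proof.
move=> wH; rewrite /rootprod rmorph_prod /=.
rewrite (eq_bigr (fun t => (-1) ^+ inv w^-1%g t *: linform (rt (t ^ w)%g))); last first.
  by move=> t /setIP[tT _]; rewrite linsub_rt.
rewrite scaler_prod prod_sign_inv (sgnV rc) //; congr (_ *: _).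
rewrite [RHS](reindex_inj (conjg_inj w)) /=; apply: eq_bigl => t.
rewrite !inE; congr (_ && _); last by rewrite memJ_norm // (fintype.subsetP (normG _)).
apply/idP/idP => [/(rc_conj rc)//|tT].
by rewrite -(conjgK w t); apply: (rc_conj rc).
Qed.

(** The reflection fixes its hyperplane pointwise, so there [p] equals its own opposite. *)
Lemma coproj_refl t p : t \in T -> linsub (rho t) p = - p ->
  linsub (coproj (rt t)) p = 0.
Proof.
move=> tT e; have : linsub (coproj (rt t)) (linsub (rho t) p) = linsub (coproj (rt t)) p.
  rewrite linsubM (rs_refl rs) //; congr (linsub _ _).
  rewrite /coproj; set Q := rt t *m _.
  have QQ : Q *m Q = Q by rewrite mulmxA -(mulmxA (rt t)) (rs_unit rs) // mulmx1.
  rewrite mulmxBr mulmx1 mulmxBl mul1mx -scalemxAl QQ.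
  by apply/matrixP => i j; rewrite !mxE; ring.
rewrite e raddfN /= => /esym/eqP; rewrite -addr_eq0 -mulr2n -scaler_nat scaler_eq0.
by rewrite pnatr_eq0 => /eqP.
Qed.

(** The forms are divided out one at a time. By [rs_indep] those already removed do not vanish on
    the hyperplane of the next, so the quotient does; no unique factorisation is involved. *)
Lemma rootprod_dvd H p : (forall t, t \in T -> t \in H -> linsub (rho t) p = - p) ->
  exists r, p = rootprod H * r.
Proof.
move=> h; rewrite /rootprod -big_enum /=.
have : uniq (enum (T :&: H)) by apply: enum_uniq.
have : all (fun t => (t \in T) && (t \in H)) (enum (T :&: H)).
  by apply/allP => t; rewrite mem_enum => /setIP[-> ->].
elim: (enum _) => [_ _|t l IHl /= /andP[/andP[tT tH] lTH] /andP[tl ul]].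
  by exists p; rewrite big_nil mul1r.
have [r e] := IHl lTH ul; have := coproj_refl tT (h t tT tH).
rewrite e rmorphM rmorph_prod => /eqP; rewrite mulf_eq0 prodf_seq_eq0 => /orP[/hasP[u ul0 /=]|/eqP r0].
  have /andP[uT uH] := allP lTH _ ul0.
  rewrite linsub_linform linform_eq0 /coproj linearB /= trmx1 trmx_mul trmxK -/(coproj (rt t)).
  have tu : t != u by apply: contraNneq tl => ->.
  by rewrite (negbTE (rs_indep rs tT uT tu)).
have [r' e'] := linform_dvd (rt t) r; exists r'; move: e'; rewrite r0 subr0 => ->.
by rewrite big_cons; ring.
Qed.

Lemma msize_rootprod H q : q != 0 -> msize (rootprod H * q) = (#|T :&: H| + msize q)%N.
Proof.
move=> q0; rewrite /rootprod -big_enum cardE /=.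
have : all (mem T) (enum (T :&: H)) by apply/allP => t; rewrite mem_enum => /setIP[].
elim: (enum _) => [_|t l IHl /= /andP[tT lT]]; first by rewrite big_nil mul1r.
have r0 : linform (rt t) != 0 by rewrite linform_eq0 rt_neq0.
rewrite big_cons -mulrA; set P := \prod_(_ <- _) _ * q in IHl *.
have P0 : P != 0.
  by rewrite -(msize_poly_eq0 P) IHl // addn_eq0 msize_poly_eq0 (negbTE q0) andbF.
by rewrite msizeM // IHl // msize_linform ?rt_neq0.
Qed.

Lemma skewP H p : reflgroup T H ->
  (forall w, w \in H -> linsub (rho w) p = sgn H w *: p) ->
  exists2 q, p = rootprod H * q & forall w, w \in H -> linsub (rho w) q = q.
Proof.
move=> rH h; have [t tT tH|q e] := @rootprod_dvd H p.
  by rewrite h // (sgn_refl rc) // scaleN1r.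
exists q => // w wH; have := h w wH; rewrite e rmorphM /= linsub_rootprod // -scalerAl.
move/(scalerI (sgn_neq0 T inv R H w)); apply: mulfI.
rewrite /rootprod; apply/prodf_neq0 => t /setIP[tT _].
by rewrite linform_eq0 rt_neq0.
Qed.

Let one_sgn (w : gT) : R := 1.

(** Both sides are dimensions. Multiplication by [rootprod H], with matrix [Mu], maps the invariants
    of degree < K - N isomorphically onto the skew invariants of degree < K, where N is the number
    of reflections. *)
Lemma chi_skew H K : reflgroup T H ->
  (\sum_(w in H) sgn H w * chi K w) / #|H|%:R = inv_series chi H (K - #|T :&: H|)%N.
Proof.
move=> rH; have rM := rsM rs.
have sM x y : x \in H -> y \in H -> sgn H (x * y)%g = sgn H x * sgn H y.
  by move=> _ yH; apply: (sgnM rc).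
have s2 x : x \in H -> sgn H x * sgn H x = 1 by move=> _; rewrite -expr2 sqrr_sign.
have o2 x : x \in H -> one_sgn x * one_sgn x = 1 by rewrite mulr1.
have oM x y : x \in H -> y \in H -> one_sgn (x * y)%g = one_sgn x * one_sgn y by rewrite mulr1.
rewrite -(rank_isoproj rM sM s2).
have -> k : inv_series chi H k = (\rank (isoproj rho H one_sgn k))%:R.
  by rewrite (rank_isoproj rM oM o2); congr (_ / _); apply: eq_bigr => w _; rewrite mul1r.
congr (_%:R); set N := #|_|; set K' := (K - N)%N.
pose mulR : {mpoly R[n]} -> {mpoly R[n]} := fun q => rootprod H * q.
have mulR_lin : linear mulR.
  by move=> c p q; rewrite /mulR mulrDr scalerAr.
pose mR : {linear {mpoly R[n]} -> {mpoly R[n]}} :=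
  HB.pack mulR (GRing.isLinear.Build R _ _ _ mulR mulR_lin).
pose Mu := opm K' K mR.
have szR q : (msize q <= K')%N -> (msize (mulR q) <= K)%N.
  move=> qK; case: (eqVneq q 0) => [->|q0]; first by rewrite /mulR mulr0 msize0.
  rewrite msize_rootprod // -/N; have : (0 < msize q)%N by rewrite lt0n msize_poly_eq0.
  by move: qK; rewrite /K'; lia.
have Mu_free : row_free Mu.
  rewrite -kermx_eq0; apply/eqP/row_matrixP => i; rewrite row0.
  have := mulmx_ker Mu => /(congr1 (row i)); rewrite row0 row_mul mul_opm /= => e.
  have : mulR (polym (row i (kermx Mu))) = 0.
    by rewrite -(@vecmK _ _ K (mulR _)) ?e ?linear0 // szR // msize_polym.
  move/eqP; rewrite mulf_eq0 => /orP[|/eqP z].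
    by move/prodf_eq0 => [t /setIP[tT _]]; rewrite linform_eq0 (negbTE (rt_neq0 tT)).
  by rewrite -[LHS]polymK z linear0.
rewrite -(mxrankMfree _ Mu_free); apply/eqP; rewrite eqn_leq; apply/andP; split.
  apply/mxrankS/row_subP => i.
  set r := row i _; have : (r <= isoproj rho H (sgn H) K)%MS by apply: row_sub.
  move/(isoprojP rM sM s2) => /(skewP rH)[q e qinv].
  have qK : (msize q <= K')%N.
    case: (eqVneq q 0) => [->|q0]; first by rewrite msize0.
    by have := msize_polym r; rewrite e msize_rootprod // /K' -/N; lia.
  have -> : r = vecm K' q *m Mu by rewrite mul_opm vecmK // /= -[LHS]polymK e.
  apply: submxMr; apply/(isoprojP rM oM o2) => w wH.
  by rewrite vecmK // qinv // scale1r.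
apply/mxrankS/row_subP => i; rewrite row_mul.
set r := row i _; have : (r <= isoproj rho H one_sgn K')%MS by apply: row_sub.
move/(isoprojP rM oM o2) => h; apply/(isoprojP rM sM s2) => w wH.
rewrite mul_opm vecmK ?szR ?msize_polym //= /mulR rmorphM /= h // scale1r.
by rewrite linsub_rootprod // scalerAl.
Qed.

Lemma invariant_series H K : reflgroup T H ->
  convol (lenpoly T inv R H) (inv_series chi H) K = #|{: 'X_{1..n < K}}|%:R.
Proof.
move=> rH; rewrite (convol_lenpoly rc) //.
- by rewrite /poly_char (rs1 rs) repm1 mxtrace1.
- by move=> w; apply: poly_char0.
- by move=> k w g; apply: (poly_charJ (rsM rs)).
- by move=> G k rG; apply: chi_skew.
Qed.

End SkewInvariants.

(** * Counting monomials by weighted degree *)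

Section WeightedMonomials.
Local Open Scope ring_scope.
Variables (R : numFieldType) (n : nat).
Implicit Types (e : 'I_n -> nat) (m : 'X_{1..n}) (K : nat).

Definition wdeg e m : nat := (\sum_i e i * m i)%N.

Lemma wdegD e m1 m2 : wdeg e (m1 + m2)%MM = (wdeg e m1 + wdeg e m2)%N.
Proof. by rewrite -big_split; apply: eq_bigr => i _; rewrite /= mnmDE mulnDr. Qed.

Lemma mdeg_wdeg e m : (forall i, 0 < e i)%N -> (mdeg m <= wdeg e m)%N.
Proof. by move=> e0; rewrite mdegE; apply: leq_sum => i _; rewrite leq_pmull. Qed.

Definition wmons e K : {set 'X_{1..n < K}} := [set m : 'X_{1..n < K} | (wdeg e m < K)%N].

Lemma wmons1 K : wmons (fun=> 1%N) K = [set: 'X_{1..n < K}]%SET.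
Proof.
apply/setP => m; rewrite !inE /wdeg; under eq_bigr do rewrite mul1n.
by rewrite -mdegE bmdeg.
Qed.

(** Encoding exponents in a type independent of [K] lets the counts for different [K] be compared
    inside one set. Positive weights keep each exponent below [K]. *)
Lemma card_wmons e K M : (forall i, 0 < e i)%N -> (K <= M)%N ->
  #|wmons e K| = #|[set g : {ffun 'I_n -> 'I_M} | (\sum_i e i * g i < K)%N]%SET|.
Proof.
move=> e0 KM.
have mM (m : 'X_{1..n < K}) i : (m i < M)%N.
  apply: leq_trans KM; apply: leq_ltn_trans (bmdeg m).
  by rewrite mdegE (bigD1 i) //= leq_addr.
pose phi (m : 'X_{1..n < K}) : {ffun 'I_n -> 'I_M} := [ffun i => Ordinal (mM m i)].
rewrite -(card_imset (f := phi)) => [|m1 m2 /ffunP h]; last first.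
  by apply/val_inj/mnmP => i; have := congr1 val (h i); rewrite !ffunE.
apply: eq_card => g; rewrite inE.
apply/imsetP/idP => [[m + ->]|gK].
  by rewrite inE /wdeg; congr (_ < _)%N; apply: eq_bigr => i _; rewrite ffunE.
pose m : 'X_{1..n} := [multinom g i : nat | i < n].
have wm : wdeg e m = (\sum_i e i * g i)%N by apply: eq_bigr => i _; rewrite mnmE.
have mK : (mdeg m < K)%N by apply: leq_ltn_trans (mdeg_wdeg _ e0) _; rewrite wm.
exists (BMultinom mK); first by rewrite inE /= wm.
by apply/ffunP => i; apply/val_inj; rewrite ffunE /= mnmE.
Qed.

(** The counts have generating series X / (1 - X) times the product of the 1 / (1 - X^e_i); the
    factor X reflects the strict inequality in [wmons]. Geometric series are cut at length [K]. *)
Lemma convol_wmons e K : (forall i, 0 < e i)%N ->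
  convol (\prod_i (1 - 'X^(e i))) (fun k => #|wmons e k|%:R) K = (0 < K)%:R :> R.
Proof.
move=> e0.
pose G : {poly R} := \sum_(g : {ffun 'I_n -> 'I_K}) 'X^(\sum_i e i * g i).
pose ones : {poly R} := \poly_(j < K.+1) (0 < j)%:R.
have GE : G = \prod_i \sum_(j < K) 'X^(e i * j).
  by rewrite bigA_distr_bigA; apply: eq_bigr => g _; rewrite -expr_sum.
have OG k : (k <= K)%N -> (ones * G)`_k = #|wmons e k|%:R.
  move=> kK; rewrite (card_wmons e0 kK) mulr_sumr coef_sum -sum1_card natr_sum.
  rewrite [RHS]big_mkcond; apply: eq_bigr => g _; rewrite coefMXn inE.
  rewrite coef_poly; case: ltnP => [kg|gk]; first by rewrite ltnNge ltnW.
  rewrite (leq_ltn_trans (leq_subr _ _)) ?ltnS // subn_gt0.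
  by case: ltnP.
rewrite (@convol_coef _ _ _ _ K) //; set P := \prod_i _.
transitivity ((P * (ones * G))`_K).
  rewrite !coefM; apply: eq_bigr => i _; rewrite coef_poly OG ?leq_subr //.
  by rewrite ltnS leq_subr.
(* Each factor telescopes up to a multiple of X^K. The error cannot reach the coefficient [K],
   because [ones] has no constant term. *)
have [Z PG] : exists Z, P * G = 1 - 'X^K * Z.
  rewrite GE /P -big_split /=; elim/big_ind: _ => [|p1 p2 [Z1 ->] [Z2 ->]|i _].
  - by exists 0; rewrite mulr0 subr0.
  - by exists (Z1 + Z2 - 'X^K * Z1 * Z2); ring.
  exists 'X^((e i).-1 * K); rewrite -exprD -mulSn prednK // mulnC exprM.
  transitivity (1 - ('X^(e i) : {poly R}) ^+ K); last by rewrite -exprM mulnC exprM.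
  rewrite -[RHS]opprB subrX1 -mulNr opprB; congr (_ * _).
  by apply: eq_bigr => j _; rewrite exprM.
rewrite mulrCA PG mulrBr mulr1 coefB mulrA [ones * _]mulrC -mulrA coefXnM ltnn subnn.
rewrite coefM big_ord1 subnn [ones`_0]coef_poly /= mul0r subr0.
by rewrite coef_poly ltnS leqnn.
Qed.

End WeightedMonomials.

(** * Independence of the basic invariants and the product formula *)

Section BasicInvariants.
Local Open Scope ring_scope.
Variables (R : numFieldType) (n : nat) (f : 'I_n -> {mpoly R[n]}) (e : 'I_n -> nat).
Variable Inv : {mpoly R[n]} -> Prop.
Local Notation dimU K := #|{: 'X_{1..n < K}}|.
Variable E : forall K, 'M[R]_(dimU K).
Variables (L : {poly R}) (N : nat).
Local Notation fpoly q := (q \mPo [tuple f i | i < n]).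

Hypothesis n_gt0 : (0 < n)%N.
Hypothesis f_homog : forall i, f i \is (e i).-homog.
Hypothesis Inv_gen : forall p, Inv p -> exists q, p = fpoly q.
Hypothesis Inv_fpoly : forall q, Inv (fpoly q).
Hypothesis EP : forall K (r : 'rV_(dimU K)), reflect (Inv (polym r)) (r <= E K)%MS.
Hypothesis convol_rank : forall K, convol L (fun k => (\rank (E k))%:R) K = (dimU K)%:R.
Hypothesis L_ge0 : forall i, 0 <= L`_i.
Hypothesis L_le : forall K, \sum_(i < K) L`_i <= N%:R.

(* [E K] has for row space the invariants of degree less than [K].  A generator of
   degree 0 is excluded only by [basic_degree_gt0]; until then, [e'] replaces [e]. *)
Let e' i := maxn (e i) 1.
Let e'_gt0 i : (0 < e' i)%N. Proof. by rewrite /e' leq_max orbT. Qed.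

Let F m := fpoly 'X_[m].

Let FE m : F m = \prod_i f i ^+ m i.
Proof. by rewrite /F comp_mpolyX; apply: eq_bigr => i _; rewrite tnth_mktuple. Qed.

Let fpolyE q : fpoly q = \sum_(m <- msupp q) q@_m *: F m.
Proof. exact: comp_mpolyEX. Qed.

Let F_homog m : F m \is (wdeg e m).-homog.
Proof.
rewrite FE /wdeg; elim/big_rec2: _ => [|i p d _ IH]; first exact: dhomog1.
by apply: dhomogM IH; apply: dhomogMn.
Qed.

Let F_msize m : (msize (F m) <= (wdeg e m).+1)%N.
Proof.
rewrite msizeE big_seq; apply/bigmax_leqP_seq => m' m'S _.
by rewrite (dhomog_mf (F_homog m)).
Qed.

Let wdeg_le m : (wdeg e m <= wdeg e' m)%N.
Proof. by apply: leq_sum => i _; rewrite leq_mul2r leq_maxl orbT. Qed.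

Definition gen_mx K : 'M[R]_(#|wmons e' K|, dimU K) :=
  \matrix_i vecm K (F (enum_val i : 'X_{1..n < K})).

Let wmon_ex K (m : 'X_{1..n}) : (wdeg e' m < K)%N ->
  exists i : 'I_#|wmons e' K|, (enum_val i : 'X_{1..n < K}) = m :> 'X_{1..n}.
Proof.
move=> mK; have mdK : (mdeg m < K)%N by apply: leq_ltn_trans (mdeg_wdeg _ e'_gt0) mK.
have mA : BMultinom mdK \in wmons e' K by rewrite inE.
by exists (enum_rank_in mA (BMultinom mdK)); rewrite enum_rankK_in.
Qed.

Let wmon_lt K (i : 'I_#|wmons e' K|) : (wdeg e' (enum_val i : 'X_{1..n < K}) < K)%N.
Proof. by have := enum_valP i; rewrite inE. Qed.

Let gen_mx_row K (m : 'X_{1..n}) : (wdeg e' m < K)%N -> (vecm K (F m) <= gen_mx K)%MS.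
Proof.
move=> /wmon_ex[i im]; have <- : row i (gen_mx K) = vecm K (F m) by rewrite rowK im.
exact: row_sub.
Qed.

(** The two row spaces coincide: an invariant of degree < K is a combination of products [F m], and
    [vecm] kills the homogeneous ones of degree at least [K]. *)
Lemma rank_gen_mx K : \rank (gen_mx K) = \rank (E K).
Proof.
apply/eqP; rewrite eqn_leq; apply/andP; split; apply/mxrankS/row_subP => i.
  rewrite rowK; apply/EP; rewrite vecmK; first exact: Inv_fpoly.
  apply: leq_trans (F_msize _) _; apply: leq_ltn_trans (wdeg_le _) _; exact: wmon_lt.
set r := row i _; have /EP /Inv_gen[q eq] : (r <= E K)%MS by apply: row_sub.
rewrite -[r]polymK eq fpolyE raddf_sum /=; apply: summx_sub => m _.
rewrite linearZ /=; apply: scalemx_sub.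
case: (ltnP (wdeg e m) K) => mK; last first.
  suff -> : vecm K (F m) = 0 by apply: sub0mx.
  apply/rowP => j; rewrite !mxE; apply/eqP; rewrite mcoeff_eq0.
  apply/negP => /(dhomog_mf (F_homog m)) /= h.
  by have := mdeg_bmon j; rewrite ltnNge -h in mK * => /negP[].
(* Generators of degree 0 are constants, so their exponents can be dropped. *)
pose m' : 'X_{1..n} := [multinom (if e i == 0%N then 0 else m i)%N | i < n].
have wm' : wdeg e' m' = wdeg e m.
  apply: eq_bigr => j _; rewrite /m' mnmE /e'; case: eqP => [->|/eqP ej].
    by rewrite muln0.
  by rewrite (maxn_idPl _) // lt0n.
have [c ->] : exists c, F m = c *: F m'.
  rewrite !FE; elim/big_ind2: _ => [|p1 p2 q1 q2 [c1 ->] [c2 ->]|j _].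
  - by exists 1; rewrite scale1r.
  - by exists (c1 * c2); rewrite -scalerAl -scalerAr scalerA.
  rewrite /m' mnmE; case: eqP => [ej|_]; last by exists 1; rewrite scale1r.
  have /msize1_polyC -> : (msize (f j) <= 1)%N.
    rewrite msizeE big_seq; apply/bigmax_leqP_seq => m2 m2S _.
    by rewrite (dhomog_mf (f_homog j)) ?ej.
  by exists ((f j)@_0 ^+ m j); rewrite expr0 -rmorphXn alg_mpolyC.
by rewrite linearZ /=; apply: scalemx_sub; apply: gen_mx_row; rewrite wm'.
Qed.

Let wmon K (j : 'I_#|wmons e' K|) : 'X_{1..n} := (enum_val j : 'X_{1..n < K}).
Let wpoly K (r : 'rV[R]_#|wmons e' K|) : {mpoly R[n]} := \sum_j r 0 j *: 'X_[wmon j].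

Let wmon_inj K : injective (@wmon K).
Proof. by move=> i j /val_inj /enum_val_inj. Qed.

Let wpoly_coef K (r : 'rV[R]_#|wmons e' K|) j : (wpoly r)@_(wmon j) = r 0 j.
Proof.
rewrite raddf_sum (bigD1 j) //= mcoeffZ mcoeffX eqxx mulr1 big1 ?addr0 // => i ij.
by rewrite mcoeffZ mcoeffX (inj_eq (@wmon_inj _)) (negbTE ij) mulr0.
Qed.

Let wpoly_supp K (r : 'rV[R]_#|wmons e' K|) m : m \in msupp (wpoly r) -> (wdeg e' m < K)%N.
Proof.
rewrite mcoeff_msupp; apply: contraR => mK; rewrite raddf_sum big1 // => j _ /=.
rewrite mcoeffZ mcoeffX; case: eqP => [jm|_]; last by rewrite mulr0.
by rewrite -jm wmon_lt in mK.
Qed.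

Let wpolyK K p : (forall m, m \in msupp p -> (wdeg e' m < K)%N) ->
  p = wpoly (\row_(j < #|wmons e' K|) p@_(wmon j)).
Proof.
move=> pK; apply/mpolyP => m; case: (ltnP (wdeg e' m) K) => mK.
  by have [j <-] := wmon_ex mK; rewrite wpoly_coef mxE.
rewrite !memN_msupp_eq0 //; apply/negP; last by move/pK; rewrite ltnNge mK.
by move/wpoly_supp; rewrite ltnNge mK.
Qed.

Let fpoly_wpoly K (r : 'rV[R]_#|wmons e' K|) :
  r *m gen_mx K = vecm K (fpoly (wpoly r)).
Proof.
rewrite mulmx_sum_row /wpoly (linear_sum (comp_mpoly [tuple f i | i < n])) /=.
rewrite (linear_sum (@vecm R n K)) /=.
by apply: eq_bigr => j _; rewrite rowK !linearZ.
Qed.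

Let fpoly_msize K (r : 'rV[R]_#|wmons e' K|) : (msize (fpoly (wpoly r)) <= K)%N.
Proof.
rewrite (linear_sum (comp_mpoly [tuple f i | i < n])); apply: leq_trans (msize_sum _ _ _) _; apply/bigmax_leqP => j _ /=.
rewrite linearZ; apply: leq_trans (msizeZ_le _ _) _; apply: leq_trans (F_msize _) _.
by apply: leq_ltn_trans (wdeg_le _) _; apply: wmon_lt.
Qed.

(** Every multiple of the relation [q] by a monomial of weighted degree < K - D is a relation among
    the rows of [gen_mx K], and these multiples are independent. *)
Lemma rank_relation (q : {mpoly R[n]}) D K : q != 0 -> fpoly q = 0 ->
  (forall m, m \in msupp q -> (wdeg e' m <= D)%N) ->
  (\rank (E K) + #|wmons e' (K - D)| <= #|wmons e' K|)%N.
Proof.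
move=> q0 fq qD; rewrite -rank_gen_mx.
have supp (i : 'I_#|wmons e' (K - D)|) m : m \in msupp (q * 'X_[wmon i]) -> (wdeg e' m < K)%N.
  rewrite (perm_mem (msuppMX _ _)) => /mapP[m1 /qD m1D ->].
  by rewrite wdegD; have := wmon_lt i; rewrite -/(wmon i); lia.
pose Z : 'M[R]_(#|wmons e' (K - D)|, #|wmons e' K|) :=
  \matrix_(i, j) (q * 'X_[wmon i])@_(wmon j).
have rowZ i : wpoly (row i Z) = q * 'X_[wmon i].
  by rewrite [RHS](wpolyK (@supp i)); congr wpoly; apply/rowP => j; rewrite !mxE.
have ZM : Z *m gen_mx K = 0.
  apply/row_matrixP => i; rewrite row0 row_mul fpoly_wpoly rowZ rmorphM /= fq mul0r.
  exact: linear0.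
have Zfree : row_free Z.
  rewrite -kermx_eq0; apply/eqP/row_matrixP => i; rewrite row0.
  have := mulmx_ker Z => /(congr1 (row i)); rewrite row0 row_mul.
  set r := row i _ => rZ; have : wpoly (r *m Z) = q * wpoly r.
    rewrite mulmx_sum_row {1}/wpoly; under eq_bigr => j _.
      rewrite summxE scaler_suml; under eq_bigr do rewrite mxE -scalerA.
      over.
    rewrite exchange_big /wpoly mulr_sumr; apply: eq_bigr => j _ /=.
    by rewrite -scaler_sumr -/(wpoly _) rowZ scalerAr.
  rewrite rZ {1}/wpoly big1 => [|j _]; last by rewrite mxE scale0r.
  move=> /esym/eqP; rewrite mulf_eq0 (negbTE q0) /= => /eqP r0.
  by apply/rowP => j; rewrite -wpoly_coef r0 mcoeff0 mxE.
by rewrite addnC -(eqP Zfree); apply: mulmx0_rank_max.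
Qed.

(** A monomial of weighted degree in [K - D, K) is determined by that degree, with [D] possible
    values, and by its exponents other than the one of [i0]. *)
Lemma card_wmons_diff D K :
  (#|wmons e' K| <= #|wmons e' (K - D)| + D * K ^ n.-1)%N.
Proof.
pose i0 := Ordinal n_gt0.
rewrite (card_wmons e'_gt0 (leqnn K)) (card_wmons e'_gt0 (leq_subr D K)).
set A := [set g | _]%SET; set B := [set g | _]%SET.
have BA : B \subset A.
  by apply/fintype.subsetP => g; rewrite !inE => h; apply: leq_trans h _; apply: leq_subr.
rewrite -(cardsID B A) (_ : A :&: B = B)%SET; last by apply/finset.setIidPr.
rewrite leq_add2l; case: D @B BA => [|D] B BA.
  rewrite leqn0 cards_eq0 finset.setD_eq0; apply/fintype.subsetP => g.
  by rewrite !inE subn0.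
pose psi (g : {ffun 'I_n -> 'I_K}) : 'I_D.+1 * {ffun {i : 'I_n | i != i0} -> 'I_K} :=
  (inord (\sum_i e' i * g i - (K - D.+1)), [ffun i => g (val i)]).
have aux s : (K - D.+1 <= s -> s < K -> s - (K - D.+1) < D.+1)%N by lia.
have aux2 s s' : (K - D.+1 <= s -> K - D.+1 <= s' ->
  s - (K - D.+1) = s' - (K - D.+1) -> s = s')%N by lia.
rewrite -(card_in_imset (f := psi)); last first.
  move=> g1 g2; rewrite !inE -!leqNgt => /andP[h1 h1'] /andP[h2 h2'] [].
  move=> /(congr1 val); rewrite /= !inordK ?aux // => /(aux2 _ _ h1 h2) hs /ffunP hg.
  have gE i : i != i0 -> g1 i = g2 i.
    by move=> ii; have := hg (exist _ i ii); rewrite !ffunE.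
  move: hs; rewrite (bigD1 i0) // [RHS](bigD1 i0) //=.
  rewrite (eq_bigr (fun i => e' i * g2 i)%N) => [/addIn /eqP|i /gE -> //].
  rewrite eqn_pmul2l // => /eqP /val_inj g0; apply/ffunP => i.
  by case: (eqVneq i i0) => [->|/gE].
apply: leq_trans (max_card _) _; rewrite card_prod card_ord card_ffun card_ord.
by rewrite card_sub (eq_card (B := predC1 i0)) // cardC1 card_ord.
Qed.

Lemma dim_lower B : (B ^ n <= dimU (n * B).+1)%N.
Proof.
rewrite -[X in (X ^ _)%N]card_ord -[X in (_ ^ X)%N]card_ord -card_ffun.
have h (g : {ffun 'I_n -> 'I_B}) : (mdeg [multinom g i : nat | i < n] < (n * B).+1)%N.
  rewrite mdegE ltnS -[X in (_ <= X * _)%N]card_ord -sum_nat_const.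
  by apply: leq_sum => i _; rewrite mnmE ltnW.
rewrite -(card_imset (f := fun g => BMultinom (h g))) ?max_card // => g1 g2.
move=> /(congr1 val) /= /mnmP hm; apply/ffunP => i; apply/val_inj.
by have := hm i; rewrite !mnmE.
Qed.

(* By [convol_rank] the rank of [E K] is of order [K ^ n], whereas a relation among the
   [f i] would bound it by [D * K ^ n.-1]. *)
Lemma fpoly_inj q : fpoly q = 0 -> q = 0.
Proof.
move=> fq; apply/eqP/negPn/negP => q0.
pose D := (\max_(m <- msupp q) wdeg e' m)%N.
have qD m : m \in msupp q -> (wdeg e' m <= D)%N.
  by move=> mq; rewrite /D (big_rem m) //= leq_maxl.
have leX a b j : (a <= b -> a ^ j <= b ^ j)%N by case: j => // j; rewrite leq_exp2r.
have rk K : (\rank (E K) <= D * K ^ n.-1)%N.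
  have := rank_relation K q0 fq qD; have := card_wmons_diff D K; lia.
have dim K : (dimU K <= N * (D * K ^ n.-1))%N.
  rewrite -(ler_nat R) -convol_rank natrM.
  apply: le_trans (_ : \sum_(i < K.+1) L`_i * (D * K ^ n.-1)%:R <= _); last first.
    by rewrite -mulr_suml ler_wpM2r // ler0n.
  apply: ler_sum => i _; rewrite ler_wpM2l // ler_nat.
  by apply: leq_trans (rk _) _; rewrite leq_mul2l leX ?leq_subr ?orbT.
(* With [K = n * B + 1 <= n.+1 * B], the upper bound becomes at most
   [N * D * n.+1 ^ n.-1 * B ^ n.-1], which this choice of [B] makes smaller than [B ^ n]. *)
pose B := (N * (D * n.+1 ^ n.-1)).+1.
have := leq_trans (dim_lower B) (dim _); apply/negP; rewrite -ltnNge.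
rewrite (_ : B ^ n = B * B ^ n.-1)%N; last by rewrite -expnS prednK.
apply: leq_trans (_ : (N * (D * (n.+1 * B) ^ n.-1) < _)%N).
  by rewrite ltnS !leq_mul2l leX ?orbT //; rewrite /B; nia.
by rewrite expnMn !mulnA ltn_pmul2r ?expn_gt0 // /B !mulnA.
Qed.

(** A generator of degree 0 is a constant c, and then 'X_i - c would be a nonzero relation. *)
Lemma basic_degree_gt0 i : (0 < e i)%N.
Proof.
rewrite lt0n; apply/eqP => ei.
have /msize1_polyC fi : (msize (f i) <= 1)%N.
  rewrite msizeE big_seq; apply/bigmax_leqP_seq => m mS _.
  by rewrite (dhomog_mf (f_homog i)) ?ei.
have /fpoly_inj /(congr1 (mcoeff U_(i))) : fpoly ('X_i - ((f i)@_0)%:MP) = 0.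
  by rewrite raddfB /= comp_mpolyXU comp_mpolyC -tnth_nth tnth_mktuple -fi subrr.
rewrite mcoeffB mcoeffXU eqxx mcoeffC mcoeff0 -mdeg_eq0 mdeg1 mulr0 subr0 => /eqP.
by rewrite oner_eq0.
Qed.

Lemma rank_invariants K : \rank (E K) = #|wmons e K|.
Proof.
have -> : wmons e K = wmons e' K.
  apply/setP => m; rewrite !inE; congr (_ < _)%N; apply: eq_bigr => i _.
  by rewrite /e' (maxn_idPl _) // basic_degree_gt0.
rewrite -rank_gen_mx; apply/eqP; change (row_free (gen_mx K)).
rewrite -kermx_eq0; apply/eqP/row_matrixP => i; rewrite row0.
have := mulmx_ker (gen_mx K) => /(congr1 (row i)); rewrite row0 row_mul fpoly_wpoly.
set r := row i _ => r0; have /fpoly_inj w0 : fpoly (wpoly r) = 0.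
  by rewrite -(vecmK (fpoly_msize r)) r0 linear0.
by apply/rowP => j; rewrite -wpoly_coef w0 mcoeff0 mxE.
Qed.

Lemma poincare_product : L = \prod_i \sum_(j < e i) 'X^j.
Proof.
pose o k : R := (0 < k)%:R.
pose P : {poly R} := \prod_(i < n) (1 - 'X); pose Q : {poly R} := \prod_i (1 - 'X^(e i)).
have QE : Q = P * \prod_i \sum_(j < e i) 'X^j.
  rewrite /P /Q -big_split; apply: eq_bigr => i _ /=.
  by rewrite -[LHS]opprB subrX1 -mulNr opprB.
have c1 k : convol P (fun k => (dimU k)%:R) k = o k.
  rewrite /o -(@convol_wmons R n (fun=> 1%N) k) //; apply: eq_convol => j.
  by rewrite wmons1 cardsT.
have c2 k : convol (P * L) (fun k => (\rank (E k))%:R) k = o k.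
  by rewrite convolM -c1; apply: eq_convol => j; rewrite convol_rank.
have c3 k : convol Q (fun k => (\rank (E k))%:R) k = o k.
  rewrite /o -(@convol_wmons R n e k) //; last exact: basic_degree_gt0.
  by apply: eq_convol => j; rewrite rank_invariants.
(* Convolving the rank series with [P * L] or with [Q] gives [o]. Applying both, in either order,
   eliminates the rank series; convolution with [o] takes partial sums of coefficients, which
   determine a polynomial. *)
have PQ k : convol (P * L) o k = convol Q o k.
  by rewrite -(eq_convol Q c2) convolC; apply: eq_convol.
have conv_o (p : {poly R}) k : convol p o k = \sum_(i < k) p`_i.
  rewrite /convol big_ord_recr /= subnn mulr0 addr0; apply: eq_bigr => i _.
  by rewrite /o subn_gt0 ltn_ord mulr1.
have eqPQ : P * L = Q.
  apply/polyP => k; have := PQ k.+1; rewrite !conv_o !big_ord_recr /= -!conv_o PQ.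
  exact: addrI.
have P0 : P != 0.
  apply/prodf_neq0 => i _; rewrite subr_eq0; apply/eqP => /(congr1 (coefp 0)) /=.
  by rewrite coef1 coefX /= => /eqP; rewrite oner_eq0.
by apply: (mulfI P0); rewrite eqPQ.
Qed.

End BasicInvariants.

(** * Finite reflection groups as root systems *)

Section Reflections.
Local Open Scope ring_scope.
Variables (R : realType) (n : nat).
Implicit Types (a b x : 'cV[R]_n) (g t : 'M[R]_n).

Definition dotv a b : R := (a^T *m b) 0 0.

Lemma dotvE a b : dotv a b = \sum_i a i 0 * b i 0.
Proof. by rewrite /dotv mxE; apply: eq_bigr => i _; rewrite mxE. Qed.

Lemma dotvC a b : dotv a b = dotv b a.
Proof. by rewrite !dotvE; apply: eq_bigr => i _; rewrite mulrC. Qed.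

Lemma dotvDr a b x : dotv a (b + x) = dotv a b + dotv a x.
Proof. by rewrite /dotv mulmxDr mxE. Qed.

Lemma dotvZr c a b : dotv a (c *: b) = c * dotv a b.
Proof. by rewrite /dotv -scalemxAr mxE. Qed.

Lemma dotvNr a b : dotv a (- b) = - dotv a b.
Proof. by rewrite /dotv mulmxN mxE. Qed.

Lemma dotvZl c a b : dotv (c *: a) b = c * dotv a b.
Proof. by rewrite dotvC dotvZr dotvC. Qed.

Lemma dotvv_ge0 a : 0 <= dotv a a.
Proof. by rewrite dotvE; apply: sumr_ge0 => i _; rewrite -expr2 sqr_ge0. Qed.

Lemma dotvv_eq0 a : (dotv a a == 0) = (a == 0).
Proof.
apply/eqP/eqP => [|->]; last by rewrite /dotv mulmx0 mxE.
rewrite dotvE => /psumr_eq0P h; apply/colP => i; rewrite mxE; apply/eqP.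
by rewrite -sqrf_eq0 expr2 h // => j _; rewrite -expr2 sqr_ge0.
Qed.

Lemma dotvv_gt0 a : a != 0 -> 0 < dotv a a.
Proof. by move=> a0; rewrite lt0r dotvv_eq0 a0 dotvv_ge0. Qed.

Lemma trmx_mul_dotv a b : a^T *m b = (dotv a b)%:M.
Proof. by apply/matrixP => i j; rewrite !ord1 /dotv [RHS]mxE eqxx mulr1n. Qed.

Lemma outer_mul a b x : a *m b^T *m x = dotv b x *: a.
Proof. by rewrite -mulmxA trmx_mul_dotv mul_mx_scalar. Qed.

Lemma refl_unit a : dotv a a = 1 -> refl a = 1%:M - 2 *: (a *m a^T).
Proof. by rewrite /refl /dotv => ->; rewrite divr1. Qed.

Lemma refl_unit_mul a b : dotv a a = 1 -> refl a *m b = b - (2 * dotv a b) *: a.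
Proof. by move=> a1; rewrite refl_unit // mulmxBl mul1mx -scalemxAl outer_mul scalerA. Qed.

Lemma refl_scale c a : c != 0 -> refl (c *: a) = refl a.
Proof.
move=> c0; rewrite /refl -!/(dotv _ _) dotvZl dotvZr [(c *: a)^T]linearZ /= -scalemxAl -scalemxAr.
rewrite !scalerA; congr (_ - _ *: _).
case: (eqVneq (dotv a a) 0) => [->|d0]; first by rewrite !mulr0 invr0 !mulr0 !mul0r.
by field; rewrite c0 d0.
Qed.

Lemma refl_tr a : (refl a)^T = refl a.
Proof. by rewrite /refl linearB linearZ /= trmx1 trmx_mul trmxK. Qed.

Lemma unit_scale a : a != 0 -> dotv ((Num.sqrt (dotv a a))^-1 *: a) ((Num.sqrt (dotv a a))^-1 *: a) = 1.
Proof.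
move=> a0; have d0 := dotvv_gt0 a0; rewrite dotvZl dotvZr mulrA -invfM -expr2.
by rewrite sqr_sqrtr ?ltW // mulVf // gt_eqF.
Qed.

Lemma refl_sqr a : a != 0 -> refl a *m refl a = 1%:M.
Proof.
move=> a0; have s0 : (Num.sqrt (dotv a a))^-1 != 0 :> R.
  by rewrite invr_eq0 sqrtr_eq0 -ltNge dotvv_gt0.
rewrite -(refl_scale a s0); set u := _ *: a; have : dotv u u = 1 := unit_scale a0.
move: u => u u1; have QQ : (u *m u^T) *m (u *m u^T) = u *m u^T by rewrite mulmxA outer_mul u1 scale1r.
rewrite refl_unit // mulmxBr mulmx1 mulmxBl mul1mx -scalemxAl -scalemxAr QQ.
by apply/matrixP => i j; rewrite !mxE; ring.
Qed.

Lemma refl_conj g a : g^T *m g = 1%:M -> g *m refl a *m g^T = refl (g *m a).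
Proof.
move=> gg; have gg' : g *m g^T = 1%:M by apply: mulmx1C.
rewrite /refl trmx_mul mulmxBr mulmx1 mulmxBl gg' -scalemxAr -scalemxAl !mulmxA.
by rewrite -(mulmxA a^T) gg mulmx1.
Qed.

Lemma dotv_unit_eq a b : dotv a a = 1 -> dotv b b = 1 -> 1 <= dotv a b -> a = b.
Proof.
move=> a1 b1 ab; apply/eqP; rewrite -subr_eq0 -dotvv_eq0; apply/eqP/le_anti.
rewrite dotvv_ge0 andbT dotvDr dotvNr ![dotv (a - b) _]dotvC !dotvDr !dotvNr a1 b1.
by rewrite (dotvC b a); lra.
Qed.

Lemma refl_unit_inj a b : dotv a a = 1 -> dotv b b = 1 -> refl a = refl b ->
  a = b \/ a = - b.
Proof.
move=> a1 b1 e; have := refl_unit_mul b a1; rewrite e refl_unit_mul // b1 mulr1.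
move=> /(congr1 (fun x => b - x)); rewrite !subKr => h.
have ab2 : dotv a b ^+ 2 = 1.
  have := congr1 (dotv b) h; rewrite !dotvZr b1 (dotvC b a).
  by move=> h2; nra.
have /orP[/eqP ab|/eqP ab] : (dotv a b == 1) || (dotv a b == - 1).
  by rewrite -eqf_sqr ab2 expr1n.
  by left; apply: dotv_unit_eq => //; rewrite ab.
right; apply: dotv_unit_eq => //; last by rewrite dotvNr ab opprK.
by rewrite dotvNr dotvC dotvNr opprK.
Qed.

End Reflections.

(** * The matrix group as an abstract finite group with its positive roots *)

Section MatrixGroup.
Local Open Scope ring_scope.
Variables (R : realType) (n : nat) (W : seq 'M[R]_n).

Record orthogonal_group : Prop := OrthogonalGroup {
  og1 : 1%:M \in W;
  ogM : forall g h, g \in W -> h \in W -> g *m h \in W;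
  ogT : forall g, g \in W -> g^T \in W;
  ogK : forall g, g \in W -> g^T *m g = 1%:M }.

(** The proof [H] is a phantom parameter of the type, so that the group structure, whose operations
    depend on it, can be declared as an instance. *)
Definition mgroup (H : orthogonal_group) : Type := seq_sub W.

Variable H : orthogonal_group.
Local Notation gT := (mgroup H).

HB.instance Definition _ := Finite.on gT.

Definition mg_mul (x y : gT) : gT := SeqSub (ogM H (ssvalP x) (ssvalP y)).
Definition mg_one : gT := SeqSub (og1 H).
Definition mg_inv (x : gT) : gT := SeqSub (ogT H (ssvalP x)).

Lemma mg_mulA : associative mg_mul.
Proof. by move=> x y z; apply/val_inj; rewrite /= mulmxA. Qed.
Lemma mg_mul1 : left_id mg_one mg_mul.
Proof. by move=> x; apply/val_inj; rewrite /= mul1mx. Qed.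
Lemma mg_mulV : left_inverse mg_one mg_inv mg_mul.
Proof. by move=> x; apply/val_inj; rewrite /= (ogK H) // ssvalP. Qed.

HB.instance Definition _ := Finite_isGroup.Build gT mg_mulA mg_mul1 mg_mulV.

Definition mgval (x : gT) : 'M[R]_n := ssval x.

Lemma mgvalM (x y : gT) : mgval (x * y)%g = mgval x *m mgval y.
Proof. by []. Qed.
Lemma mgval1 : mgval 1%g = 1%:M.
Proof. by []. Qed.
Lemma mgvalV (x : gT) : mgval x^-1%g = (mgval x)^T.
Proof. by []. Qed.
Lemma mgval_in (x : gT) : mgval x \in W.
Proof. exact: ssvalP. Qed.
Lemma mgvalK (x : gT) : (mgval x)^T *m mgval x = 1%:M.
Proof. by rewrite (ogK H) // mgval_in. Qed.
Lemma mgval_inj : injective mgval.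
Proof. exact: val_inj. Qed.

Lemma mgval_conj (t x : gT) : mgval (t ^ x^-1)%g = mgval x *m mgval t *m (mgval x)^T.
Proof. by rewrite conjgE invgK !mgvalM mgvalV ?mulmxA. Qed.

Variable v : 'cV[R]_n.
Hypothesis gen : generic_for W v.

Definition mrefls : {set gT} := [set t : gT | `[< is_reflection (mgval t) >]]%SET.

Definition mroot (t : gT) : 'cV[R]_n :=
  xget 0 [set a | [/\ dotv a a = 1, mgval t = refl a & 0 < dotv v a]]%classic.

Lemma mreflsP t : reflect (is_reflection (mgval t)) (t \in mrefls).
Proof. by rewrite inE; apply: asboolP. Qed.

Lemma dotv_generic a t : a != 0 -> mgval t = refl a -> dotv v a != 0.
Proof. by move=> a0 ta; apply: gen; rewrite -?ta ?mgval_in. Qed.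

Lemma unit_neq0 (a : 'cV[R]_n) : dotv a a = 1 -> a != 0.
Proof. by move=> a1; rewrite -dotvv_eq0 a1 oner_neq0. Qed.

Lemma mrootP t : t \in mrefls ->
  [/\ dotv (mroot t) (mroot t) = 1, mgval t = refl (mroot t) & 0 < dotv v (mroot t)].
Proof.
move=> /mreflsP[a [a0 ta]].
suff [b hb] : exists b, [/\ dotv b b = 1, mgval t = refl b & 0 < dotv v b].
  by rewrite /mroot; case: xgetP => [y _ hy|h]; [exact: hy|case: (h b)].
set c := (Num.sqrt (dotv a a))^-1; have c0 : 0 < c by rewrite invr_gt0 sqrtr_gt0 dotvv_gt0.
have ca1 : dotv (c *: a) (c *: a) = 1 := unit_scale a0.
have va := dotv_generic a0 ta.
case: (ltrP 0 (dotv v a)) => va0.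
  exists (c *: a); split=> //; first by rewrite refl_scale // gt_eqF.
  by rewrite dotvZr mulr_gt0.
exists (- c *: a); split.
- by rewrite scaleNr dotvNr dotvC dotvNr opprK.
- by rewrite refl_scale // oppr_eq0 gt_eqF.
- by rewrite dotvZr nmulr_rgt0 ?oppr_lt0 // lt_neqAle va.
Qed.

Lemma mroot_uniq t a : t \in mrefls -> dotv a a = 1 -> mgval t = refl a -> 0 < dotv v a ->
  mroot t = a.
Proof.
move=> tT a1 ta va; have [r1 tr vr] := mrootP tT.
have [//|e] := refl_unit_inj r1 a1 (etrans (esym tr) ta).
by move: vr; rewrite e dotvNr oppr_gt0 ltNge ltW.
Qed.

Definition minv (w t : gT) : bool := dotv v (mgval w *m mroot t) < 0.

Lemma mgval_dot w (a b : 'cV[R]_n) : dotv (mgval w *m a) (mgval w *m b) = dotv a b.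
Proof. by rewrite /dotv trmx_mul -mulmxA [X in _ *m X]mulmxA mgvalK mul1mx. Qed.

Lemma mrefls_conj t x : t \in mrefls -> (t ^ x)%g \in mrefls.
Proof.
move=> tT; have [r1 tr _] := mrootP tT; apply/mreflsP.
exists (mgval x^-1%g *m mroot t); split.
  by apply: unit_neq0; rewrite mgval_dot.
by rewrite -(invgK x) mgval_conj tr invgK refl_conj // mgvalK.
Qed.

Lemma minv_act w t : t \in mrefls ->
  mgval w *m mroot t = (-1) ^+ minv w t *: mroot (t ^ w^-1)%g.
Proof.
move=> tT; have [r1 tr vr] := mrootP tT; have tT' := mrefls_conj w^-1%g tT.
set a := mgval w *m mroot t; have a1 : dotv a a = 1 by rewrite mgval_dot.
have ta : mgval (t ^ w^-1)%g = refl a by rewrite mgval_conj tr refl_conj // mgvalK.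
have va := dotv_generic (unit_neq0 a1) ta.
rewrite /minv -/a; case: ltP => va0.
  rewrite (mroot_uniq (a := - a)) ?expr1 ?scaleN1r ?opprK //.
  - by rewrite dotvNr dotvC dotvNr opprK.
  - by rewrite -scaleN1r refl_scale // oppr_eq0 oner_eq0.
  - by rewrite dotvNr oppr_gt0.
by rewrite expr0 scale1r (mroot_uniq (a := a)) // lt_neqAle eq_sym va.
Qed.

Lemma mrefls_inj t u : t \in mrefls -> u \in mrefls -> mroot t = mroot u -> t = u.
Proof.
move=> tT uT e; have [_ tr _] := mrootP tT; have [_ ur _] := mrootP uT.
by apply: mgval_inj; rewrite tr ur e.
Qed.

Lemma mrefl_mul t b : t \in mrefls ->
  mgval t *m b = b - (2 * dotv (mroot t) b) *: mroot t.
Proof. by move=> /mrootP[r1 -> _]; rewrite refl_unit_mul. Qed.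

Lemma mroot_lt1 t u : t \in mrefls -> u \in mrefls -> t != u ->
  dotv (mroot t) (mroot u) < 1.
Proof.
move=> tT uT; rewrite ltNge; apply: contra => h; apply/eqP/mrefls_inj => //.
by have [t1 _ _] := mrootP tT; have [u1 _ _] := mrootP uT; apply: dotv_unit_eq.
Qed.

(* Among the positive roots of [G] minimising the ratio of [x |-> sigma <v, w x>] to
   [x |-> <v, x>], the one with least [<v, x>] is simple: otherwise it is a positive
   combination of two other positive roots, which are then minimisers as well. *)
Lemma minv_min (G : {group gT}) b w :
  (forall s, s \in simples mrefls minv G -> minv w s = b) ->
  forall t, t \in mrefls :&: G -> minv w t = b.
Proof.
move=> hS t0 t0T; apply/eqP/negPn/negP => nb.
pose phi (x : 'cV[R]_n) : R := (-1) ^+ b * dotv v (mgval w *m x).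
have phiD x y : phi (x + y) = phi x + phi y by rewrite /phi mulmxDr dotvDr mulrDr.
have phiZ c x : phi (c *: x) = c * phi x by rewrite /phi -scalemxAr dotvZr mulrCA.
have phi_lt0 t : t \in mrefls -> (phi (mroot t) < 0) = (minv w t != b).
  move=> tT; rewrite /phi; have := minv_act w tT.
  have [_ _ vr] := mrootP (mrefls_conj w^-1%g tT).
  move=> ->; rewrite dotvZr mulrA -exprD.
  by case: (minv w t); case: (b); rewrite ?expr0 ?expr1 ?mulN1r ?mul1r ?sqrrN ?expr1n ?mul1r
    ?oppr_lt0 ?vr // ltNge ltW.
pose psi t := phi (mroot t) / dotv v (mroot t).
have [t1 t1T t1min] := @arg_minP _ _ _ t0 (mem (mrefls :&: G)) psi t0T.
have t1M : (t1 \in mrefls :&: G) && (psi t1 == psi t1) by rewrite eqxx andbT; exact: t1T.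
have [t] := @arg_minP _ _ _ t1 (fun t => (t \in mrefls :&: G) && (psi t == psi t1))
  (fun t => dotv v (mroot t)) t1M.
move=> /andP[/setIP[tT tG] /eqP tm] tmin.
have [r1 _ vr] := mrootP tT.
have psi_lt : psi t < 0.
  have /setIP[t0T' _] := t0T; have [_ _ v0] := mrootP t0T'.
  rewrite tm; apply: le_lt_trans (t1min _ t0T) _.
  by rewrite /psi pmulr_llt0 ?invr_gt0 // phi_lt0.
have phiE u : u \in mrefls -> phi (mroot u) = psi u * dotv v (mroot u).
  by move=> uT; have [_ _ vu] := mrootP uT; rewrite /psi divfK // gt_eqF.
suff tS : t \in simples mrefls minv G.
  have := phi_lt0 t tT; rewrite (hS _ tS) eqxx phiE // => /negbT/negP; apply.
  by rewrite pmulr_llt0.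
apply/simplesP; split=> // u uT uG ut; apply/negP => tu.
have tuT := mrefls_conj t^-1%g uT.
have [_ _ vu] := mrootP uT; have [_ _ vc] := mrootP tuT.
have := minv_act t uT; rewrite tu expr1 scaleN1r mrefl_mul //.
set k := dotv _ _; set c := mroot (u ^ _)%g in vc *; set a := mroot t in r1 vr k tm tmin *.
set d := mroot u in vu k *.
have k1 : k < 1 by apply: mroot_lt1 => //; rewrite eq_sym.
(* If [t] inverts the root [d] of [u], then [d - 2 k a = - c] with [c] positive: a multiple of [a]
   is the sum of two positive roots. *)
move=> /(congr1 (fun x => x + (2 * k) *: a + c)); rewrite subrK [RHS]addrAC addNr add0r => bc.
have vE : dotv v d + dotv v c = 2 * k * dotv v a by rewrite -dotvDr bc dotvZr.
have pE : phi d + phi c = 2 * k * phi a by rewrite -phiD bc phiZ.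
have dM : psi t <= psi u by rewrite tm; apply: t1min; apply/finset.setIP.
have cM : psi t <= psi (u ^ t^-1)%g.
  by rewrite tm; apply: t1min; apply/finset.setIP; rewrite groupJ // groupV.
rewrite !phiE // -/a -/c -/d in pE.
have e0 : (psi u - psi t) * dotv v d + (psi (u ^ t^-1)%g - psi t) * dotv v c = 0.
  by rewrite !mulrBl addrACA pE -opprD -mulrDr vE; ring.
have eu : psi u = psi t.
  apply/eqP; rewrite -subr_eq0; apply/eqP.
  have : (psi u - psi t) * dotv v d = 0.
    apply/le_anti/andP; split; last by rewrite mulr_ge0 ?subr_ge0 // ltW.
    rewrite -[X in _ <= X]e0 lerDl mulr_ge0 ?subr_ge0 // ltW //.
  by move/eqP; rewrite mulf_eq0 (gt_eqF vu) orbF => /eqP.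
have ec : psi (u ^ t^-1)%g = psi t.
  apply/eqP; move: e0; rewrite eu subrr mul0r add0r => /eqP.
  by rewrite mulf_eq0 (gt_eqF vc) orbF subr_eq0.
(* Both roots are minimisers, so [<v, d> + <v, c> >= 2 <v, a>], whereas the sum is [2 k <v, a>] with
   [k < 1]. *)
have := tmin u; have := tmin (u ^ t^-1)%g; rewrite !finset.in_setI uT uG tuT groupJ ?groupV //= eu ec tm eqxx.
move=> /(_ isT) h1 /(_ isT) h2; rewrite -/a -/c -/d in h1 h2.
have : 2 * k * dotv v a < 2 * dotv v a by rewrite ltr_pM2r // gtr_pMr.
by rewrite -vE; lra.
Qed.

Lemma mgroup_root_system : root_system mgval mrefls minv mroot.
Proof.
split; last first.
- move=> t u tT uT tu; rewrite /coproj mulmxBl mul1mx outer_mul subr_eq0; apply/eqP => e.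
  have [t1 tr vt] := mrootP tT; have [u1 ur vu] := mrootP uT.
  set k := dotv _ _ in e; have k2 : k ^+ 2 = 1.
    by move: u1; rewrite e dotvZl dotvZr t1 mulr1 expr2.
  have k0 : 0 < k by move: vu; rewrite e dotvZr pmulr_lgt0.
  have k1 : k = 1 by nra.
  by move: tu; rewrite (mrefls_inj tT uT) ?eqxx // e k1 scale1r.
- by move=> w t tT; apply: minv_act.
- by move=> t /mrootP[r1 -> _]; apply: refl_unit.
- by move=> t /mrootP[r1 _ _]; rewrite trmx_mul_dotv r1.
- by move=> x; rewrite mgvalV.
- exact: mgvalM.
- exact: mgval1.
split.
- exact: mrefls_conj.
- move=> t /mreflsP[a [a0 ta]]; apply: mgval_inj.
  by rewrite mgvalM ta refl_sqr.
- move=> u x t tT; have tT' := mrefls_conj x^-1%g tT; have [_ _ vr] := mrootP (mrefls_conj u^-1%g tT').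
  rewrite {1}/minv mgvalM -mulmxA minv_act // -scalemxAr minv_act // scalerA -signr_addb dotvZr.
  by case: (_ (+) _); rewrite ?expr1 ?expr0 ?mulN1r ?mul1r ?oppr_lt0 // ltNge ltW.
- move=> t tT; have [r1 _ vr] := mrootP tT; rewrite /minv mrefl_mul // r1 mulr1.
  by rewrite dotvDr dotvNr dotvZr; lra.
- move=> t s tT sT tsE; apply: contra => ts; apply/eqP/mrefls_inj => //.
  have := minv_act t sT; rewrite ts expr1 scaleN1r mrefl_mul //.
  have -> : (s ^ t^-1)%g = s by rewrite conjgE invgK ?mulgA tsE mulgK.
  have [t1 _ vt] := mrootP tT; have [s1 _ vs] := mrootP sT.
  move=> /(congr1 (fun x => x + (2 * dotv (mroot t) (mroot s)) *: mroot t + mroot s)).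
  rewrite subrK [RHS]addrAC addNr add0r; set k := dotv _ _ => e.
  have sE : mroot s = k *: mroot t.
    apply: (scalerI (_ : 2 != 0 :> R)); first by rewrite pnatr_eq0.
    by rewrite scalerA -e scaler_nat mulr2n.
  have k0 : 0 < k by move: vs; rewrite sE dotvZr pmulr_lgt0.
  have k2 : k ^+ 2 = 1 by move: s1; rewrite sE dotvZl dotvZr t1 mulr1 expr2.
  have k1 : k = 1 by nra.
  by rewrite sE k1 scale1r.
- exact: minv_min.
Qed.

Lemma mgroup_enum : uniq W -> perm_eq [seq mgval x | x <- index_enum gT] W.
Proof.
move=> uW; apply: uniq_perm => // [|g].
  by rewrite (map_inj_uniq mgval_inj) index_enum_uniq.
apply/mapP/idP => [[x _ ->]|gW]; first exact: mgval_in.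
by exists (SeqSub gW) => //; apply: mem_index_enum.
Qed.

Lemma mgroup_sum (V : nmodType) (F : 'M[R]_n -> V) : uniq W ->
  \sum_(g <- W) F g = \sum_(x in [set: gT]%SET) F (mgval x).
Proof.
move=> /mgroup_enum e; rewrite -(perm_big _ e) big_map.
by apply: eq_bigl => x; rewrite finset.in_setT.
Qed.

Lemma ninv_len (w : gT) : uniq W -> ninv W v (mgval w) = len mrefls minv [set: gT]%SET w.
Proof.
move=> /mgroup_enum /seq.permP e; rewrite /ninv /len -e count_map -sum1_count -sum1_card.
apply: eq_bigl => t; rewrite finset.in_set finset.in_setI finset.in_setT andbT /=.
apply/asboolP/andP => [[a [a0 ta va wa]]|[tT wt]].
  have tT : t \in mrefls by apply/mreflsP; exists a.
  split=> //; rewrite /minv; set c := (Num.sqrt (dotv a a))^-1.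
  have c0 : 0 < c by rewrite invr_gt0 sqrtr_gt0 dotvv_gt0.
  rewrite (mroot_uniq (a := c *: a)) ?unit_scale //.
  - by rewrite -scalemxAr dotvZr pmulr_rlt0.
  - by rewrite refl_scale // gt_eqF.
  - by rewrite dotvZr mulr_gt0.
have [r1 tr vr] := mrootP tT; exists (mroot t); split=> //; exact: unit_neq0.
Qed.

Hypothesis refl_gen : forall g, g \in W -> exists s : seq 'M[R]_n,
  (forall t, t \in s -> t \in W /\ is_reflection t) /\ g = foldr (@mulmx R n n n) 1%:M s.

Lemma mgroup_reflgroup : reflgroup mrefls [set: gT]%SET.
Proof.
apply/fintype.subsetP => x _; have [s [sr xs]] := refl_gen (mgval_in x).
elim: s x sr xs => [|t s IHs] x sr xs.
  by rewrite (_ : x = 1%g) ?group1 //; apply: mgval_inj.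
have [tW tr] := sr t (mem_head _ _).
pose t' : gT := SeqSub tW; have e : x = (t' * (t'^-1 * x))%g by rewrite mulKVg.
rewrite e groupM //; first by rewrite mem_gen // finset.in_setI finset.in_setT andbT; apply/mreflsP.
apply: IHs => [u us|]; first by apply: sr; rewrite inE us orbT.
have tt : (mgval t')^T *m t = 1%:M := mgvalK t'.
by rewrite mgvalM mgvalV xs [foldr _ _ _]/= mulmxA tt mul1mx.
Qed.

End MatrixGroup.

Section CoxeterGroup.
Local Open Scope ring_scope.
Variables (R : realType) (n : nat) (W : seq 'M[R]_n).
Hypothesis cox : finite_coxeter_group_rank W.

(** Reflections are symmetric involutions, so the transpose of a word of reflections is the reversed
    word, which lies in [W] and is the inverse. *)
Lemma coxeter_orthogonal : orthogonal_group W.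
Proof.
have [uW W1 WM Wr _] := cox.
have key g : g \in W -> [/\ g \in W, g^T \in W & g^T *m g = 1%:M].
  move=> /Wr[s [sr ->]]; elim: s sr => [_|t s IHs sr] /=; first by rewrite trmx1 mul1mx.
  have [gW gtW gg] := IHs (fun u us => sr u (mem_behead (s := t :: s) us)).
  have [tW [a [a0 ta]]] := sr t (mem_head _ _).
  have tt : t^T = t by rewrite ta refl_tr.
  split; first exact: WM.
    by rewrite trmx_mul tt WM.
  by rewrite trmx_mul tt -mulmxA (mulmxA t) ta refl_sqr // mul1mx.
by split=> // g gW; have [] := key g gW.
Qed.

End CoxeterGroup.

(** * Polynomials determined by their values *)

Section PolynomialFunctions.
Local Open Scope ring_scope.
Variables (R : numFieldType).

Lemma poly_fun_eq0 (p : {poly R}) : (forall x, p.[x] = 0) -> p = 0.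
Proof.
move=> h; apply/eqP/negPn/negP => p0.
have := @max_poly_roots _ p [seq i%:R | i <- iota 0 (size p)] p0.
rewrite size_map size_iota ltnn => H; suff : false by [].
apply: H; first by apply/allP => x _; apply/eqP.
by rewrite map_inj_uniq ?iota_uniq // => i j /eqP; rewrite eqr_nat => /eqP.
Qed.

Lemma digits_inj K n (a b : nat -> nat) :
  (forall i, a i < K)%N -> (forall i, b i < K)%N ->
  (\sum_(i < n) a i * K ^ i = \sum_(i < n) b i * K ^ i)%N -> forall i, (i < n)%N -> a i = b i.
Proof.
move=> aK bK; have K0 : (0 < K)%N by apply: leq_ltn_trans (aK 0%N).
elim: n => [|n IHn] in a b aK bK * => //.
rewrite !big_ord_recl !muln1.
have shift (c : nat -> nat) : (\sum_(i < n) c (bump 0 i) * K ^ (bump 0 i) =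
    (\sum_(i < n) c i.+1 * K ^ i) * K)%N.
  by rewrite big_distrl; apply: eq_bigr => i _; rewrite /bump /= add1n expnSr mulnA.
rewrite !shift => e; have e0 : a 0%N = b 0%N.
  by have := congr1 (modn^~ K) e; rewrite ![(_ + _ * K)%N]addnC !modnMDl !modn_small.
move: e; rewrite e0 => /addnI /eqP; rewrite eqn_pmul2r // => /eqP e [|i] // iN.
by apply: (IHn (fun i => a i.+1) (fun i => b i.+1)).
Qed.

(* Kronecker substitution ['X_i := t ^ (K ^ i)] separates the monomials of [p]. *)
Lemma mpoly_fun_eq0 n (p : {mpoly R[n]}) :
  (forall x : 'cV[R]_n, p.@[fun i => x i 0] = 0) -> p = 0.
Proof.
move=> h; set K := msize p; pose phi (m : 'X_{1..n}) : nat := (\sum_(i < n) m i * K ^ i)%N.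
pose P : {poly R} := \sum_(m <- msupp p) p@_m *: 'X^(phi m).
have P0 : P = 0.
  apply: poly_fun_eq0 => t; rewrite -(h (\col_i t ^+ (K ^ i))) /P horner_sum.
  rewrite [in RHS](mpolyE p) raddf_sum /=; apply: eq_bigr => m _.
  rewrite hornerZ mevalZ hornerXn mevalX; congr (_ * _).
  rewrite /phi -prodrXr; apply: eq_bigr => i _.
  by rewrite mxE -exprM mulnC.
apply/mpolyP => m; rewrite mcoeff0; apply/eqP; rewrite mcoeff_eq0; apply/negP => mp.
have mK (m' : 'X_{1..n}) i : m' \in msupp p -> (m' i < K)%N.
  move=> /msize_mdeg_lt; apply: leq_ltn_trans.
  by rewrite mdegE (bigD1 i) //= leq_addr.
have := congr1 (coefp (phi m)) P0; rewrite /= coef0 coef_sum (bigD1_seq m) //=.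
rewrite coefZ coefXn eqxx mulr1 big_seq_cond big1 ?addr0 => [/eqP|m' /andP[m'p mm']].
  by rewrite mcoeff_eq0 mp.
rewrite coefZ coefXn; case: eqP => [e|_]; last by rewrite mulr0.
case/eqP: mm'; apply/mnmP => i; apply/esym.
pose ext (c : 'X_{1..n}) (j : nat) : nat := oapp (fun k : 'I_n => c k) 0%N (insub j).
have extE c (k : 'I_n) : ext c k = c k by rewrite /ext valK.
have K0 : (0 < K)%N by apply: leq_ltn_trans (mK m i mp).
have extK c j : c \in msupp p -> (ext c j < K)%N.
  by move=> cp; rewrite /ext; case: insubP => //= k _ _; apply: mK.
have := @digits_inj K n (ext m) (ext m') (fun j => extK _ _ mp) (fun j => extK _ _ m'p) _ i (ltn_ord i).
rewrite !extE; apply; rewrite /phi in e.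
by under eq_bigr do rewrite extE; under [RHS]eq_bigr do rewrite extE.
Qed.

Lemma linsub_invariant n (p : {mpoly R[n]}) (g : 'M[R]_n) :
  (forall x : 'cV[R]_n, p.@[fun i => (g *m x) i 0] = p.@[fun i => x i 0]) <->
  linsub g p = p.
Proof.
split=> [h|e x]; last by rewrite -meval_linsub e.
by apply/eqP; rewrite -subr_eq0; apply/eqP/mpoly_fun_eq0 => x; rewrite mevalB meval_linsub h subrr.
Qed.

End PolynomialFunctions.

Section CoxeterPoincare.
Local Open Scope ring_scope.
Variables (R : realType) (n : nat) (W : seq 'M[R]_n) (v : 'cV[R]_n) (d : nat).
Hypothesis n_gt0 : (0 < n)%N.
Hypothesis cox : finite_coxeter_group_rank W.
Hypothesis gen : generic_for W v.
Hypothesis deg : max_degree W d.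

Theorem coxeter_poincare : exists e : 'I_n -> nat,
  [/\ forall i, (0 < e i)%N, d = (\max_(i < n) e i)%N &
  \sum_(w <- W) 'X^(ninv W v w) = \prod_i \sum_(j < e i) 'X^j :> {poly R}].
Proof.
have [f [e [fh finv fgen dE]]] := deg; have [uW W1 WM Wr _] := cox.
pose H := coxeter_orthogonal cox; pose gT := mgroup H.
pose T := mrefls H; pose iv := minv v (H := H).
have rs := mgroup_root_system H gen; have rG := mgroup_reflgroup H Wr.
pose one (w : gT) : R := 1; pose G : {group gT} := [set: gT]%G.
pose E K := isoproj (@mgval R n W H) G one K.
have oM x y : x \in G -> y \in G -> one (x * y)%g = one x * one y by rewrite mulr1.
have o2 x : x \in G -> one x * one x = 1 by rewrite mulr1.
have invP p : invariant_poly W p <-> forall w : gT, linsub (mgval w) p = p.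
  split=> [h w|h g gW]; first by apply/linsub_invariant => x; apply: h; apply: mgval_in.
  by move=> x; apply: (linsub_invariant p g).2; apply: (h (SeqSub gW)).
pose L := lenpoly T iv R G.
have LE : L = \sum_(w <- W) 'X^(ninv W v w).
  by rewrite (mgroup_sum H) //; apply: eq_bigr => x _; rewrite (ninv_len gen).
exists e; have fhom i : f i \is (e i).-homog by have [] := fh i.
have key : (forall i, 0 < e i)%N /\ L = \prod_i \sum_(j < e i) 'X^j.
  have EP K (r : 'rV[R]_(#|{: 'X_{1..n < K}}|)) :
      reflect (invariant_poly W (polym r)) (r <= E K)%MS.
    apply: (iffP (isoprojP (@mgvalM R n W H) oM o2 r)) => [h|/invP h w _].
      by apply/invP => w; rewrite h ?scale1r // finset.in_setT.
    by rewrite h scale1r.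
  have finv' q : invariant_poly W (q \mPo [tuple f i | i < n]).
    move=> g gW x; rewrite !comp_mpoly_meval; apply: meval_eq => i.
    by rewrite tnth_mktuple finv.
  have conv K : convol L (fun k => (\rank (E k))%:R) K = (#|{: 'X_{1..n < K}}|)%:R.
    rewrite -(invariant_series rs K rG); apply: eq_convol => k.
    rewrite (rank_isoproj (@mgvalM R n W H) oM o2); congr (_ / _).
    by apply: eq_bigr => w _; rewrite mul1r.
  have L0 i : 0 <= L`_i.
    by rewrite coef_sum; apply: sumr_ge0 => w _; rewrite coefXn ler0n.
  have L1 K : \sum_(i < K) L`_i <= #|G|%:R.
    under eq_bigr do rewrite coef_sum.
    rewrite exchange_big -sum1_card natr_sum; apply: ler_sum => w _.
    under eq_bigr do rewrite coefXn.
    case: (ltnP (len T iv G w) K) => lK; last first.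
      by rewrite big1 // => i _; rewrite (ltn_eqF (leq_trans (ltn_ord i) lK)).
    rewrite (bigD1 (Ordinal lK)) //= eqxx big1 ?addr0 // => i.
    by rewrite -val_eqE /= => /negbTE ->.
  split; first exact: (basic_degree_gt0 n_gt0 fhom fgen finv' EP conv L0 L1).
  exact: (poincare_product n_gt0 fhom fgen finv' EP conv L0 L1).
by have [e0 LP] := key; split=> //; rewrite -LE.
Qed.

(** In positive rank a trivial group would fix a nonzero vector. This is the source of the
    positivity of the variance. *)
Lemma coxeter_nontrivial : (1 < size W)%N.
Proof.
have [uW W1 _ _ ess] := cox; rewrite ltnNge; apply/negP => sW.
have W1E g : g \in W -> g = 1%:M.
  by case: (W) sW W1 => [//|a [|//]] _; rewrite !inE => /eqP <- /eqP.
have /matrixP /(_ (Ordinal n_gt0) 0) : const_mx 1 = 0 :> 'cV[R]_n.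
  by apply: ess => g /W1E ->; rewrite mul1mx.
by rewrite !mxE => /eqP; rewrite oner_eq0.
Qed.

End CoxeterPoincare.

(** * The normal distribution function *)

Import numFieldNormedType.Exports.

Section NormalCdf.
Local Open Scope classical_set_scope.
Local Open Scope ring_scope.
Variable R : realType.

Definition Phi (x : R) : R := std_normal_cdf x.
Definition phi (x : R) : R := normal_peak 1 * expR (- x ^+ 2 / 2).

Lemma normal_pdf01 x : normal_pdf 0 1 x = phi x.
Proof. by rewrite normal_pdfE ?oner_neq0 // /normal_fun subr0 expr1n. Qed.

Lemma Phi_derive (x : R) : is_derive x 1 Phi (phi x).
Proof.
have x1 : x < x + 1 by rewrite ltrDl.
have int : lebesgue_measure.-integrable [set` Interval -oo%O (BRight (x + 1))]
    (EFin \o @normal_pdf R 0 1).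
  by apply: (@integrableS _ _ _ _ setT) => //; apply: integrable_normal_pdf.
have [||d1 d2] := continuous_FTC1 x1 int; first by rewrite ltNyr.
  exact: continuous_normal_pdf (oner_neq0 R) x.
rewrite -normal_pdf01 -d2; apply: DeriveDef; first exact: d1.
by rewrite derive1E.
Qed.

(** The general facts on distribution functions concern random variables; here the identity, under
    the normal law, serves as one. *)
Let idTR : measurableTypeR R -> R := idfun.
#[local] HB.instance Definition _ :=
  @isMeasurableFun.Build _ _ _ _ idTR (@measurable_id _ _ setT).
Let X : {RV (@normal_prob R 0 1) >-> R} := idTR : {RV (@normal_prob R 0 1) >-> R}.

Lemma PhiE x : (Phi x)%:E = cdf X x.
Proof.
rewrite /Phi /std_normal_cdf fineK.
  by rewrite /cdf /distribution /pushforward preimage_id.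
exact: fin_num_measure.
Qed.

Lemma Phi_ge0 x : 0 <= Phi x.
Proof. by rewrite -lee_fin PhiE. Qed.

Lemma Phi_le1 x : Phi x <= 1.
Proof. by rewrite -lee_fin PhiE cdf_le1. Qed.

Lemma Phi_nondecreasing x y : x <= y -> Phi x <= Phi y.
Proof. by move=> xy; rewrite -lee_fin !PhiE; apply: cdf_nondecreasing. Qed.

Lemma Phi_tails (eta : R) : 0 < eta ->
  exists2 K, 0 <= K & 1 - eta <= Phi K /\ Phi (- K) <= eta.
Proof.
move=> eta0.
have PhiF : Phi = fine \o cdf X by apply/funext => x; rewrite [RHS]/comp -PhiE.
have c1 : Phi x @[x --> +oo] --> (1 : R) by rewrite PhiF; apply: fine_cvg; apply: cvg_cdfy1.
have c0 : Phi x @[x --> -oo] --> (0 : R) by rewrite PhiF; apply: fine_cvg; apply: cvg_cdfNy0.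
move/cvgrPdist_le : c1 => /(_ _ eta0) [K1 [_ h1]].
move/cvgrPdist_le : c0 => /(_ _ eta0) [K2 [_ h2]].
pose K := `|K1| + `|K2| + 1.
have K1K : K1 < K by have := ler_norm K1; have := normr_ge0 K2; rewrite /K; lra.
have K2K : - K < K2 by have := ler_norm (- K2); have := normr_ge0 K1; rewrite normrN /K; lra.
exists K; first by rewrite /K; have := normr_ge0 K1; have := normr_ge0 K2; lra.
split; first by have := h1 _ K1K; rewrite /= ler_norml; lra.
by have := h2 _ K2K; rewrite /= ler_norml; lra.
Qed.

End NormalCdf.

(** * Taylor estimates with explicit remainders *)

Section NormalTaylor.
Local Open Scope classical_set_scope.
Local Open Scope ring_scope.
Variable R : realType.
Implicit Types (f g : R -> R) (x y z h r a b : R).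

Lemma is_derive_add f g x a b : is_derive x 1 f a -> is_derive x 1 g b ->
  is_derive x 1 (fun y => f y + g y) (a + b).
Proof. by move=> df dg; apply: is_deriveD. Qed.

Lemma is_derive_mul f g x a b : is_derive x 1 f a -> is_derive x 1 g b ->
  is_derive x 1 (fun y => f y * g y) (a * g x + f x * b).
Proof.
move=> df dg; rewrite (_ : a * g x + f x * b = f x *: b + g x *: a); first exact: is_deriveM.
by rewrite addrC [a * _]mulrC.
Qed.

Lemma is_derive_comp f g x a b : is_derive (g x) 1 f a -> is_derive x 1 g b ->
  is_derive x 1 (fun y => f (g y)) (a * b).
Proof. by move=> df dg; apply: is_derive1_comp. Qed.

Lemma is_derive_const c x : is_derive x 1 (fun=> c : R) 0.
Proof. exact: is_derive_cst. Qed.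

Lemma is_derive_idR x : is_derive x 1 (fun y : R => y) 1.
Proof. exact: is_derive_id. Qed.

Lemma is_derive_scale c f x a : is_derive x 1 f a -> is_derive x 1 (fun y => c * f y) (c * a).
Proof.
by move=> df; have := is_derive_mul (is_derive_const c x) df; rewrite mul0r add0r.
Qed.

Lemma is_derive_ext f g x a b : is_derive x 1 f a -> f =1 g -> a = b -> is_derive x 1 g b.
Proof. by move=> df /funext <- <-. Qed.

Lemma is_derive_inv f x a : f x != 0 -> is_derive x 1 f a ->
  is_derive x 1 (fun y => (f y)^-1) (- (f x) ^- 2 * a).
Proof. by move=> fx df; apply: is_deriveV. Qed.

Definition between0 h x : Prop := 0 <= x <= h \/ h <= x <= 0.

(** One integration of a power bound, by the mean value theorem; the factor 1 / (k + 1) is given up.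
    Iterating it from the highest derivative gives Taylor estimates. *)
Lemma growth_bound f df h (M : R) (k : nat) : 0 <= M ->
  (forall x, between0 h x -> is_derive x 1 f (df x)) ->
  (forall x, between0 h x -> `|df x| <= M * `|x| ^+ k) ->
  `|f h - f 0| <= M * `|h| ^+ k.+1.
Proof.
move=> M0 fd fM; have cont a b : (forall x, a <= x <= b -> between0 h x) ->
    {within `[a, b], continuous f}.
  move=> ab; apply: derivable_within_continuous => x; rewrite in_itv /= => /ab /fd.
  by case.
have bound x : between0 h x -> `|df x| <= M * `|h| ^+ k.
  move=> xb; apply: le_trans (fM x xb) _; rewrite ler_wpM2l // lerXn2r ?nnegrE //.
  by case: xb => /andP[u w]; [rewrite !ger0_norm ?(le_trans u w)|rewrite !ler0_norm ?lerN2 ?(le_trans u w)].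
case: (ltgtP 0 h) => [h0|h0|<-]; last by rewrite subrr normr0 mulr_ge0 ?exprn_ge0.
- have ab x : 0 <= x <= h -> between0 h x by left.
  have d x : x \in `]0, h[ -> is_derive x 1 f (df x).
    by rewrite in_itv /= => /andP[u w]; apply: fd; apply: ab; rewrite !ltW.
  have [c + ->] := MVT h0 d (cont _ _ ab).
  rewrite in_itv /= => /andP[u w]; rewrite subr0 normrM exprSr mulrA ler_wpM2r //.
  by apply: bound; apply: ab; rewrite !ltW.
have ab x : h <= x <= 0 -> between0 h x by right.
have d x : x \in `]h, 0[ -> is_derive x 1 f (df x).
  by rewrite in_itv /= => /andP[u w]; apply: fd; apply: ab; rewrite !ltW.
have [c + e] := MVT h0 d (cont _ _ ab).
rewrite in_itv /= => /andP[u w]; rewrite distrC e normrM sub0r normrN exprSr mulrA ler_wpM2r //.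
by apply: bound; apply: ab; rewrite !ltW.
Qed.

Lemma phi_derive x : is_derive x 1 (@phi R) (- x * phi x).
Proof.
have d : is_derive x 1 (fun y : R => - y ^+ 2 / 2) (- x).
  apply: (is_derive_ext (is_derive_scale (- 2^-1) (is_derive_mul (is_derive_idR x) (is_derive_idR x)))).
    by move=> y; rewrite expr2; ring.
  by field.
apply: (is_derive_ext (is_derive_scale (normal_peak 1) (is_derive_comp (is_derive_expR _) d))) => //.
by rewrite mulrA mulrC.
Qed.

Lemma phi_derive2 x : is_derive x 1 (fun y : R => - y * phi y) ((x ^+ 2 - 1) * phi x).
Proof.
apply: (is_derive_ext (is_derive_mul (is_derive_scale (-1) (is_derive_idR x)) (phi_derive x))).
  by move=> y; rewrite mulN1r.
by ring.
Qed.

(** A common bound for [phi] times any polynomial dominated by 2 (1 + x^4). Since exp(x^2 / 2) >= (1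
    + x^2 / 4)^2 and 16 (1 + x^2 / 4)^2 >= 1 + x^4, the constant 2 * 16 works. *)
Definition phi_bound : R := 32 * normal_peak 1.

Lemma phi_bound_ge0 : 0 <= phi_bound.
Proof. by rewrite mulr_ge0 ?normal_peak_ge0. Qed.

Lemma phi_ge0 x : 0 <= phi x.
Proof. by rewrite mulr_ge0 ?normal_peak_ge0 ?expR_ge0. Qed.

Lemma phi_quartic x : 2 * (1 + x ^+ 4) * phi x <= phi_bound.
Proof.
rewrite /phi /phi_bound mulrCA [leRHS]mulrC ler_wpM2l ?normal_peak_ge0 //.
rewrite mulNr expRN ler_pdivrMr ?expR_gt0 //.
have -> : x ^+ 2 / 2 = x ^+ 2 / 4 + x ^+ 2 / 4 by field.
have e1 := expR_ge1Dx (x ^+ 2 / 4); rewrite expRD.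
have x2 := sqr_ge0 x; have e0 : 0 <= 1 + x ^+ 2 / 4 by nra.
have : (1 + x ^+ 2 / 4) * (1 + x ^+ 2 / 4) <= expR (x ^+ 2 / 4) * expR (x ^+ 2 / 4).
  by rewrite ler_pM.
have -> : x ^+ 4 = x ^+ 2 * x ^+ 2 by rewrite -exprD.
by move: (x ^+ 2) x2 => y y0; nra.
Qed.

Lemma phi_poly_bound (p : R) x : `|p| <= 2 * (1 + x ^+ 4) -> `|p * phi x| <= phi_bound.
Proof.
move=> px; rewrite normrM (ger0_norm (phi_ge0 x)).
by apply: le_trans (phi_quartic x); rewrite ler_wpM2r ?phi_ge0.
Qed.

Lemma Phi_taylor z h :
  `|Phi (z + h) - Phi z - h * phi z + h ^+ 2 / 2 * (z * phi z)| <= phi_bound * `|h| ^+ 3.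
Proof.
have shift f (df : R -> R) : (forall x, is_derive x 1 f (df x)) ->
    forall x, is_derive x 1 (fun y => f (z + y)) (df (z + x)).
  move=> fd x; have d := is_derive_add (is_derive_const z x) (is_derive_idR x).
  by have := is_derive_comp (fd _) d; rewrite add0r mulr1.
have b1 x : `|(- (z + x) * phi (z + x)) - (- (z + 0) * phi (z + 0))| <= phi_bound * `|x| ^+ 1.
  apply: (@growth_bound (fun y => - (z + y) * phi (z + y)) (fun y => ((z + y) ^+ 2 - 1) * phi (z + y)) x _ 0 phi_bound_ge0).
    by move=> y _; apply: (shift _ _ phi_derive2).
  move=> y _; rewrite expr0 mulr1; apply: phi_poly_bound.
  by move: (z + y) => t; rewrite ler_norml; nra.
have b2 x : `|(phi (z + x) + z * phi z * x) - (phi (z + 0) + z * phi z * 0)| <= phi_bound * `|x| ^+ 2.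
  apply: (@growth_bound (fun x => phi (z + x) + z * phi z * x)
    (fun y => - (z + y) * phi (z + y) + z * phi z * 1) x _ 1 phi_bound_ge0) => y _.
    exact: (is_derive_add (shift _ _ phi_derive y) (is_derive_scale _ (is_derive_idR y))).
  by have := b1 y; rewrite addr0 [- z * _]mulNr opprK mulr1.
have := @growth_bound (fun x => Phi (z + x) + (- phi z * x + z * phi z / 2 * (x * x)))
   (fun y => phi (z + y) + (- phi z * 1 + z * phi z / 2 * (1 * y + y * 1))) h _ 2 phi_bound_ge0.
rewrite !mulr0 !addr0 (_ : _ - _ = Phi (z + h) - Phi z - h * phi z + h ^+ 2 / 2 * (z * phi z)); last by field.
apply=> y _.
  exact: (is_derive_add (shift _ _ (@Phi_derive R) y) (is_derive_add
    (is_derive_scale _ (is_derive_idR y))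
    (is_derive_scale _ (is_derive_mul (is_derive_idR y) (is_derive_idR y))))).
by have := b2 y; rewrite addr0 mulr0 addr0 (_ : _ - _ = phi (z + y) + (- phi z * 1 + z * phi z / 2 * (1 * y + y * 1))) //; field.
Qed.

(** Increasing the variance by [r] has the first-order effect - r / 2 * z * phi z, the same as the
    quadratic term of [Phi_taylor] for a displacement of mean square [r]. This is the heat equation
    at one point. *)
Lemma Phi_scale z r : 0 <= r ->
  `|Phi (z / Num.sqrt (1 + r)) - Phi z + r / 2 * (z * phi z)| <= phi_bound * r ^+ 2.
Proof.
move=> r0; pose G x := z / Num.sqrt (1 + x).
have G0 : G 0 = z by rewrite /G addr0 sqrtr1 divr1.
have pos x : between0 r x -> 0 < 1 + x by case=> /andP[]; lra.
have dG x : between0 r x -> is_derive x 1 G (- 2^-1 * (G x / (1 + x))).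
  move=> /pos x1; have s0 : 0 < Num.sqrt (1 + x) by rewrite sqrtr_gt0.
  have d1 := is_derive_add (is_derive_const 1 x) (is_derive_idR x).
  have d2 : is_derive x 1 (fun y => Num.sqrt (1 + y)) ((2 * Num.sqrt (1 + x))^-1 * (0 + 1)).
    by apply: is_derive_comp d1; apply: is_derive1_sqrt.
  have d3 := is_derive_scale z (@is_derive_inv (fun y => Num.sqrt (1 + y)) _ _ (lt0r_neq0 s0) d2).
  rewrite (_ : - 2^-1 * (G x / (1 + x)) = z * (- (Num.sqrt (1 + x)) ^- 2 * ((2 * Num.sqrt (1 + x))^-1 * (0 + 1)))) //.
  rewrite /G -[in X in _ / X](sqr_sqrtr (ltW x1)) add0r mulr1.
  by field; rewrite lt0r_neq0.
(* The derivative of [Phi (G x)] is [- p1 x / 2]; bounding the derivative of [p1] and integrating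
   twice yields the remainder. *)
pose p1 x := G x * phi (G x) / (1 + x).
have dV x : between0 r x -> is_derive x 1 (fun y => (1 + y)^-1) (- (1 + x) ^- 2).
  move=> /pos x1; have d1 := is_derive_add (is_derive_const 1 x) (is_derive_idR x).
  have := @is_derive_inv (fun y => 1 + y) _ _ (lt0r_neq0 x1) d1.
  by rewrite add0r mulr1.
have b1 x : between0 r x -> `|p1 x - p1 0| <= phi_bound * `|x| ^+ 1.
  move=> xr; have sub y : between0 x y -> between0 r y.
    by move: xr; rewrite /between0; lra.
  apply: (@growth_bound p1 (fun y => ((- (- G y * phi (G y)) - ((G y) ^+ 2) * (G y) * phi (G y)) * (- 2^-1 / (1 + y)) * (1 + y)^-1
      + G y * phi (G y) * (- (1 + y) ^- 2))) x _ 0 phi_bound_ge0) => y /sub yr.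
    have y1 := pos _ yr.
    have dg := dG _ yr; have dphi := is_derive_comp (phi_derive _) dg.
    have := is_derive_mul (is_derive_mul dg dphi) (dV _ yr).
    rewrite (_ : _ + _ = ((- (- G y * phi (G y)) - ((G y) ^+ 2) * (G y) * phi (G y)) * (- 2^-1 / (1 + y)) * (1 + y)^-1
      + G y * phi (G y) * (- (1 + y) ^- 2))) //.
    by field; rewrite lt0r_neq0.
  have y1 := pos _ yr; have y0 : 0 <= y by case: yr => /andP[]; lra.
  rewrite expr0 mulr1.
  set t := G y.
  rewrite (_ : _ + _ = (1 + y) ^- 2 * ((2^-1 * t ^+ 3 - 3 / 2 * t) * phi t)); last first.
    by field; rewrite lt0r_neq0.
  rewrite normrM; apply: le_trans (_ : 1 * phi_bound <= _); last by rewrite mul1r.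
  apply: ler_pM => //; last first.
    apply: phi_poly_bound; rewrite ler_norml.
    have := sqr_ge0 (t - t ^+ 2); have := sqr_ge0 (t + t ^+ 2); have := sqr_ge0 (t - 1).
    by have := sqr_ge0 (t + 1); have := sqr_ge0 (t ^+ 2 - 1); nra.
  rewrite ger0_norm ?invr_ge0 ?sqr_ge0 // invf_le1 ?exprn_gt0 //.
  by rewrite exprn_ege1 // lerDl.
have := @growth_bound (fun x => Phi (G x) + 2^-1 * p1 0 * x)
   (fun y => phi (G y) * (- 2^-1 * (G y / (1 + y))) + 2^-1 * p1 0 * 1) r _ 1 phi_bound_ge0.
rewrite mulr0 addr0 G0 (ger0_norm r0).
rewrite (_ : Phi (G r) + 2^-1 * p1 0 * r - Phi z = Phi (z / Num.sqrt (1 + r)) - Phi z + r / 2 * (z * phi z)); last first.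
  by rewrite /p1 G0 addr0 /G; field.
apply=> y yr.
  exact: (is_derive_add (is_derive_comp (Phi_derive _) (dG _ yr))
    (is_derive_scale _ (is_derive_idR y))).
have y1 := pos _ yr.
rewrite (_ : _ + _ = - 2^-1 * (p1 y - p1 0)); last by rewrite /p1; field; rewrite lt0r_neq0.
rewrite normrM; have := b1 y yr; have := normr_ge0 (p1 y - p1 0).
rewrite normrN (@ger0_norm _ (2^-1)) ?invr_ge0 //; lra.
Qed.

End NormalTaylor.

(** * Sums of independent uniform variables *)

Section UniformAverages.
Local Open Scope ring_scope.
Variable R : realType.
Implicit Types (g h : R -> R) (x y z : R) (e : nat) (es : seq nat).

Definition node e (j : nat) : R := j%:R - (e%:R - 1) / 2.

(* [Uavg e g x] is the mean of [g (x + U)] for [U] uniform on [e] consecutive points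
   centred at 0, whose moments of order 2, 4, 6 are [unif_var e], [m4 e], [m6 e]. *)
Definition Uavg e g x : R := (\sum_(j < e) g (x + node e j)) / e%:R.

(** The mean of [g (x + S)] for a sum [S] of independent centred uniform variables, one for each
    entry of [es]. *)
Definition Uall es g : R -> R := foldr Uavg g es.

Definition unif_var e : R := (e%:R ^+ 2 - 1) / 12.

Definition total_var es : R := \sum_(e <- es) unif_var e.

Lemma UavgD e g h x : Uavg e (fun y => g y + h y) x = Uavg e g x + Uavg e h x.
Proof. by rewrite /Uavg big_split mulrDl. Qed.

Lemma UavgZ e c g x : Uavg e (fun y => c * g y) x = c * Uavg e g x.
Proof. by rewrite /Uavg -mulr_sumr mulrA. Qed.

Lemma Uavg_const e c x : (0 < e)%N -> Uavg e (fun=> c) x = c.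
Proof.
move=> e0; rewrite /Uavg sumr_const card_ord -[c *+ e]mulr_natr mulfK //.
by rewrite pnatr_eq0 -lt0n.
Qed.

Lemma eq_Uavg e g h : g =1 h -> Uavg e g =1 Uavg e h.
Proof. by move=> gh x; rewrite /Uavg; congr (_ / _); apply: eq_bigr => j _; apply: gh. Qed.

Lemma Uavg_le e g h x : (forall j, (j < e)%N -> g (x + node e j) <= h (x + node e j)) ->
  Uavg e g x <= Uavg e h x.
Proof. by move=> gh; rewrite ler_wpM2r ?invr_ge0 ?ler0n //; apply: ler_sum => j _; apply: gh. Qed.

Lemma UallD es g h x : Uall es (fun y => g y + h y) x = Uall es g x + Uall es h x.
Proof.
by elim: es x => [|e es IH] x //=; rewrite -UavgD; apply: eq_Uavg.
Qed.

Lemma UallZ es c g x : Uall es (fun y => c * g y) x = c * Uall es g x.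
Proof.
by elim: es x => [|e es IH] x //=; rewrite -UavgZ; apply: eq_Uavg.
Qed.

Lemma eq_Uall es g h : g =1 h -> Uall es g =1 Uall es h.
Proof. by move=> gh; elim: es => [|e es IH] //=; apply: eq_Uavg. Qed.

Lemma UallN es g x : Uall es (fun y => - g y) x = - Uall es g x.
Proof. by rewrite -mulN1r -UallZ; apply: eq_Uall => y; rewrite mulN1r. Qed.

Lemma UallB es g h x : Uall es (fun y => g y - h y) x = Uall es g x - Uall es h x.
Proof. by rewrite UallD UallN. Qed.

Lemma Uall_sum (I : Type) (r : seq I) es (g : I -> R -> R) x :
  Uall es (fun y => \sum_(i <- r) g i y) x = \sum_(i <- r) Uall es (g i) x.
Proof.
elim: r => [|i r IH]; last first.
  by rewrite big_cons -IH -UallD; apply: eq_Uall => y; rewrite big_cons.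
transitivity (0 * Uall es (fun=> 0) x); last by rewrite mul0r big_nil.
by rewrite -UallZ; apply: eq_Uall => y; rewrite big_nil mul0r.
Qed.

Lemma Uall_const es c x : all (ltn 0) es -> Uall es (fun=> c) x = c.
Proof.
elim: es x => [|e es IH] x //= /andP[e0 es0].
by rewrite -[RHS](Uavg_const c x e0); apply: eq_Uavg => y; apply: IH.
Qed.

Lemma Uall_le es g h x : (forall y, g y <= h y) -> Uall es g x <= Uall es h x.
Proof. by move=> gh; elim: es x => [|e es IH] x //=; apply: Uavg_le. Qed.

Lemma Uall_shift es g c x : Uall es (fun y => g (y + c)) x = Uall es g (x + c).
Proof.
elim: es x => [|e es IH] x //=; rewrite /Uavg; congr (_ / _).
by apply: eq_bigr => j _; rewrite IH addrAC.
Qed.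

Lemma Uavg_close e g h c x : (0 < e)%N ->
  (forall j, (j < e)%N -> `|g (x + node e j) - h (x + node e j)| <= c) ->
  `|Uavg e g x - Uavg e h x| <= c.
Proof.
move=> e0 gh; rewrite -mulrBl -sumrB normrM normfV normr_nat ler_pdivrMr ?ltr0n //.
apply: le_trans (ler_norm_sum _ _ _) _.
apply: le_trans (_ : \sum_(j < e) c <= _); first by apply: ler_sum => j _; apply: gh.
by rewrite sumr_const card_ord mulr_natr.
Qed.

Lemma Uall_close es g h c x : all (ltn 0) es ->
  (forall y, `|g y - h y| <= c) -> `|Uall es g x - Uall es h x| <= c.
Proof.
elim: es x => [|e es IH] x //= /andP[e0 es0] gh.
by apply: Uavg_close => // j _; apply: IH.
Qed.

(** An additional point moves the centre by 1/2. With [x] left free, this gives all power sums by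
    induction on [e]. *)
Lemma sum_node_shift e x (g : R -> R) :
  \sum_(j < e.+1) g (x + node e.+1 j) =
  \sum_(j < e) g (x - 1/2 + node e j) + g (x + e%:R / 2).
Proof.
rewrite big_ord_recr /=; congr (_ + _).
  by apply: eq_bigr => j _; congr g; rewrite /node -natr1; field.
by congr g; rewrite /node -natr1; field.
Qed.

Definition m4 e : R := (e%:R ^+ 2 - 1) * (3 * e%:R ^+ 2 - 7) / 240.
Definition m6 e : R := (e%:R ^+ 2 - 1) * (3 * e%:R ^+ 4 - 18 * e%:R ^+ 2 + 31) / 1344.

Lemma Uavg_id e x : (0 < e)%N -> Uavg e id x = x.
Proof.
move=> e0; have e1 : e%:R != 0 :> R by rewrite pnatr_eq0 -lt0n.
suff : \sum_(j < e) (x + node e j) = e%:R * x by move=> h; rewrite /Uavg h mulrC mulKf.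
elim: e x {e0 e1} => [|e IH] x; first by rewrite big_ord0 mul0r.
by rewrite (sum_node_shift e x id) IH -natr1; field.
Qed.

Lemma Uavg_pow2 e x : (0 < e)%N -> Uavg e (fun y => y ^+ 2) x = x ^+ 2 + unif_var e.
Proof.
move=> e0; have e1 : e%:R != 0 :> R by rewrite pnatr_eq0 -lt0n.
suff : \sum_(j < e) (x + node e j) ^+ 2 = e%:R * (x ^+ 2 + unif_var e).
  by move=> h; rewrite /Uavg h mulrC mulKf.
elim: e x {e0 e1} => [|e IH] x; first by rewrite big_ord0 mul0r.
by rewrite (sum_node_shift e x (fun y => y ^+ 2)) IH /unif_var -natr1; field.
Qed.

Lemma Uavg_pow4 e x : (0 < e)%N ->
  Uavg e (fun y => y ^+ 4) x = x ^+ 4 + 6 * unif_var e * x ^+ 2 + m4 e.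
Proof.
move=> e0; have e1 : e%:R != 0 :> R by rewrite pnatr_eq0 -lt0n.
suff : \sum_(j < e) (x + node e j) ^+ 4 = e%:R * (x ^+ 4 + 6 * unif_var e * x ^+ 2 + m4 e).
  by move=> h; rewrite /Uavg h mulrC mulKf.
elim: e x {e0 e1} => [|e IH] x; first by rewrite big_ord0 mul0r.
by rewrite (sum_node_shift e x (fun y => y ^+ 4)) IH /unif_var /m4 -natr1; field.
Qed.

Lemma Uavg_pow6 e x : (0 < e)%N ->
  Uavg e (fun y => y ^+ 6) x = x ^+ 6 + 15 * unif_var e * x ^+ 4 + 15 * m4 e * x ^+ 2 + m6 e.
Proof.
move=> e0; have e1 : e%:R != 0 :> R by rewrite pnatr_eq0 -lt0n.
suff : \sum_(j < e) (x + node e j) ^+ 6 =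
    e%:R * (x ^+ 6 + 15 * unif_var e * x ^+ 4 + 15 * m4 e * x ^+ 2 + m6 e).
  by move=> h; rewrite /Uavg h mulrC mulKf.
elim: e x {e0 e1} => [|e IH] x; first by rewrite big_ord0 mul0r.
by rewrite (sum_node_shift e x (fun y => y ^+ 6)) IH /unif_var /m4 /m6 -natr1; field.
Qed.

Lemma unif_var_ge0 e : (0 < e)%N -> 0 <= unif_var e.
Proof.
by move=> e0; rewrite /unif_var divr_ge0 // subr_ge0 exprn_ege1 // ler1n.
Qed.

(** The first term is the fourth moment of a Gaussian of the same variance; the defects add up to
    [kurt]. *)
Lemma m4E e : m4 e = 3 * unif_var e ^+ 2 - (e%:R ^+ 4 - 1) / 120.
Proof. by rewrite /m4 /unif_var; field. Qed.

Lemma m4_le e : (0 < e)%N -> m4 e <= 3 * unif_var e ^+ 2.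
Proof.
by move=> e0; rewrite m4E gerBl divr_ge0 // subr_ge0 exprn_ege1 // ler1n.
Qed.

Lemma m6_le e : (0 < e)%N -> m6 e <= 15 * unif_var e ^+ 3.
Proof.
case: e => [|[|e]] // _; first by rewrite /m6 /unif_var expr1n subrr !mul0r expr0n mulr0.
rewrite /m6 /unif_var; set x : R := e.+2%:R; have x2 : 2 <= x by rewrite ler_nat.
have -> : x ^+ 4 = (x ^+ 2) ^+ 2 by rewrite -exprM.
have : 4 <= x ^+ 2 by nra.
move: (x ^+ 2) => t t4.
rewrite -subr_ge0 (_ : _ - _ = (t - 1) * (15 / 1728 * (t - 1) ^+ 2 - (3 * t ^+ 2 - 18 * t + 31) / 1344)); last by field.
by rewrite mulr_ge0 ?subr_ge0 //; nra.
Qed.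

Lemma total_var_ge0 es : all (ltn 0) es -> 0 <= total_var es.
Proof.
by move=> /allP h; rewrite /total_var big_seq; apply: sumr_ge0 => e /h e0; apply: unif_var_ge0.
Qed.

Lemma total_var_cons e es : total_var (e :: es) = unif_var e + total_var es.
Proof. by rewrite /total_var big_cons. Qed.

Lemma Uall_id es x : all (ltn 0) es -> Uall es id x = x.
Proof.
elim: es x => [|e es IH] x //= /andP[e0 es0].
by rewrite -[RHS](Uavg_id x e0); apply: eq_Uavg => y; apply: IH.
Qed.

Lemma Uall_pow2 es x : all (ltn 0) es -> Uall es (fun y => y ^+ 2) x = x ^+ 2 + total_var es.
Proof.
elim: es x => [|e es IH] x /=; first by move=> _; rewrite /total_var big_nil addr0.
move=> /andP[e0 es0]; rewrite (eq_Uavg _ (h := fun y => y ^+ 2 + total_var es)) => [|y]; last exact: IH.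
by rewrite UavgD Uavg_pow2 // Uavg_const // total_var_cons addrA.
Qed.

Lemma Uall_pow4 es x : all (ltn 0) es ->
  Uall es (fun y => y ^+ 4) x =
  x ^+ 4 + 6 * total_var es * x ^+ 2 + 3 * total_var es ^+ 2 - (\sum_(e <- es) (e%:R ^+ 4 - 1)) / 120.
Proof.
elim: es x => [|e es IH] x /=; first by move=> _; rewrite /total_var !big_nil; field.
move=> /andP[e0 es0]; set S := \sum_(i <- es) _ in IH *.
rewrite (eq_Uavg _ (h := fun y => y ^+ 4 + (6 * total_var es * y ^+ 2 + (3 * total_var es ^+ 2 - S / 120)))) => [|y]; last first.
  by rewrite IH // !addrA.
rewrite UavgD UavgD UavgZ Uavg_pow2 // Uavg_pow4 // Uavg_const // total_var_cons big_cons m4E.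
by rewrite -/S; field.
Qed.

(** The bound is the sixth moment of [x] plus a Gaussian of variance [total_var es]. Each uniform
    moment is at most its Gaussian counterpart, and Gaussian variances add. *)
Lemma Uall_pow6 es x : all (ltn 0) es ->
  Uall es (fun y => y ^+ 6) x <=
  x ^+ 6 + 15 * total_var es * x ^+ 4 + 45 * total_var es ^+ 2 * x ^+ 2 + 15 * total_var es ^+ 3.
Proof.
elim: es x => [|e es IH] x /=; first by move=> _; rewrite /total_var !big_nil; lra.
move=> /andP[e0 es0]; have V0 := total_var_ge0 es0; have v0 := unif_var_ge0 e0.
have h4 := m4_le e0; have h6 := m6_le e0.
apply: le_trans (_ : Uavg e (fun y => y ^+ 6 + (15 * total_var es * y ^+ 4 + (45 * total_var es ^+ 2 * y ^+ 2 + 15 * total_var es ^+ 3))) x <= _).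
  by apply: Uavg_le => j _; rewrite !addrA; apply: IH.
rewrite UavgD Uavg_pow6 // UavgD UavgZ Uavg_pow4 // UavgD UavgZ Uavg_pow2 // Uavg_const //.
rewrite total_var_cons; move: (total_var es) (unif_var e) (m4 e) (m6 e) V0 v0 h4 h6 => V u p q V0 u0 h4 h6.
have x2 := sqr_ge0 x; have h1 : 15 * p * x ^+ 2 <= 15 * (3 * u ^+ 2) * x ^+ 2.
  by rewrite ler_wpM2r // ler_wpM2l.
have h2 : 15 * V * p <= 15 * V * (3 * u ^+ 2) by rewrite ler_wpM2l // mulr_ge0.
apply: le_trans (_ : x ^+ 6 + 15 * u * x ^+ 4 + 15 * (3 * u ^+ 2) * x ^+ 2 + 15 * u ^+ 3 +
  (15 * V * (x ^+ 4 + 6 * u * x ^+ 2) + 15 * V * (3 * u ^+ 2) +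
  (45 * V ^+ 2 * (x ^+ 2 + u) + 15 * V ^+ 3)) <= _); first by lra.
by rewrite le_eqVlt; apply/orP; left; apply/eqP; ring.
Qed.

End UniformAverages.

(** * Gaussian replacement *)

Section Lindeberg.
Local Open Scope ring_scope.
Variable R : realType.
Implicit Types (x y z A t : R) (e D : nat) (es : seq nat).

Local Notation B := (phi_bound R).
Local Notation m2 := (@unif_var R).
Local Notation Var := (@total_var R).

(* [heat A t] solves the heat equation [u_t = u_xx / 2]. *)
Definition heat A t x : R := Phi ((A - x) / Num.sqrt t).

(** Both averages are compared with that of the quadratic Taylor polynomial [q]. In the cubic
    remainder |xi|^3 is at most e / 2 * xi^2, which leaves one factor of the variance. *)
Lemma Uavg_heat A t e x : 0 < t -> (0 < e)%N ->
  `|Uavg e (heat A t) x - heat A (t + m2 e) x| <=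
  B * (e%:R / 2 * (m2 e / Num.sqrt t ^+ 3) + (m2 e / t) ^+ 2).
Proof.
move=> t0 e0; have s0 : 0 < Num.sqrt t by rewrite sqrtr_gt0.
have e1 : e%:R != 0 :> R by rewrite pnatr_eq0 -lt0n.
have tE : t = Num.sqrt t ^+ 2 by rewrite sqr_sqrtr // ltW.
set s := Num.sqrt t in s0 tE *; set z := (A - x) / s.
pose q y := Phi z + (- (phi z / s) * (y - x) + - (z * phi z / (2 * t)) * (y - x) ^+ 2).
have qE : Uavg e q x = Phi z - m2 e / (2 * t) * (z * phi z).
  rewrite /q (UavgD _ (fun=> Phi z)) Uavg_const //.
  rewrite (UavgD _ (fun y => - (phi z / s) * (y - x))) !UavgZ.
  rewrite (UavgD _ id (fun=> - x)) Uavg_id // Uavg_const // subrr.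
  have -> : Uavg e (fun y => (y - x) ^+ 2) x = m2 e.
    have := Uall_shift [:: e] (fun y => y ^+ 2) (- x) x; rewrite /= => ->.
    by rewrite subrr Uavg_pow2 // expr0n add0r.
  by rewrite tE; field; rewrite lt0r_neq0.
have step1 : `|Uavg e (heat A t) x - Uavg e q x| <= B * (e%:R / 2 * (m2 e / s ^+ 3)).
  have b3 : Uavg e (fun y => B * (e%:R / 2 / s ^+ 3) * (y - x) ^+ 2) x = B * (e%:R / 2 * (m2 e / s ^+ 3)).
    have := Uall_shift [:: e] (fun y => y ^+ 2) (- x) x; rewrite /= => h.
    by rewrite UavgZ h subrr Uavg_pow2 // expr0n /= add0r; field; rewrite lt0r_neq0.
  rewrite -b3 -mulrBl -sumrB normrM normfV normr_nat /Uavg ler_wpM2r ?invr_ge0 ?ler0n //.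
  apply: le_trans (ler_norm_sum _ _ _) _; apply: ler_sum => j _.
  rewrite /q /heat addrAC subrr add0r; set xi := node R e j.
  have xie : `|xi| <= e%:R / 2.
    have := ltn_ord j; rewrite -(ltr_nat R) => je.
    have j1 : j%:R + 1 <= e%:R :> R by rewrite natr1 ler_nat.
    by rewrite /xi /node ler_norml; have := ler0n R j; lra.
  have -> : (A - (x + xi)) / s = z + - (xi / s) by rewrite /z; field; rewrite lt0r_neq0.
  have := Phi_taylor z (- (xi / s)).
  rewrite (_ : _ + _ = Phi (z + - (xi / s)) - (Phi z + (- (phi z / s) * xi + - (z * phi z / (2 * t)) * xi ^+ 2))); last first.
    by rewrite tE; field; rewrite lt0r_neq0.
  move/le_trans; apply; rewrite -mulrA ler_wpM2l ?phi_bound_ge0 //.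
  rewrite normrN normrM normfV (gtr0_norm s0) exprMn exprVn [leRHS]mulrAC.
  rewrite ler_pM2r ?invr_gt0 ?exprn_gt0 // exprSr -[xi ^+ 2]real_normK ?num_real // mulrC.
  by rewrite ler_wpM2r ?exprn_ge0.
have step2 : `|Uavg e q x - heat A (t + m2 e) x| <= B * (m2 e / t) ^+ 2.
  have r0 : 0 <= m2 e / t by rewrite divr_ge0 ?unif_var_ge0 // ltW.
  have := Phi_scale z r0; rewrite distrC qE.
  have -> : z / Num.sqrt (1 + m2 e / t) = (A - x) / Num.sqrt (t + m2 e).
    rewrite (_ : t + m2 e = t * (1 + m2 e / t)); last by field; rewrite lt0r_neq0.
    by rewrite sqrtrM ?(ltW t0) // -/s invfM mulrA.
  rewrite -/(heat _ _ _) (_ : _ + _ = heat A (t + m2 e) x - (Phi z - m2 e / (2 * t) * (z * phi z))) //.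
  by field; rewrite lt0r_neq0.
rewrite mulrDr; apply: le_trans (ler_distD (Uavg e q x) _ _) _.
exact: lerD.
Qed.

Lemma unif_var_le e D : (e <= D)%N -> m2 e <= D%:R ^+ 2 / 12.
Proof.
move=> eD; rewrite /unif_var ler_pM2r ?invr_gt0 //.
apply: le_trans (_ : e%:R ^+ 2 <= _); first by rewrite gerBl.
by rewrite lerXn2r ?nnegrE ?ler0n // ler_nat.
Qed.

(** The variables already replaced only enlarge the heat parameter, so each further replacement
    costs no more than it would at [t], and the costs are proportional to the variances. *)
Lemma lindeberg A t D es x : 0 < t -> all (ltn 0) es -> all (fun e => e <= D)%N es ->
  `|Uall es (heat A t) x - heat A (t + Var es) x| <=
  B * (D%:R / 2 / Num.sqrt t ^+ 3 + D%:R ^+ 2 / 12 / t ^+ 2) * Var es.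
Proof.
move=> t0; elim: es x => [|e es IH] x /=.
  by move=> _ _; rewrite /total_var big_nil addr0 subrr normr0 mulr0.
move=> /andP[e0 es0] /andP[eD esD]; have V0 := total_var_ge0 R es0; have v0 := unif_var_ge0 R e0.
set V := Var es in V0 *; have tV : 0 < t + V by lra.
set Q := D%:R / 2 / _ + _ in IH *.
have ts : 0 < Num.sqrt t by rewrite sqrtr_gt0.
have D0 : 0 <= D%:R :> R by rewrite ler0n.
have key : e%:R / 2 * (m2 e / Num.sqrt (t + V) ^+ 3) + (m2 e / (t + V)) ^+ 2 <= Q * m2 e.
  have i3 : (Num.sqrt (t + V) ^+ 3)^-1 <= (Num.sqrt t ^+ 3)^-1.
    have tt : Num.sqrt t <= Num.sqrt (t + V) by rewrite ler_wsqrtr // lerDl.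
    rewrite lef_pV2 ?posrE ?exprn_gt0 ?(lt_le_trans ts tt) //.
    by rewrite lerXn2r ?nnegrE ?sqrtr_ge0.
  have i2 : (t + V) ^- 2 <= t ^- 2.
    rewrite lef_pV2 ?posrE ?exprn_gt0 //.
    by rewrite lerXn2r ?nnegrE ?(ltW t0) ?(ltW tV) // lerDl.
  rewrite /Q mulrDl; apply: lerD.
    rewrite -[leRHS]mulrA [_^-1 * m2 e]mulrC; apply: ler_pM.
    - by rewrite divr_ge0 ?ler0n.
    - by rewrite divr_ge0 // exprn_ge0 // sqrtr_ge0.
    - by rewrite ler_wpM2r ?invr_ge0 // ler_nat.
    - by rewrite ler_wpM2l.
  rewrite expr_div_n expr2 -[leRHS]mulrA -mulrA [_^-1 * m2 e]mulrC; apply: ler_pM => //.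
  - by rewrite divr_ge0 // exprn_ge0 // ltW.
  - exact: unif_var_le.
  - by rewrite ler_wpM2l.
apply: le_trans (ler_distD (Uavg e (heat A (t + V)) x) _ _) _.
rewrite total_var_cons -/V [m2 e + V]addrC mulrDr addrA; apply: lerD.
  by apply: Uavg_close => // j _; apply: IH.
apply: le_trans (Uavg_heat _ _ tV e0) _; rewrite -[leRHS]mulrA ler_wpM2l ?phi_bound_ge0 //.
Qed.

Definition cdf_avg es (a : R) : R := Uall es (fun y => (y <= a * Num.sqrt (Var es))%R%:R) 0.

(* The indicator function is squeezed between two heat kernels of width [eps * s]. *)
Lemma cdf_avg_close a eta : 0 < eta -> exists2 delta, 0 < delta &
  forall D es, all (ltn 0) es -> all (fun e => e <= D)%N es -> 0 < Var es ->
  D%:R / Num.sqrt (Var es) <= delta -> `|cdf_avg es a - Phi a| <= eta.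
Proof.
move=> eta0; have eta4 : 0 < eta / 4 by rewrite divr_gt0.
have [K K0 [PK PNK]] := Phi_tails eta4.
have B0 := phi_bound_ge0 R; pose c := K + `|a| + 1.
have a0 := normr_ge0 a; have c0 : 0 < c by rewrite /c; lra.
(* The shift by [eps * K] and the division by [q <= 1 + eps] displace the argument [a] by at most
   [eps * c]; the Lipschitz constant [B] of [Phi] turns this into at most [eta / 4]. *)
pose eps := eta / 4 / ((B + 1) * c).
have eps0 : 0 < eps by rewrite /eps !divr_gt0 ?mulr_gt0 //; lra.
pose q := Num.sqrt (1 + eps ^+ 2).
have q1 : 1 <= q by rewrite -[leLHS]sqrtr1 ler_wsqrtr // lerDl sqr_ge0.
have qe : q <= 1 + eps.
  rewrite -[leRHS](@ger0_norm _ (1 + eps)) -?sqrtr_sqr ?ler_wsqrtr //; last lra.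
  by rewrite sqrrD expr1n; nra.
have Phi_lip u w : `|Phi u - Phi w| <= B * `|u - w|.
  have := @growth_bound _ (fun x => Phi (w + x)) (fun x => phi (w + x)) (u - w) B 0 B0.
  rewrite addr0 [w + (u - w)]addrC subrK expr1; apply=> y _.
    have := is_derive_comp (Phi_derive _) (is_derive_add (is_derive_const w y) (is_derive_idR y)).
    by rewrite add0r mulr1.
  rewrite expr0 mulr1 -[phi _]mul1r; apply: phi_poly_bound.
  by rewrite normr1; have := exprn_even_ge0 (w + y) (isT : ~~ odd 4); lra.
have near_a k : `|k| <= eps * K -> `|Phi ((a + k) / q) - Phi a| <= eta / 4.
  move=> kK; apply: le_trans (Phi_lip _ _) _.
  have q0 : 0 < q by lra.
  have -> : (a + k) / q - a = (k - a * (q - 1)) / q by field; rewrite lt0r_neq0.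
  rewrite normrM normfV (gtr0_norm q0).
  have n1 : `|k - a * (q - 1)| <= eps * c.
    apply: le_trans (ler_normB _ _) _; rewrite normrM (ger0_norm (_ : 0 <= q - 1)); last lra.
    by rewrite /c; nra.
  apply: le_trans (_ : (B + 1) * (eps * c) <= _).
    apply: ler_pM => //; [by rewrite divr_ge0 // ltW|by lra|].
    by rewrite ler_pdivrMr //; have := mulr_ge0 (ltW eps0) (ltW c0); nra.
  rewrite /eps le_eqVlt; apply/orP; left; apply/eqP; field.
  by rewrite !lt0r_neq0 //; lra.
pose Q := B * (1 / 2 / eps ^+ 3 + 1 / 12 / eps ^+ 4).
have Q0 : 0 <= Q by rewrite mulr_ge0 // addr_ge0 // divr_ge0 // exprn_ge0 // ltW.
(* The cap 1 bounds the square of the ratio [D / s] by the ratio itself, so that the error of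
   [lindeberg] is at most [Q] times the ratio. *)
pose delta := Num.min 1 (eta / 4 / (Q + 1)).
have Q10 : 0 < Q + 1 by lra.
exists delta; first by rewrite lt_min ltr01 divr_gt0.
move=> D es es0 esD V0; set V := Var es in V0 *; set s := Num.sqrt V => Ds.
have s0 : 0 < s by rewrite sqrtr_gt0.
have VE : V = s ^+ 2 by rewrite sqr_sqrtr // ltW.
have es_gt : 0 < eps * s by rewrite mulr_gt0.
pose t := (eps * s) ^+ 2; have t0 : 0 < t by rewrite exprn_gt0.
have st : Num.sqrt t = eps * s by rewrite sqrtr_sqr gtr0_norm.
have stV : Num.sqrt (t + V) = s * q.
  rewrite (_ : t + V = s ^+ 2 * (1 + eps ^+ 2)); last by rewrite VE /t; ring.
  by rewrite sqrtrM ?sqr_ge0 // sqrtr_sqr gtr0_norm.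
have err A : `|Uall es (heat A t) 0 - heat A (t + V) 0| <= eta / 4.
  apply: le_trans (lindeberg A 0 t0 es0 esD) _; rewrite st -/V.
  set r := D%:R / s in Ds; have r0 : 0 <= r by rewrite divr_ge0 ?ler0n // ltW.
  have -> : B * (D%:R / 2 / (eps * s) ^+ 3 + D%:R ^+ 2 / 12 / t ^+ 2) * V =
     B * (r / 2 / eps ^+ 3 + r ^+ 2 / 12 / eps ^+ 4).
    by rewrite /r /t VE; field; rewrite !lt0r_neq0.
  have r1 : r <= 1 by apply: le_trans Ds _; rewrite ge_min lexx.
  apply: le_trans (_ : Q * r <= _).
    rewrite /Q -[leRHS]mulrA ler_wpM2l // mulrDl; apply: lerD.
      by rewrite le_eqVlt; apply/orP; left; apply/eqP; field; rewrite lt0r_neq0.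
    have -> : 1 / 12 / eps ^+ 4 * r = r / 12 / eps ^+ 4 by field; rewrite lt0r_neq0.
    by rewrite ler_wpM2r ?invr_ge0 ?exprn_ge0 ?(ltW eps0) // ler_wpM2r ?invr_ge0 // expr2 ler_piMr.
  have : r <= eta / 4 / (Q + 1) by apply: le_trans Ds _; rewrite ge_min lexx orbT.
  by rewrite ler_pdivlMr // => rQ; nra.
have heatE k : heat ((a + k) * s) (t + V) 0 = Phi ((a + k) / q).
  by rewrite /heat stV subr0; congr Phi; field; rewrite !lt0r_neq0 //; lra.
have upper : cdf_avg es a <= Uall es (heat ((a + eps * K) * s) t) 0 + eta / 4.
  rewrite -[eta / 4](Uall_const (eta / 4) 0 es0) -UallD; apply: Uall_le => y.
  rewrite -/V -/s; case: (lerP y (a * s)) => ya; last by rewrite addr_ge0 ?Phi_ge0 // ltW.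
  rewrite -lerBlDr; apply: le_trans PK _; apply: Phi_nondecreasing.
  by rewrite st ler_pdivlMr //; nra.
have lower : Uall es (heat ((a + - (eps * K)) * s) t) 0 - eta / 4 <= cdf_avg es a.
  rewrite -[eta / 4](Uall_const (eta / 4) 0 es0) -UallB; apply: Uall_le => y.
  rewrite -/V -/s; case: (lerP y (a * s)) => ya.
    by have := Phi_le1 (((a + - (eps * K)) * s - y) / Num.sqrt t); rewrite /heat mulr1n; lra.
  rewrite subr_le0; apply: le_trans PNK; apply: Phi_nondecreasing.
  by rewrite st ler_pdivrMr //; nra.
have eK0 : 0 <= eps * K by rewrite mulr_ge0 // ltW.
have n1 := near_a (eps * K); rewrite ger0_norm // lexx in n1.
have n2 := near_a (- (eps * K)); rewrite normrN ger0_norm // lexx in n2.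
have e1 := err ((a + eps * K) * s); have e2 := err ((a + - (eps * K)) * s).
rewrite !heatE in e1 e2; move: (n1 isT) (n2 isT) e1 e2 upper lower.
by rewrite !ler_norml; lra.
Qed.

End Lindeberg.

(** * The fourth moment under the CLT *)

Section Necessity.
Local Open Scope ring_scope.
Variable R : realType.
Implicit Types (x y z : R) (e D k m : nat) (es : seq nat) (h : R -> R).

Local Notation Var := (@total_var R).

(** Written as a telescoping sum of indicators, so that its mean is a finite combination of values
    of the distribution function; on the interval from [g j] (excluded) to [g j.+1] it equals
    [h (g j.+1)]. *)
Definition stepfun h (g : nat -> R) k y : R :=
  h (g 0%N) + \sum_(j < k) (h (g j.+1) - h (g j)) * (g j < y)%R%:R.

Lemma stepfunP h (g : nat -> R) k y : (forall j, g j <= g j.+1) ->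
  exists m, [/\ (m <= k)%N, stepfun h g k y = h (g m),
    forall j, (j < m)%N -> g j < y & (m < k)%N -> y <= g m].
Proof.
move=> gm; elim: k => [|k [m [mk e lo up]]].
  by exists 0%N; split=> //; rewrite /stepfun big_ord0 addr0.
have homo : {homo g : i j / (i <= j)%N >-> i <= j} by apply: homo_leq => // i; apply: le_trans.
have eS : stepfun h g k.+1 y = stepfun h g k y + (h (g k.+1) - h (g k)) * (g k < y)%R%:R.
  by rewrite /stepfun big_ord_recr /= addrA.
case: (ltrP (g k) y) => ky; last first.
  exists m; split=> //; first exact: leqW.
    by rewrite eS e ltNge ky mulr0 addr0.
  move=> mk1; case: (ltnP m k) => [/up //|km].
  by rewrite (_ : m = k) //; apply/eqP; rewrite eqn_leq mk.
have mE : m = k.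
  apply/eqP; rewrite eqn_leq mk leqNgt; apply/negP => mk'.
  by have := le_lt_trans (homo _ _ (ltnW mk')) ky; rewrite ltNge up.
exists k.+1; split=> //.
- by rewrite eS e ky mE mulr1 addrC subrK.
- by move=> j; rewrite ltnS => jk; apply: le_lt_trans (homo _ _ jk) ky.
- by rewrite ltnn.
Qed.

Definition trunc4 (M y : R) : R := Num.min (y ^+ 4) (M ^+ 4).

Definition grid (M : R) k (j : nat) : R := - M + 2 * M * j%:R / k%:R.

Lemma quartic_lip (M x y : R) : `|x| <= M -> `|y| <= M ->
  `|x ^+ 4 - y ^+ 4| <= 4 * M ^+ 3 * `|x - y|.
Proof.
move=> xM yM; have M0 : 0 <= M by apply: le_trans xM.
have -> : x ^+ 4 - y ^+ 4 = (x ^+ 3 + x ^+ 2 * y + x * y ^+ 2 + y ^+ 3) * (x - y) by ring.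
rewrite normrM ler_wpM2r //.
have pw i j : `|x ^+ i * y ^+ j| <= M ^+ (i + j).
  by rewrite normrM !normrX exprD ler_pM // ?exprn_ge0 // lerXn2r ?nnegrE.
have := pw 3 0; have := pw 2 1; have := pw 1 2; have := pw 0 3.
rewrite !expr0 !expr1 !mul1r !mulr1 => h1 h2 h3 h4.
apply: le_trans (ler_normD _ _) _; apply: le_trans (lerD (ler_normD _ _) h1) _.
apply: le_trans (lerD (lerD (ler_normD _ _) h2) (lexx _)) _.
by move: h3 h4 => /= h3 h4; lra.
Qed.

Lemma quartic_ge (M y : R) : 0 <= M -> M <= `|y| -> M ^+ 4 <= y ^+ 4.
Proof.
move=> M0 My; rewrite -[y ^+ 4]ger0_norm ?exprn_even_ge0 // normrX.
by rewrite lerXn2r ?nnegrE.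
Qed.

Lemma trunc4_in (M y : R) : `|y| <= M -> trunc4 M y = y ^+ 4.
Proof.
move=> yM; rewrite /trunc4 min_l // -[y ^+ 4]ger0_norm ?exprn_even_ge0 // normrX.
by rewrite lerXn2r ?nnegrE // (le_trans _ yM).
Qed.

Lemma trunc4_out (M y : R) : 0 <= M -> M <= `|y| -> trunc4 M y = M ^+ 4.
Proof. by move=> M0 My; rewrite /trunc4 min_r // quartic_ge. Qed.

(** The mesh 2 M / k times the Lipschitz constant 4 M^3 of the fourth power on [-M, M]. Outside,
    both functions are equal to M^4. *)
Lemma trunc4_step (M y : R) k : 0 < M -> (0 < k)%N ->
  `|trunc4 M y - stepfun (trunc4 M) (grid M k) k y| <= 8 * M ^+ 4 / k%:R.
Proof.
move=> M0 k0; have kR : 0 < k%:R :> R by rewrite ltr0n.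
have gS j : grid M k j.+1 = grid M k j + 2 * M / k%:R.
  by rewrite /grid -natr1; field; rewrite lt0r_neq0.
have d0 : 0 < 2 * M / k%:R by rewrite divr_gt0 // mulr_gt0.
have gm j : grid M k j <= grid M k j.+1 by rewrite gS lerDl ltW.
have w0 : 0 <= 8 * M ^+ 4 / k%:R by rewrite divr_ge0 ?mulr_ge0 ?exprn_ge0 // ltW.
have g0 : grid M k 0 = - M by rewrite /grid mulr0 mul0r addr0.
have gk : grid M k k = M by rewrite /grid; field; rewrite lt0r_neq0.
have [m [mk -> lo up]] := stepfunP (trunc4 M) k y gm.
have far z : M <= `|z| -> trunc4 M z = M ^+ 4 by apply: trunc4_out; apply: ltW.
case: m => [|m] in mk lo up *.
  have yM := up k0; rewrite g0 in yM *.
  rewrite !far ?subrr ?normr0 //; first by rewrite normrN ler_norm.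
  by rewrite ler0_norm; lra.
have mlow := lo m (ltnSn m).
have homo : {homo grid M k : i j / (i <= j)%N >-> i <= j} by apply: homo_leq => // i; apply: le_trans.
have gm0 : - M <= grid M k m by have := homo 0%N m (leq0n m); rewrite g0.
have gmM : grid M k m.+1 <= M by have := homo _ _ mk; rewrite gk.
have inner : y <= grid M k m.+1 -> `|trunc4 M y - trunc4 M (grid M k m.+1)| <= 8 * M ^+ 4 / k%:R.
  move=> yg; have yM : `|y| <= M by rewrite ler_norml; lra.
  have gM : `|grid M k m.+1| <= M by rewrite ler_norml; lra.
  rewrite !trunc4_in //; apply: le_trans (quartic_lip yM gM) _.
  rewrite (_ : 8 * M ^+ 4 / k%:R = 4 * M ^+ 3 * (2 * M / k%:R)); last by field; rewrite lt0r_neq0.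
  rewrite ler_wpM2l ?mulr_ge0 ?exprn_ge0 ?(ltW M0) // ler_norml.
  by move: mlow yg; rewrite gS; lra.
case: (ltnP m.+1 k) => [/up|km]; first exact: inner.
have mE : m.+1 = k by apply/eqP; rewrite eqn_leq mk.
case: (lerP y M) => yM; first by apply: inner; rewrite mE gk.
rewrite mE gk !far ?subrr ?normr0 //; first by rewrite ger0_norm // ltW.
by rewrite ger0_norm; lra.
Qed.

Definition Eavg es h : R := Uall es (fun y => h (y / Num.sqrt (Var es))) 0.

Lemma sqrt_even_pow k x : 0 < x -> Num.sqrt x ^+ (2 * k) = x ^+ k.
Proof. by move=> x0; rewrite exprM sqr_sqrtr // ltW. Qed.

(* [kurt es / Var es ^+ 2] is minus the excess kurtosis of the sum. *)
Definition kurt es : R := (\sum_(e <- es) (e%:R ^+ 4 - 1)) / 120.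

Lemma Eavg_pow4 es : all (ltn 0) es -> 0 < Var es ->
  Eavg es (fun y => y ^+ 4) = 3 - kurt es / Var es ^+ 2.
Proof.
move=> es0 V0; rewrite /Eavg (eq_Uall _ (h := fun y => Var es ^- 2 * y ^+ 4)) => [|y].
  rewrite UallZ Uall_pow4 // /kurt !expr0n /=; field; rewrite lt0r_neq0 //.
by rewrite expr_div_n (sqrt_even_pow 2 V0) mulrC.
Qed.

Lemma Eavg_pow6 es : all (ltn 0) es -> 0 < Var es -> Eavg es (fun y => y ^+ 6) <= 15.
Proof.
move=> es0 V0; rewrite /Eavg (eq_Uall _ (h := fun y => Var es ^- 3 * y ^+ 6)) => [|y].
  rewrite UallZ ler_pdivrMl ?exprn_gt0 //; apply: le_trans (Uall_pow6 0 es0) _.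
  by rewrite !expr0n /=; lra.
by rewrite expr_div_n (sqrt_even_pow 3 V0) mulrC.
Qed.

Lemma Eavg_step es h (g : nat -> R) k : all (ltn 0) es -> 0 < Var es ->
  Eavg es (stepfun h g k) =
  h (g 0%N) + \sum_(j < k) (h (g j.+1) - h (g j)) * (1 - cdf_avg es (g j)).
Proof.
move=> es0 V0; have s0 : 0 < Num.sqrt (Var es) by rewrite sqrtr_gt0.
rewrite /Eavg /stepfun (UallD _ (fun=> h (g 0%N))) Uall_const // Uall_sum.
congr (_ + _); apply: eq_bigr => j _; rewrite UallZ; congr (_ * _).
rewrite -[1 in RHS](Uall_const 1 0 es0) -UallB; apply: eq_Uall => y.
rewrite ltr_pdivlMr //; case: ltrP => _; [exact: esym (subr0 _)|exact: esym (subrr _)].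
Qed.

Lemma trunc4_compare M k es es' : 0 < M -> (0 < k)%N ->
  all (ltn 0) es -> 0 < Var es -> all (ltn 0) es' -> 0 < Var es' ->
  Eavg es' (trunc4 M) - Eavg es (trunc4 M) <= 16 * M ^+ 4 / k%:R +
    \sum_(j < k) M ^+ 4 * `|cdf_avg es (grid M k j) - cdf_avg es' (grid M k j)|.
Proof.
move=> M0 k0 es0 V0 es0' V0'; set st := stepfun (trunc4 M) (grid M k) k.
have close l : all (ltn 0) l -> `|Eavg l (trunc4 M) - Eavg l st| <= 8 * M ^+ 4 / k%:R.
  by move=> l0; apply: Uall_close => // y; apply: trunc4_step.
have st_le : Eavg es' st - Eavg es st <=
    \sum_(j < k) M ^+ 4 * `|cdf_avg es (grid M k j) - cdf_avg es' (grid M k j)|.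
  have cancel (a b c : R) : a + b - (a + c) = b - c by ring.
  rewrite !Eavg_step // cancel -sumrB; apply: ler_sum => j _.
  rewrite -mulrBr (_ : 1 - _ - _ = cdf_avg es (grid M k j) - cdf_avg es' (grid M k j)); last by ring.
  apply: le_trans (ler_norm _) _; rewrite normrM ler_wpM2r //.
  have t0 z : 0 <= trunc4 M z <= M ^+ 4.
    by rewrite le_min exprn_even_ge0 //= exprn_ge0 ?(ltW M0) // ge_min lexx orbT.
  by rewrite ler_norml; have := t0 (grid M k j.+1); have := t0 (grid M k j); lra.
have := close es es0; have := close es' es0'; rewrite !ler_norml.
have -> : 16 * M ^+ 4 / k%:R = 8 * M ^+ 4 / k%:R + 8 * M ^+ 4 / k%:R by field; rewrite pnatr_eq0 -lt0n.
by lra.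
Qed.

(** Beyond [M] the fourth power is at most y^6 / M^2, whose mean the sixth moment controls uniformly
    in [es]. *)
Lemma trunc4_moment M es : 0 < M -> all (ltn 0) es -> 0 < Var es ->
  Eavg es (trunc4 M) <= Eavg es (fun y => y ^+ 4) <= Eavg es (trunc4 M) + 15 / M ^+ 2.
Proof.
move=> M0 es0 V0; apply/andP; split.
  by apply: Uall_le => y; rewrite /trunc4 ge_min lexx.
have M2 : 0 < M ^+ 2 by rewrite exprn_gt0.
apply: le_trans (_ : Eavg es (fun y => trunc4 M y + M ^- 2 * y ^+ 6) <= _).
  apply: Uall_le => y0; move: (y0 / _) => y.
  case: (lerP `|y| M) => yM.
    by rewrite trunc4_in // lerDl mulr_ge0 ?invr_ge0 ?exprn_even_ge0 // ltW.
  rewrite trunc4_out ?(ltW M0) ?(ltW yM) //.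
  have y2 : M ^+ 2 <= y ^+ 2.
    by rewrite -[y ^+ 2]ger0_norm ?sqr_ge0 // normrX lerXn2r ?nnegrE // ltW.
  have : y ^+ 4 <= M ^- 2 * y ^+ 6.
    rewrite mulrC ler_pdivlMr // (exprD y 4 2).
    by rewrite ler_wpM2l ?exprn_even_ge0.
  by have := exprn_ge0 4 (ltW M0); lra.
rewrite /Eavg (UallD _ (fun y => trunc4 M (y / _))) UallZ lerD2l mulrC ler_pM2r ?invr_gt0 //.
exact: Eavg_pow6.
Qed.

Lemma eventually_forall (P : nat -> nat -> Prop) k :
  (forall j, exists N, forall n, (N <= n)%N -> P j n) ->
  exists N, forall n, (N <= n)%N -> forall j, (j < k)%N -> P j n.
Proof.
move=> h; elim: k => [|k [N1 IH]]; first by exists 0%N.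
have [N2 h2] := h k; exists (maxn N1 N2) => n; rewrite geq_max => /andP[n1 n2] j.
by rewrite ltnS leq_eqVlt => /orP[/eqP ->|jk]; [apply: h2|apply: IH].
Qed.

Lemma total_var_nseq2 m : Var (nseq m 2) = m%:R / 4.
Proof. by rewrite /total_var big_nseq iter_addr_0 /unif_var -mulr_natl; field. Qed.

Lemma kurt_nseq2 m : kurt (nseq m 2) = m%:R / 8.
Proof. by rewrite /kurt big_nseq iter_addr_0 -mulr_natl; field. Qed.

Lemma archimedean_nat x : exists N : nat, forall n, (N <= n)%N -> x <= n%:R.
Proof.
exists (Num.truncn `|x|).+1 => n Nn; apply: le_trans (ler_norm x) _.
by apply: le_trans (ltW (truncnS_gt _)) _; rewrite ler_nat.
Qed.

Lemma binomial_clt x (eta : R) : 0 < eta -> exists N, forall m, (N <= m)%N ->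
  `|cdf_avg (nseq m 2) x - Phi x| <= eta.
Proof.
move=> eta0; have [delta d0 h] := cdf_avg_close x eta0.
(* Here the ratio in [cdf_avg_close] is 2 / sqrt (m / 4) = 4 / sqrt m. *)
have [N hN] := archimedean_nat (16 / delta ^+ 2).
exists N.+1 => m Nm; have m0 : 0 < m%:R :> R by rewrite ltr0n (leq_ltn_trans _ Nm).
apply: (h 2%N); rewrite ?all_nseq ?orbT ?total_var_nseq2 ?divr_gt0 //.
have s0 : 0 < Num.sqrt (m%:R / 4 : R) by rewrite sqrtr_gt0 divr_gt0.
rewrite ler_pdivrMr // -(@ler_pXn2r _ 2) ?nnegrE ?mulr_ge0 ?(ltW d0) ?(ltW s0) //.
rewrite exprMn sqr_sqrtr ?divr_ge0 //.
have := hN m (ltnW Nm); rewrite ler_pdivrMr ?exprn_gt0 //.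
by rewrite -natrX /=; lra.
Qed.

(* Comparison with the binomial laws [nseq m 2] avoids the moments of the normal law. *)
Lemma clt_kurt (es : nat -> seq nat) :
  (forall n, (0 < n)%N -> all (ltn 0) (es n) /\ 0 < Var (es n)) ->
  (forall x eta, 0 < eta -> exists N, forall n, (N <= n)%N ->
    `|cdf_avg (es n) x - Phi x| <= eta) ->
  forall eta, 0 < eta -> exists N, forall n, (N <= n)%N ->
    kurt (es n) / Var (es n) ^+ 2 <= eta.
Proof.
move=> es0 clt eta eta0.
(* Four errors of at most [eta / 5] each will add up: truncation at [M], mesh of the grid, distance
   of the distribution functions on it, and the kurtosis defect 2 / m of the binomial law. *)
pose M := Num.sqrt (75 / eta); have M0 : 0 < M by rewrite sqrtr_gt0 divr_gt0.
have M2 : 15 / M ^+ 2 = eta / 5.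
  by rewrite sqr_sqrtr ?divr_ge0 ?ltW //; field; rewrite lt0r_neq0.
have M40 : 0 < M ^+ 4 by rewrite exprn_gt0.
have [k0 hk] := archimedean_nat (80 * M ^+ 4 / eta); pose k := k0.+1.
have kR : 0 < k%:R :> R by rewrite ltr0n.
have kB : 16 * M ^+ 4 / k%:R <= eta / 5.
  have := hk k (leqnSn _); rewrite ler_pdivrMr // => hk'.
  by rewrite ler_pdivrMr //; lra.
pose c := eta / 5 / (2 * k%:R * M ^+ 4).
have c0 : 0 < c by rewrite !divr_gt0 // !mulr_gt0.
have [Nm hm] := @eventually_forall (fun j m => `|cdf_avg (nseq m 2) (grid M k j) - Phi (grid M k j)| <= c) k
  (fun j => binomial_clt (grid M k j) c0).
have [Nm2 hm2] := archimedean_nat (10 / eta).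
pose m := (maxn Nm Nm2).+1.
have mR : 0 < m%:R :> R by rewrite ltr0n.
have mB : 2 / m%:R <= eta / 5.
  have /hm2 : (Nm2 <= m)%N by rewrite /m leqW // leq_maxr.
  by rewrite ler_pdivrMr // => h; rewrite ler_pdivrMr //; lra.
have [N hN] := @eventually_forall (fun j n => `|cdf_avg (es n) (grid M k j) - Phi (grid M k j)| <= c) k
  (fun j => clt (grid M k j) c c0).
exists N.+1 => n Nn; have [e0 V0] := es0 n (leq_ltn_trans (leq0n _) Nn).
have r0 : all (ltn 0) (nseq m 2) by rewrite all_nseq orbT.
have rV : 0 < Var (nseq m 2) by rewrite total_var_nseq2 divr_gt0.
have := trunc4_compare M0 (ltn0Sn k0 : (0 < k)%N) e0 V0 r0 rV.
have /andP[t1 _] := trunc4_moment M0 e0 V0; have /andP[_ t2] := trunc4_moment M0 r0 rV.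
rewrite !Eavg_pow4 // in t1 t2.
have sum_le : \sum_(j < k) M ^+ 4 * `|cdf_avg (es n) (grid M k j) - cdf_avg (nseq m 2) (grid M k j)| <= eta / 5.
  apply: le_trans (_ : \sum_(j < k) M ^+ 4 * (2 * c) <= _).
    apply: ler_sum => j _; rewrite ler_pM2l //.
    have h1 := hN n (ltnW Nn) j (ltn_ord j).
    have /hm /(_ j (ltn_ord j)) h2 : (Nm <= m)%N by rewrite /m leqW // leq_maxl.
    by move: h1 h2; rewrite !ler_norml; lra.
  rewrite sumr_const card_ord -mulr_natr /c le_eqVlt; apply/orP; left; apply/eqP.
  by field; rewrite !lt0r_neq0.
have kE : kurt (nseq m 2) / Var (nseq m 2) ^+ 2 = 2 / m%:R.
  by rewrite kurt_nseq2 total_var_nseq2; field; rewrite lt0r_neq0.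
by rewrite kE M2 in t2; lra.
Qed.

Lemma clt_necessary (es : nat -> seq nat) (D : nat -> nat) :
  (forall n, (0 < n)%N -> [/\ all (ltn 0) (es n), 0 < Var (es n), (1 < D n)%N & D n \in es n]) ->
  (forall x eta, 0 < eta -> exists N, forall n, (N <= n)%N ->
    `|cdf_avg (es n) x - Phi x| <= eta) ->
  forall eta, 0 < eta -> exists N, forall n, (N <= n)%N ->
    (D n)%:R / Num.sqrt (Var (es n)) <= eta.
Proof.
move=> es0 clt eta eta0; have e4 : 0 < eta ^+ 4 / 128 by rewrite divr_gt0 // exprn_gt0.
have [n n0|N hN] := clt_kurt _ clt e4; first by have [] := es0 n n0.
exists N.+1 => n Nn; have [e0 V0 D1 De] := es0 n (leq_ltn_trans (leq0n _) Nn).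
have s0 : 0 < Num.sqrt (Var (es n)) by rewrite sqrtr_gt0.
have := hN n (ltnW Nn); rewrite ler_pdivrMr ?exprn_gt0 // => kV.
rewrite -(@ler_pXn2r _ 4) ?nnegrE ?divr_ge0 ?(ltW s0) ?(ltW eta0) //.
rewrite expr_div_n ler_pdivrMr ?exprn_gt0 //.
rewrite (sqrt_even_pow 2 V0).
have DK : ((D n)%:R ^+ 4 - 1) / 120 <= kurt (es n).
  rewrite /kurt ler_pM2r ?invr_gt0 // (big_rem _ De) /= lerDl big_seq.
  apply: sumr_ge0 => e /mem_rem ee; rewrite subr_ge0 exprn_ege1 // ler1n.
  exact: (allP e0 _ ee).
have D2 : 16 <= (D n)%:R ^+ 4 :> R.
  by rewrite -(_ : 2%:R ^+ 4 = 16 :> R) ?lerXn2r ?nnegrE ?ler0n ?ler_nat // -natrX.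
by move: kV DK; rewrite mulrAC; lra.
Qed.

End Necessity.

(** * From inversion polynomials to uniform variables *)

Section Pairing.
Local Open Scope ring_scope.
Variable R : realType.
Implicit Types (g : R -> R) (x : R) (p q : {poly R}) (es : seq nat).

(** The linear functional that sends X^k to [g (x + k)]. It turns the product formula into the law
    of the inversion number, each factor becoming a uniform average after recentring. *)
Definition pairing g x p : R := \sum_(k < size p) p`_k * g (x + k%:R).

Lemma pairing_widen N g x p : (size p <= N)%N ->
  pairing g x p = \sum_(k < N) p`_k * g (x + k%:R).
Proof.
move=> pN; rewrite /pairing (big_ord_widen N (fun k => p`_k * g (x + k%:R)) pN).
rewrite big_mkcond; apply: eq_bigr => k _; case: ltnP => // pk.
by rewrite nth_default // mul0r.
Qed.

Lemma pairingD g x p q : pairing g x (p + q) = pairing g x p + pairing g x q.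
Proof.
pose N := maxn (size p) (size q).
rewrite (pairing_widen g x (size_polyD p q)) (pairing_widen g x (leq_maxl _ _ : _ <= N)%N).
rewrite (pairing_widen g x (leq_maxr _ _ : _ <= N)%N) -big_split.
by apply: eq_bigr => k _; rewrite coefD mulrDl.
Qed.

Lemma pairing_sum (I : Type) (r : seq I) (F : I -> {poly R}) g x :
  pairing g x (\sum_(i <- r) F i) = \sum_(i <- r) pairing g x (F i).
Proof.
elim: r => [|i r IH]; last by rewrite !big_cons pairingD IH.
by rewrite !big_nil /pairing size_poly0 big_ord0.
Qed.

Lemma pairingXnM k g x p : pairing g x ('X^k * p) = pairing g (x + k%:R) p.
Proof.
have sz : (size ('X^k * p)%R <= k + size p)%N.
  by apply: leq_trans (size_polyMleq _ _) _; rewrite size_polyXn.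
rewrite (pairing_widen _ _ sz) big_split_ord big1 => [|i _]; last first.
  by rewrite coefXnM /= ltn_ord mul0r.
rewrite /= add0r; apply: eq_bigr => i _.
by rewrite coefXnM ltnNge leq_addr /= addKn natrD addrA.
Qed.

Lemma pairingXn k g x : pairing g x 'X^k = g (x + k%:R).
Proof.
by rewrite -['X^k]mulr1 pairingXnM /pairing size_poly1 big_ord1 coef1 mul1r addr0.
Qed.

Definition mean es : R := \sum_(e <- es) (e%:R - 1) / 2.

Lemma pairing_prod es g x : all (ltn 0) es ->
  pairing g x (\prod_(e <- es) \sum_(j < e) 'X^j) =
  (\prod_(e <- es) e)%N%:R * Uall es g (x + mean es).
Proof.
elim: es x => [|e es IH] x /=.
  by rewrite /mean !big_nil -(expr0 'X) pairingXn addr0 mul1r.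
move=> /andP[e0 es0]; rewrite !big_cons mulr_suml pairing_sum natrM.
have e1 : e%:R != 0 :> R by rewrite pnatr_eq0 -lt0n.
rewrite (eq_bigr _ (fun (j : 'I_e) _ => etrans (pairingXnM j g x _) (IH (x + j%:R) es0))).
rewrite -mulr_sumr /Uavg mulrAC [RHS]mulrC; congr (_ * _).
rewrite mulrC divfK //.
apply: eq_bigr => j _; congr (Uall _ _ _).
by rewrite /mean big_cons /node; ring.
Qed.

End Pairing.

Section InversionLaw.
Local Open Scope ring_scope.
Variables (R : realType) (n : nat) (W : seq 'M[R]_n) (v : 'cV[R]_n) (es : seq nat).
Hypothesis es0 : all (ltn 0) es.
Hypothesis WE : \sum_(w <- W) 'X^(ninv W v w) = \prod_(e <- es) \sum_(j < e) 'X^j :> {poly R}.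
Hypothesis W1 : (1 < size W)%N.

Lemma sum_ninv (g : R -> R) :
  (\sum_(w <- W) g (ninv W v w)%:R) / (size W)%:R = Uall es g (mean R es).
Proof.
have key h : \sum_(w <- W) h (ninv W v w)%:R = (\prod_(e <- es) e)%N%:R * Uall es h (mean R es).
  have := congr1 (pairing h 0) WE; rewrite pairing_sum pairing_prod // add0r => <-.
  by apply: eq_bigr => w _; rewrite pairingXn add0r.
have sE : (size W)%:R = (\prod_(e <- es) e)%N%:R :> R.
  have := key (fun=> 1); rewrite Uall_const // mulr1 => <-.
  by rewrite big_const_seq count_predT iter_addr_0.
rewrite key -sE mulrC mulKf // pnatr_eq0 -lt0n; exact: ltnW.
Qed.

Lemma inv_meanE : inv_mean W v = mean R es.
Proof. by rewrite /inv_mean (sum_ninv id) Uall_id. Qed.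

Lemma inv_varE : inv_var W v = total_var R es.
Proof.
rewrite /inv_var inv_meanE (sum_ninv (fun y => (y - mean R es) ^+ 2)).
by rewrite (Uall_shift es (fun y => y ^+ 2)) subrr Uall_pow2 // expr0n add0r.
Qed.

(** At X = 1 the product formula says that the order of the group is the product of the degrees; if
    all were 1 the group would be trivial. *)
Lemma exists_ge2 : has (ltn 1) es.
Proof.
apply: contraT => /hasPn es1; suff : (size W)%:R = 1 :> R.
  by move/eqP; rewrite pnatr_eq1 => /eqP sW; have := W1; rewrite sW.
have := congr1 (horner^~ 1) WE; rewrite horner_sum horner_prod big_seq.
under eq_bigr do rewrite hornerXn expr1n.
rewrite -big_seq big_const_seq count_predT iter_addr_0 => ->.
rewrite big_seq big1 // => e ee; have := es1 e ee; have := allP es0 e ee.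
rewrite /= -leqNgt => e0 e1; have -> : e = 1%N by apply/eqP; rewrite eqn_leq e1.
by rewrite big_ord1 hornerXn expr1n.
Qed.

Lemma total_var_gt0 : 0 < total_var R es.
Proof.
have /hasP[e ee e1] := exists_ge2; rewrite /total_var (big_rem _ ee) /= ltr_pwDl //.
  rewrite /unif_var divr_gt0 // subr_gt0 exprn_egt1 //; rewrite ltr1n //.
by rewrite big_seq; apply: sumr_ge0 => i /mem_rem /(allP es0); apply: unif_var_ge0.
Qed.

Lemma std_inv_cdfE a : std_inv_cdf W v a = cdf_avg es a.
Proof.
have s0 : 0 < Num.sqrt (total_var R es) by rewrite sqrtr_gt0 total_var_gt0.
rewrite /std_inv_cdf inv_meanE inv_varE.
pose g (y : R) : R := (y - mean R es <= a * Num.sqrt (total_var R es))%R%:R.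
have -> : (count (fun w => (((ninv W v w)%:R - mean R es) / Num.sqrt (total_var R es) <= a)%R) W)%:R =
    \sum_(w <- W) g (ninv W v w)%:R.
  rewrite -sum1_count big_mkcond natr_sum; apply: eq_bigr => w _.
  by rewrite ler_pdivrMr // /g; case: ifP.
rewrite sum_ninv /cdf_avg /g.
by rewrite (Uall_shift es (fun y => (y <= a * Num.sqrt (total_var R es))%R%:R)) subrr.
Qed.

End InversionLaw.

Lemma cvg_natP (R : realType) (u : nat -> R) (l : R) :
  (u @ \oo --> l)%classic <->
  (forall eta, (0 < eta)%R -> exists N, forall n, (N <= n)%N -> (`|u n - l| <= eta)%R).
Proof.
split=> [/cvgrPdist_le h eta eta0|h].
  by have [N _ hN] := h eta eta0; exists N => n Nn; rewrite distrC; apply: hN.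
apply/cvgrPdist_le => eta eta0; have [N hN] := h eta eta0.
by exists N => // n Nn; rewrite /= distrC; apply: hN.
Qed.

Local Open Scope classical_set_scope.
Local Open Scope ring_scope.

Theorem theorem6p1 (R : realType) (W : forall n, seq 'M[R]_n)
  (v : forall n, 'cV[R]_n) (d : nat -> nat) :
  (forall n, (0 < n)%N -> finite_coxeter_group_rank (W n)) ->
  (forall n, (0 < n)%N -> generic_for (W n) (v n)) ->
  (forall n, (0 < n)%N -> max_degree (W n) (d n)) ->
  satisfies_CLT W v <->
  (fun n => (d n)%:R / Num.sqrt (inv_var (W n) (v n))) @ \oo --> (0 : R).
Proof.
move=> cox gen deg.
have /boolp.choice[es esP] n : exists es : seq nat, (0 < n)%N ->
    [/\ all (ltn 0) es, d n = (\max_(e <- es) e)%N &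
     \sum_(w <- W n) 'X^(ninv (W n) (v n) w) = \prod_(e <- es) \sum_(j < e) 'X^j :> {poly R}].
  (* The hypotheses concern positive ranks only; at rank 0 the list is a placeholder, which the
     limits do not see. *)
  have [n0|n0] := posnP n; first by exists [::]; rewrite n0.
  have [e [e0 dE WE]] := coxeter_poincare n0 (cox n n0) (gen n n0) (deg n n0).
  exists [seq e i | i <- enum 'I_n] => _; split.
  - by apply/allP => _ /mapP[i _ ->]; apply: e0.
  - by rewrite dE big_map big_enum.
  - by rewrite WE big_map big_enum.
have fact n : (0 < n)%N -> [/\ all (ltn 0) (es n), 0 < total_var R (es n),
    inv_var (W n) (v n) = total_var R (es n) &
    forall a, std_inv_cdf (W n) (v n) a = cdf_avg (es n) a].
  move=> n0; have [e0 dE WE] := esP n n0; have W1 := coxeter_nontrivial n0 (cox n n0).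
  by split=> // [||a]; [exact: total_var_gt0 WE W1|exact: inv_varE WE W1|exact: std_inv_cdfE WE W1 a].
have d_bounds n : (0 < n)%N ->
    [/\ (1 < d n)%N, d n \in es n & all (fun e => e <= d n)%N (es n)].
  move=> n0; have [e0 dE WE] := esP n n0; have W1 := coxeter_nontrivial n0 (cox n n0).
  have le e : e \in es n -> (e <= d n)%N by move=> ee; rewrite dE; apply: leq_bigmax_seq.
  have /hasP[e ee e1] := exists_ge2 e0 WE W1.
  split; [exact: leq_trans e1 (le e ee)| |exact/allP].
  (* Positivity is carried through the induction on the maximum, since its neutral value 0 is not an
     entry of the list. *)
  rewrite dE big_seq; have : (0 < \max_(i <- es n | i \in es n) i)%N.
    by rewrite -big_seq -dE (leq_trans _ (le e ee)) // ltnW.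
  elim/big_ind : _ => // x y hx hy.
  by rewrite /maxn; case: ifP.
split=> [clt|small].
  apply/cvg_natP => eta eta0.
  have [n n0|x c c0|N hN] := @clt_necessary R es d _ _ eta eta0.
  - by have [? ? _ _] := fact n n0; have [] := d_bounds n n0.
  - have /cvg_natP/(_ c c0)[N hN] := clt x.
    exists N.+1 => n Nn; have [_ _ _ <-] := fact n (leq_ltn_trans (leq0n _) Nn).
    exact: hN (ltnW Nn).
  exists N.+1 => n Nn; have [_ V0 -> _] := fact n (leq_ltn_trans (leq0n _) Nn).
  by rewrite subr0 ger0_norm ?divr_ge0 ?sqrtr_ge0 //; apply: hN (ltnW Nn).
move=> x; apply/cvg_natP => eta eta0.
have [delta d0 h] := cdf_avg_close x eta0.
have /cvg_natP/(_ delta d0)[N hN] := small.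
exists N.+1 => n Nn; have n0 := leq_ltn_trans (leq0n _) Nn.
have [e0 V0 VE ->] := fact n n0; have [_ _ dle] := d_bounds n n0.
apply: h e0 dle V0 _; have := hN n (ltnW Nn).
by rewrite subr0 VE ger0_norm ?divr_ge0 ?sqrtr_ge0.
Qed.
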